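(* Let $\alpha>0$ and $\beta>0$. Let $f:\mathcal H\to\mathbb R\cup\{+\infty\}$ be a proper, lower semicontinuous, convex function on a real Hilbert space $\mathcal H$ with $\inf_{\mathcal H} f > -\infty$. Suppose that $e(\cdot)\in W^{1,1}(t_0,T;\mathcal H)$ for all $T > t_0$, with $\int_{t_0}^{+\infty} \| e(t)\|\,dt <+\infty$ and $\int_{t_0}^{+\infty} \| \dot{e}(t)\|\,dt <+\infty$. Let $(x,y):[t_0,+\infty[\to\mathcal H\times\mathcal H$ be a global strong solution of \[ \begin{cases} \dot x(t)+\beta(\partial f(x(t)) + e(t)) -\left(\frac{1}{\beta}-\frac{\alpha}{t}\right)x(t)+\frac{1}{\beta}y(t) \ni 0, \\ \dot{y}(t) -\left(\frac{1}{\beta}-\frac{\alpha}{t}+\frac{\alpha\beta}{t^2}\right)x(t) +\frac{1}{\beta} y(t) = 0, \end{cases} \] and let $\xi(t)\in\partial f(x(t))$ be such that $\dot x(t)+\beta\xi(t) + \beta e(t)-\left(\frac{1}{\beta}-\frac{\alpha}{t}\right)x(t)+\frac{1}{\beta}y(t)=0$ for almost every $t>t_0$. Set $\dot u(t) = -\beta e(t) +\left(\frac{1}{\beta}-\frac{\alpha}{t}\right)x(t)-\frac{1}{\beta}y(t)$ (so $\dot u(t)=\dot x(t)+\beta\xi(t)$ a.e.) and \[ W(t) = \frac{1}{2}\|\dot u(t)\|^2 + f (x(t)) - \int_t^{+\infty} \langle \dot{u}(\tau),e(\tau) +\beta \dot{e}(\tau)\rangle\, d\tau. \] Then: (i) $W$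 is well-defined and non-increasing on $[t_1,+\infty[$ for some $t_1 \geq t_0$. (ii) $\int_{t_0}^{+\infty}\frac{1}{t}\|\dot x(t)\|^2dt<+\infty$ and $\int_{t_0}^{+\infty}\frac{1}{t}\|\xi(t)\|^2dt<+\infty$. (iii) $\lim_{t\to+\infty}W(t)=\lim_{t\to+\infty}f(x(t))=\inf_{\mathcal H} f$, and $\lim_{t\to+\infty}\|\dot x(t) +\beta \xi(t)\|=0$. (iv) As $t\to+\infty$, every sequential weak cluster point of $x(t)$ belongs to $S=\operatorname{argmin} f$. (v) If, moreover, $S\neq\emptyset$ and $\int_{t_0}^{+\infty} \log t \, \| e(t)\|\,dt <+\infty$ and $\int_{t_0}^{+\infty} \log t \, \| \dot{e}(t)\|\,dt < +\infty$, then (a) $f(x(t))-\inf_{\mathcal H} f=\mathcal O\left(\frac{1}{\log t}\right)$ and $\|\dot u(t)\|=\mathcal O\left(\frac{1}{\sqrt{\log t}}\right)$ as $t \to +\infty$; (b) $\int_{t_0}^{+\infty}\frac{1}{t}(f(x(t))-\inf_{\mathcal H} f)\,dt < +\infty$.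
   Context: A strong solution means: $(x,y)$ is continuous on $[t_0,T]$ and absolutely continuous on compact subsets of $]t_0,T]$, $x(t)\in\operatorname{dom}(\partial f)$ and the differential inclusion holds for almost every $t$, for every $T>t_0$. Existence and uniqueness of such a solution for Cauchy data $(x_0,y_0)\in\operatorname{dom}(f)\times\mathcal H$ hold, together with the existence of the function $\xi$ with $\xi(t)\in\partial f(x(t))$, $\xi\in L^2(t_0,T;\mathcal H)$ and $\frac{d}{dt}f(x(t))=\langle\xi(t),\dot x(t)\rangle$ a.e. *)

(* Defs.v *)
From HB Require Import structures.
From mathcomp Require Import all_boot all_order all_algebra.
From mathcomp Require Import all_classical all_reals all_analysis.

Set Implicit Arguments.
Unset Strict Implicit.
Unset Printing Implicit Defensive.

Import Order.TTheory GRing.Theory Num.Theory.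
Import numFieldNormedType.Exports.
Local Open Scope classical_set_scope.
Local Open Scope ring_scope.

Section Defs.
Context {R : realType} {H : normedModType R}.

(** [ip] is an inner product on [H] inducing the norm of [H]
    (together with completeness of [H], H is a real Hilbert space). *)
Definition is_inner_product (ip : H -> H -> R) : Prop :=
  (forall x y, ip x y = ip y x) /\
  (forall (a : R) x y z, ip (a *: x + y) z = a * ip x z + ip y z) /\
  (forall x, ip x x = `|x| ^+ 2).

Definition proper_fun (f : H -> \bar R) : Prop :=
  (forall x, f x != -oo%E) /\ (exists x, f x \is a fin_num).

Definition convex_fun (f : H -> \bar R) : Prop :=
  forall (x y : H) (l : R), 0 <= l <= 1 ->
    (f (l *: x + (1 - l) *: y)%R <= l%:E * f x + (1 - l)%:E * f y)%E.

Definition lsc_fun (f : H -> \bar R) : Prop :=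
  forall (x : H) (a : R), (a%:E < f x)%E -> \forall z \near x, (a%:E < f z)%E.

Definition inf_fun (f : H -> \bar R) : \bar R := ereal_inf (range f).

Definition argmin (f : H -> \bar R) : set H :=
  [set z | forall w, (f z <= f w)%E].

Definition subdiff (ip : H -> H -> R) (f : H -> \bar R) (x xi : H) : Prop :=
  f x \is a fin_num /\
  forall z, ((fine (f x) + ip xi (z - x)%R)%R%:E <= f z)%E.

Definition abs_cont_on (a b : R) (g : R -> H) : Prop :=
  forall eps : R, 0 < eps -> exists delta : R, 0 < delta /\
    forall (n : nat) (s : 'I_n -> R * R),
      (forall i, a <= (s i).1 <= (s i).2 /\ (s i).2 <= b) ->
      (forall i j : 'I_n, (i < j)%N -> (s i).2 <= (s j).1) ->
      \sum_(i < n) ((s i).2 - (s i).1) < delta ->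
      \sum_(i < n) `|g (s i).2 - g (s i).1| < eps.

Definition weak_cvg (ip : H -> H -> R) (u : nat -> H) (l : H) : Prop :=
  forall v, (fun n => ip (u n) v) @ \oo --> ip l v.

Definition udot (alpha beta : R) (e x y : R -> H) (t : R) : H :=
  - (beta *: e t) + (beta^-1 - alpha / t) *: x t - beta^-1 *: y t.

Definition Wfun (ip : H -> H -> R) (f : H -> \bar R) (alpha beta : R)
    (e de x y : R -> H) (t : R) : \bar R :=
  ((2^-1 * `|udot alpha beta e x y t| ^+ 2)%:E + f (x t)
   - \int[@completed_lebesgue_measure R]_(s in [set s : R | (t <= s)%R])
        (ip (udot alpha beta e x y s) (e s + beta *: de s))%:E)%E.

End Defs.

(* Main.v *)
(* Write [g = x' + beta xi]. Differentiating [g] gives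
   [g' = - (alpha / t) x' - xi - e - beta e'], whence the energy
   [E = |g|^2 / 2 + f(x) - inf f] satisfies, for [t >= alpha beta],
   [E' <= - (alpha / 2t) |x'|^2 - (beta / 2) |xi|^2 - <g, e + beta e'>].
   Gronwall's lemma bounds [E], which yields the monotonicity of [W] and the
   integrability statements. For [f z] finite, a Lyapunov function built from
   [<g, y - z> / t], [|y - z|^2 / t^2] and [|y - x|^2 / t], corrected by
   multiples of [E], of [int (|e| + beta |e'|)] and of [1 / t], decreases at
   least like [(1/t - alpha beta / t^2) (E - (f z - inf f))] and is bounded
   below; as [1/t] is not integrable, [E] tends to [0]. When [z] minimizes [f],
   comparing with [ln t * E] gives the logarithmic rates.

   The chain rule for [f(x(t))] is not assumed: monotonicity of the
   subdifferential makes [x] locally Lipschitz on [ ]t0, +oo[ ], hence so is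
   [f(x(t))], and the subgradient inequality supplies touching minorants, which
   are enough to compare absolutely continuous functions. *)
Require Import Defs.
From HB Require Import structures.
From mathcomp Require Import all_boot all_order all_algebra.
From mathcomp Require Import all_classical all_reals all_analysis.
From mathcomp Require Import measurable_realfun.
From mathcomp Require Import ring lra.
Import Order.TTheory GRing.Theory Num.Theory.
Import numFieldNormedType.Exports.
Local Open Scope classical_set_scope.
Local Open Scope ring_scope.

Set Implicit Arguments.
Unset Strict Implicit.
Unset Printing Implicit Defensive.

(** * Absolute continuity on intervals and differentiation of vector-valued functions *)

Section AbsCont.
Context {R : realType}.
Implicit Types (a b s t : R).

(** The data are known only almost everywhere for the completed Lebesgue measure, and [x] is
    absolutely continuous only away from [t0]. Everything is therefore reduced to one tool: an
    absolutely continuous function whose slope is nonpositive at almost every point does not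
    increase. Integrals enter only through primitives of real functions; vector increments are
    tested against a fixed vector, which avoids integrals with values in [H]. Measurability of the
    integrands built from [x'], [xi] and [e'] is recovered from a.e. limits of continuous difference
    quotients, because the measure is complete. The neighbourhood of [t0] is treated apart:
    finiteness of [f (x t0)] and continuity of [x] at [t0] bound [f (x t)] there, and its decrease
    pays for [|xi|^2]; beyond [t1] the energy pays. As [inf f] may not be attained, [z] is taken
    with [f z] close to [inf f]. The Lyapunov function then shows only that the energy is small at
    arbitrarily late times; that it stays small follows from its being monotone up to a multiple of
    a bounded increasing function. *)

Lemma ac_sub (V : normedModType R) a b a' b' (g : R -> V) :
  a <= a' -> b' <= b -> abs_cont_on a b g -> abs_cont_on a' b' g.
Proof.
move=> aa bb ac eps eps0; have [d [d0 Hd]] := ac _ eps0.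
exists d; split=> // n s Hs so sd; apply: Hd => // i.
have [/andP[h1 h2] h3] := Hs i; split; last exact: le_trans h3 bb.
by rewrite h2 (le_trans aa h1).
Qed.

(** Reduces every closure property below (sums, products, inner products, composition) to a
    pointwise estimate of increments. *)
Lemma ac_dom2 (V V1 V2 : normedModType R) (a b C : R) (phi : R -> V)
    (g : R -> V1) (k : R -> V2) :
  (forall s t, a <= s -> s <= t -> t <= b ->
     `|phi t - phi s| <= C * (`|g t - g s| + `|k t - k s|)) ->
  abs_cont_on a b g -> abs_cont_on a b k -> abs_cont_on a b phi.
Proof.
move=> dom acg ack eps eps0.
pose K := `|C| + 1.
have K0 : 0 < K by rewrite ltr_wpDl.
have e0 : 0 < eps / K / 2 by rewrite !divr_gt0.
have [d1 [d10 H1]] := acg _ e0; have [d2 [d20 H2]] := ack _ e0.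
exists (Num.min d1 d2); split; first by rewrite lt_min d10.
move=> n s Hs so; rewrite lt_min => /andP[s1 s2].
apply: (@le_lt_trans _ _ (\sum_(i < n) K *
  (`|g (s i).2 - g (s i).1| + `|k (s i).2 - k (s i).1|))).
  apply: ler_sum => i _; have [/andP[h1 h2] h3] := Hs i.
  apply: (le_trans (dom _ _ h1 h2 h3)); apply: ler_wpM2r; first exact: addr_ge0.
  by rewrite /K (le_trans (ler_norm C))// lerDl.
rewrite -mulr_sumr big_split /= -ltr_pdivlMl// mulrC [ltRHS]splitr.
by apply: ltrD; [exact: H1|exact: H2].
Qed.

Lemma ac_dom1 (V V1 : normedModType R) (a b C : R) (phi : R -> V)
    (g : R -> V1) :
  (forall s t, a <= s -> s <= t -> t <= b ->
     `|phi t - phi s| <= C * `|g t - g s|) ->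
  abs_cont_on a b g -> abs_cont_on a b phi.
Proof.
move=> dom acg; apply: (@ac_dom2 _ _ _ a b (`|C|) phi g g) => // s t h1 h2 h3.
apply: (le_trans (dom _ _ h1 h2 h3)).
apply: (@le_trans _ _ (`|C| * `|g t - g s|)).
  by apply: ler_wpM2r => //; exact: ler_norm.
by apply: ler_wpM2l => //; rewrite lerDl.
Qed.

Lemma ac_id a b : abs_cont_on a b (fun t : R => t).
Proof.
move=> eps eps0; exists eps; split=> // n s Hs so; congr (_ < _).
apply: eq_bigr => i _; have [/andP[h1 h2] h3] := Hs i.
by rewrite ger0_norm// subr_ge0.
Qed.

Lemma ac_lip (V : normedModType R) (a b C : R) (phi : R -> V) :
  (forall s t, a <= s -> s <= t -> t <= b -> `|phi t - phi s| <= C * (t - s)) ->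
  abs_cont_on a b phi.
Proof.
move=> lip; apply: (ac_dom1 (C := C)) (ac_id a b) => s t h1 h2 h3.
by rewrite [`|t - s|]ger0_norm ?subr_ge0//; exact: lip.
Qed.

Lemma ac_cst (V : normedModType R) a b (v : V) : abs_cont_on a b (fun=> v).
Proof. by apply: (ac_lip (C := 0)) => s t _ _ _; rewrite subrr normr0 mul0r. Qed.

Lemma acD (V : normedModType R) a b (g k : R -> V) :
  abs_cont_on a b g -> abs_cont_on a b k ->
  abs_cont_on a b (fun t => g t + k t).
Proof.
apply: (ac_dom2 (C := 1)) => s t _ _ _; rewrite mul1r.
by rewrite opprD addrACA; exact: ler_normD.
Qed.

Lemma acN (V : normedModType R) a b (g : R -> V) :
  abs_cont_on a b g -> abs_cont_on a b (fun t => - g t).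
Proof.
by apply: (ac_dom1 (C := 1)) => s t _ _ _; rewrite mul1r -opprD normrN.
Qed.

Lemma acB (V : normedModType R) a b (g k : R -> V) :
  abs_cont_on a b g -> abs_cont_on a b k ->
  abs_cont_on a b (fun t => g t - k t).
Proof. by move=> hg hk; apply: acD => //; exact: acN. Qed.

Lemma ac_cont (V : normedModType R) a b (g : R -> V) : abs_cont_on a b g ->
  forall s eps, a <= s <= b -> 0 < eps -> exists2 d : R, 0 < d &
    forall t, a <= t <= b -> `|t - s| < d -> `|g t - g s| < eps.
Proof.
move=> ac s eps /andP[as_ sb] eps0; have [d [d0 Hd]] := ac _ eps0.
exists d => // t /andP[at_ tb] ts.
have H u v : a <= u -> u <= v -> v <= b -> v - u < d -> `|g v - g u| < eps.
  move=> h1 h2 h3 h4.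
  have := Hd 1%N (fun=> (u, v)); rewrite !big_ord1 /=; apply=> //.
  - by move=> i; rewrite h1 h2 h3.
  - by move=> i j; rewrite !ord1.
have [st|ts'] := leP s t; first by apply: H => //; rewrite -[ltLHS]ger0_norm// subr_ge0.
rewrite distrC; apply: (H t s at_ (ltW ts') sb).
by rewrite -[ltLHS]ger0_norm ?subr_ge0 1?ltW// distrC.
Qed.

Lemma ac_within (V : normedModType R) a b (g : R -> V) :
  abs_cont_on a b g -> {within `[a, b], continuous g}.
Proof.
move=> ac; apply/subspace_continuousP => s /=; rewrite in_itv/= => sab.
apply/cvgrPdist_lt => eps eps0.
have [d d0 Hd] := ac_cont ac sab eps0.
rewrite near_withinE; apply/nbhs_normP; exists d => //= t /= ts.
rewrite in_itv/= => tab; rewrite distrC; apply: Hd => //.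
by rewrite distrC.
Qed.

Lemma within_bounded (V : normedModType R) a b (g : R -> V) :
  {within `[a, b], continuous g} ->
  exists2 K : R, 0 <= K & forall t, a <= t <= b -> `|g t| <= K.
Proof.
move=> cg; have [ab|ba] := leP a b; last first.
  by exists 0 => // t /andP[h1 h2]; have := le_lt_trans (le_trans h1 h2) ba; rewrite ltxx.
have cn : {within `[a, b], continuous (fun t => `|g t|)}.
  by move=> t; apply: cvg_norm; exact: cg.
have [c cab Hc] := EVT_max ab cn.
by exists `|g c| => // t tab; apply: Hc; rewrite in_itv.
Qed.

Lemma ac_bounded (V : normedModType R) a b (g : R -> V) : abs_cont_on a b g ->
  exists2 K : R, 0 <= K & forall t, a <= t <= b -> `|g t| <= K.
Proof. by move=> /ac_within /within_bounded. Qed.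

Lemma ac_scale (V : normedModType R) a b (c : R -> R) (g : R -> V) :
  abs_cont_on a b c -> abs_cont_on a b g ->
  abs_cont_on a b (fun t => c t *: g t).
Proof.
move=> acc acg; have [K K0 HK] := ac_bounded acc; have [L L0 HL] := ac_bounded acg.
apply: (ac_dom2 (C := K + L)) acc acg => s t h1 h2 h3.
have -> : c t *: g t - c s *: g s = (c t - c s) *: g t + c s *: (g t - g s).
  by rewrite scalerBl scalerBr addrA subrK.
apply: (le_trans (ler_normD _ _)); rewrite !normrZ mulrDr.
apply: lerD.
  rewrite mulrC; apply: ler_wpM2r => //; rewrite (le_trans (HL t _))//.
    by rewrite h3 (le_trans h1 h2).
  by rewrite lerDr.
apply: ler_wpM2r => //; rewrite (le_trans (HK s _))//.
  by rewrite h1 (le_trans h2 h3).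
by rewrite lerDl.
Qed.

Lemma acM a b (c g : R -> R) :
  abs_cont_on a b c -> abs_cont_on a b g ->
  abs_cont_on a b (fun t => c t * g t).
Proof. by move=> hc hg; exact: (ac_scale hc hg). Qed.

Lemma ac_comp a b (K : R) (F c : R -> R) (L : R) :
  (forall t, a <= t <= b -> `|c t| <= K) ->
  (forall u v, `|u| <= K -> `|v| <= K -> u <= v -> `|F v - F u| <= L * (v - u)) ->
  abs_cont_on a b c -> abs_cont_on a b (fun t => F (c t)).
Proof.
move=> HK HF; apply: (ac_dom1 (C := L)) => s t h1 h2 h3.
have hs : `|c s| <= K by apply: HK; rewrite h1 (le_trans h2).
have ht : `|c t| <= K by apply: HK; rewrite h3 (le_trans h1).
have [st|ts] := leP (c s) (c t).
  by rewrite [`|c t - _|]ger0_norm ?subr_ge0//; exact: HF.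
rewrite distrC (distrC (c t)) [`|c s - c t|]ger0_norm ?subr_ge0; last exact: ltW.
by apply: HF => //; exact: ltW.
Qed.

Lemma ac_inv a b : 0 < a -> abs_cont_on a b (fun t : R => t^-1).
Proof.
move=> a0; apply: (ac_lip (C := a^-1 * a^-1)) => s t h1 h2 h3.
have s0 : 0 < s := lt_le_trans a0 h1; have t0 : 0 < t := lt_le_trans s0 h2.
have -> : t^-1 - s^-1 = - (t^-1 * s^-1 * (t - s)) by field; rewrite !gt_eqF.
rewrite normrN normrM [`|t - s|]ger0_norm ?subr_ge0//.
apply: ler_wpM2r; first by rewrite subr_ge0.
rewrite ger0_norm; last by rewrite mulr_ge0// invr_ge0 ltW.
by apply: ler_pM; rewrite ?invr_ge0 ?(ltW s0) ?(ltW t0)// lef_pV2 ?posrE// (le_trans h1).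
Qed.

Lemma is_derive_cvg (V : normedModType R) (g : R -> V) t dg :
  is_derive t 1 g dg <->
  h^-1 *: (g (h + t) - g t) @[h --> 0^'] --> dg.
Proof.
have E : (fun h : R => h^-1 *: ((g \o shift t) (h *: 1) - g t)) =
         (fun h : R => h^-1 *: (g (h + t) - g t)).
  by apply/funext => h /=; rewrite [h *: 1]mulr1.
split=> [[dv <-]|cv].
  by rewrite /derivable E in dv; rewrite /derive E; exact: dv.
by split; [rewrite /derivable E; apply/cvg_ex; exists dg|rewrite /derive E; exact/cvg_lim].
Qed.

Lemma is_derive_epsP (V : normedModType R) (g : R -> V) t dg :
  is_derive t 1 g dg <->
  forall eps : R, 0 < eps -> exists2 d : R, 0 < d &
    forall s, `|s - t| < d -> `|g s - g t - (s - t) *: dg| <= eps * `|s - t|.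
Proof.
rewrite is_derive_cvg; split.
  move=> /cvgrPdist_le cv eps eps0; have := cv _ eps0.
  rewrite near_withinE => /nbhs_normP[d /= d0 Hd]; exists d => // s sd.
  have [->|st] := eqVneq s t; first by rewrite !subrr scale0r subrr !normr0 mulr0.
  have st0 : s - t != 0 by rewrite subr_eq0.
  have := Hd (s - t); rewrite /= sub0r normrN => /(_ sd st0).
  rewrite subrK distrC.
  have -> : (s - t)^-1 *: (g s - g t) - dg = (s - t)^-1 *: (g s - g t - (s - t) *: dg).
    by rewrite [in RHS]scalerBr scalerA mulVf// scale1r.
  by rewrite normrZ normfV mulrC ler_pdivrMr// normr_gt0.
move=> he; apply/cvgrPdist_le => eps eps0; have [d d0 Hd] := he _ eps0.
rewrite near_withinE; apply/nbhs_normP; exists d => //= h /=.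
rewrite sub0r normrN => hd h0.
have := Hd (h + t); rewrite addrK => /(_ hd).
have -> : dg - h^-1 *: (g (h + t) - g t) = - (h^-1 *: (g (h + t) - g t - h *: dg)).
  by rewrite [in RHS]scalerBr scalerA mulVf// scale1r opprB.
by rewrite normrN normrZ normfV [_^-1 * _]mulrC ler_pdivrMr// normr_gt0.
Qed.

(** * Inner product calculus *)

Section InnerProduct.
Context {H : normedModType R} {ip : H -> H -> R} (hip : is_inner_product ip).

Lemma ipC x y : ip x y = ip y x. Proof. by case: hip. Qed.
Lemma ipZDl c x y z : ip (c *: x + y) z = c * ip x z + ip y z.
Proof. by case: hip => _ []. Qed.
Lemma ipxx x : ip x x = `|x| ^+ 2. Proof. by case: hip => _ []. Qed.
Lemma ipDl x y z : ip (x + y) z = ip x z + ip y z.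
Proof. by rewrite -[x in LHS]scale1r ipZDl mul1r. Qed.
Lemma ip0l z : ip 0 z = 0.
Proof. by have := ipDl 0 0 z; rewrite addr0 => /eqP; rewrite -subr_eq0 opprD addrA subrr sub0r oppr_eq0 => /eqP. Qed.
Lemma ipZl c x z : ip (c *: x) z = c * ip x z.
Proof. by rewrite -[_ *: x]addr0 ipZDl ip0l addr0. Qed.
Lemma ipNl x z : ip (- x) z = - ip x z.
Proof. by rewrite -scaleN1r ipZl mulN1r. Qed.
Lemma ipBl x y z : ip (x - y) z = ip x z - ip y z.
Proof. by rewrite ipDl ipNl. Qed.
Lemma ipDr x y z : ip z (x + y) = ip z x + ip z y.
Proof. by rewrite ipC ipDl !(ipC z). Qed.
Lemma ip0r z : ip z 0 = 0. Proof. by rewrite ipC ip0l. Qed.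
Lemma ipZr c x z : ip z (c *: x) = c * ip z x.
Proof. by rewrite ipC ipZl ipC. Qed.
Lemma ipNr x z : ip z (- x) = - ip z x.
Proof. by rewrite ipC ipNl ipC. Qed.
Lemma ipBr x y z : ip z (x - y) = ip z x - ip z y.
Proof. by rewrite ipDr ipNr. Qed.

Definition ipE := (ipDl, ipDr, ipNl, ipNr, ipZl, ipZr, ip0l, ip0r).

Lemma ip_ext u v : (forall z, ip u z = ip v z) -> u = v.
Proof.
move=> uv; apply/eqP; rewrite -subr_eq0 -normr_eq0 -sqrf_eq0 -ipxx ipBl uv.
by rewrite subrr.
Qed.

(** Cauchy-Schwarz, by expanding the squared norm of [|y| x - |x| y]. *)
Lemma ip_le x y : ip x y <= `|x| * `|y|.
Proof.
have [->|y0] := eqVneq y 0; first by rewrite ip0r normr0 mulr0.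
have ny : 0 < `|y| by rewrite normr_gt0.
have : 0 <= ip (`|y| *: x - `|x| *: y) (`|y| *: x - `|x| *: y).
  by rewrite ipxx exprn_ge0.
rewrite !ipE !ipxx (ipC y x) => h.
have [->|x0] := eqVneq x 0; first by rewrite ip0l normr0 mul0r.
have nx : 0 < `|x| by rewrite normr_gt0.
have {}h : 0 <= 2 * (`|x| * `|y|) * (`|x| * `|y| - ip x y) by lra.
by move: h; rewrite pmulr_rge0 ?subr_ge0// !mulr_gt0.
Qed.

Lemma ip_norm x y : `|ip x y| <= `|x| * `|y|.
Proof.
by rewrite ler_norml ip_le andbT lerNl -ipNl (le_trans (ip_le _ _))// normrN.
Qed.

Lemma ac_ip a b (g k : R -> H) : abs_cont_on a b g -> abs_cont_on a b k ->
  abs_cont_on a b (fun t => ip (g t) (k t)).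
Proof.
move=> acc acg; have [K K0 HK] := ac_bounded acc; have [L L0 HL] := ac_bounded acg.
apply: (ac_dom2 (C := K + L)) acc acg => s t h1 h2 h3.
have -> : ip (g t) (k t) - ip (g s) (k s) =
    ip (g t - g s) (k t) + ip (g s) (k t - k s).
  by rewrite !ipE; ring.
apply: (le_trans (ler_normD _ _)); rewrite mulrDr.
apply: lerD; apply: (le_trans (ip_norm _ _)).
  rewrite mulrC; apply: ler_wpM2r => //; rewrite (le_trans (HL t _))//.
    by rewrite h3 (le_trans h1 h2).
  by rewrite lerDr.
apply: ler_wpM2r => //; rewrite (le_trans (HK s _))//.
  by rewrite h1 (le_trans h2 h3).
by rewrite lerDl.
Qed.

Lemma cvg_ip T (F : set_system T) (FF : Filter F) (u v : T -> H) (u0 v0 : H) :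
  u h @[h --> F] --> u0 -> v h @[h --> F] --> v0 ->
  ip (u h) (v h) @[h --> F] --> ip u0 v0.
Proof.
move=> cu cv; apply/subr_cvg0/norm_cvg0P.
have c0 : (`|u h - u0| * `|v h| + `|u0| * `|v h - v0|) @[h --> F] --> (0 : R).
  have cu0 : `|u h - u0| @[h --> F] --> (0 : R).
    by apply/norm_cvg0P/subr_cvg0.
  have cv0 : `|v h - v0| @[h --> F] --> (0 : R).
    by apply/norm_cvg0P/subr_cvg0.
  have := cvgD (cvgM cu0 (cvg_norm cv)) (cvgM (cvg_cst (`|u0|)) cv0).
  by rewrite mul0r mulr0 addr0; apply.
apply: squeeze_cvgr c0; last exact: cvg_cst.
apply: nearW => h; rewrite normr_ge0 /=.
have -> : ip (u h) (v h) - ip u0 v0 = ip (u h - u0) (v h) + ip u0 (v h - v0).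
  by rewrite !ipE; ring.
by rewrite (le_trans (ler_normD _ _))// lerD// ip_norm.
Qed.

Lemma is_derive_ip (g k : R -> H) t dg dk :
  is_derive t 1 g dg -> is_derive t 1 k dk ->
  is_derive t 1 (fun s => ip (g s) (k s)) (ip (g t) dk + ip dg (k t)).
Proof.
move=> dg0 dk0; apply/is_derive_cvg.
move: dg0 dk0 => /[dup] Dg /is_derive_cvg cg /[dup] Dk /is_derive_cvg ck.
have cg0 : g (h + t) @[h --> 0^'] --> g t.
  have /differentiable_continuous : differentiable g t.
    by apply/derivable1_diffP; case: Dg.
  move=> cont; apply: (@cvg_comp _ _ _ (fun h => h + t) g _ (nbhs t)) cont.
  have := @cvgD _ _ _ (0^') _ (fun h : R => h) (cst t) (0 : R) t.
  by rewrite add0r; apply; [exact: cvg_within|exact: cvg_cst].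
have -> : (fun h : R => h^-1 *: (ip (g (h + t)) (k (h + t)) - ip (g t) (k t))) =
   (fun h => ip (g (h + t)) (h^-1 *: (k (h + t) - k t)) +
             ip (h^-1 *: (g (h + t) - g t)) (k t)).
  by apply/funext => h; rewrite !ipE /GRing.scale /=; ring.
by apply: cvgD; apply: cvg_ip => //; exact: cvg_cst.
Qed.

End InnerProduct.
End AbsCont.

(** * Null sets of the completed and of the Borel Lebesgue measure *)

Section NullSets.
Context {R : realType}.
Local Notation mu := (@lebesgue_measure R).
Local Notation cmu := (@completed_lebesgue_measure R).

Lemma completed_decomposition (A : set R) :
  (wlength (@idfun R))^*%mu.-cara.-measurable A ->
  exists B N : set R, [/\ @measurable _ (measurableTypeR R) B,
    mu.-negligible N & A = B `|` N].
Proof.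
rewrite -completed_caratheodory_measurable.
rewrite g_sigma_completed_algebra_genE => -[/= B mB [N nN <-]].
by exists B, N.
Qed.

(** With the converse below, both measures have the same null sets, so a.e. statements pass from one
    to the other. *)
Lemma negligible_completed (N : set R) : cmu.-negligible N -> mu.-negligible N.
Proof.
move=> [A [mA A0 NA]]; have [B [N1 [mB nN1 AE]]] := completed_decomposition mA.
apply: (@negligibleS _ (measurableTypeR R) R mu A N NA); rewrite AE.
apply: negligibleU => //.
apply/negligibleP => //; apply/eqP; rewrite eq_le measure_ge0 andbT -A0.
by apply: le_outer_measure; rewrite AE; exact: subsetUl.
Qed.

Lemma negligible_borel (N : set R) : mu.-negligible N -> cmu.-negligible N.
Proof.
by move=> [A [mA A0 NA]]; exists A; split => //; exact: sub_caratheodory.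
Qed.

Lemma null_open_cover (N : set R) (d : R) : cmu.-negligible N -> 0 < d ->
  exists U : set R, [/\ open U, N `<=` U & (mu U < d%:E)%E].
Proof.
move=> /negligible_completed[A [mA A0 NA]] d0.
have hA : (mu A < +oo)%E by rewrite A0 ltry.
have [U [oU AU UA]] := lebesgue_regularity_outer mA hA d0.
exists U; split=> //; first exact: subset_trans NA AU.
have mU : measurable U by exact: open_measurable.
rewrite (_ : U = A `|` (U `\` A)); last by rewrite setDUK.
apply: le_lt_trans (measureU2 _ _ _) _ => //; first exact: measurableD.
by move: UA; rewrite -[X in (X < _)%E -> _]add0e -A0.
Qed.

Lemma ae_imp (P Q : R -> Prop) : (forall t, P t -> Q t) ->
  {ae cmu, forall t, P t} -> {ae cmu, forall t, Q t}.
Proof. by move=> PQ; apply: negligibleS => t /= nQ Pt; exact/nQ/PQ. Qed.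

Lemma ae_and (P Q : R -> Prop) : {ae cmu, forall t, P t} ->
  {ae cmu, forall t, Q t} -> {ae cmu, forall t, P t /\ Q t}.
Proof.
move=> hP hQ; apply: negligibleS (negligibleU hP hQ) => t /= nPQ.
by have [Pt|] := pselect (P t); [right => Qt; exact: nPQ|left].
Qed.

Lemma ae_imp2 (P Q S : R -> Prop) : (forall t, P t -> Q t -> S t) ->
  {ae cmu, forall t, P t} -> {ae cmu, forall t, Q t} -> {ae cmu, forall t, S t}.
Proof.
by move=> PQS hP hQ; apply: ae_imp (ae_and hP hQ) => t [Pt Qt]; exact: PQS.
Qed.

(** An interval of positive length is not null. Points where the differential inclusion holds are
    thus dense, which is how they are used below. *)
Lemma ae_ex (P : R -> Prop) (a b : R) : a < b ->
  {ae cmu, forall t, P t} -> exists2 t, a < t < b & P t.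
Proof.
move=> ab hP; apply: contrapT => nP.
have : cmu.-negligible `]a, b[%classic.
  apply: negligibleS hP => t /=; rewrite in_itv/= => tab Pt.
  by apply: nP; exists t.
move=> /negligible_completed h; 
have : lebesgue_measure `]a, b[%classic = 0%E
  := @measure_negligible _ (measurableTypeR R) R mu _ (measurable_itv _) h.
rewrite lebesgue_measure_itv/= lte_fin ab => /eqP.
by rewrite -EFinD eqe subr_eq0 gt_eqF.
Qed.

(** Translation invariance, drawn from the uniqueness of Lebesgue measure. It allows the system to
    be used at [t] and [t + h] simultaneously. *)
Lemma ae_shift (P : R -> Prop) (h : R) :
  {ae cmu, forall t, P t} -> {ae cmu, forall t, P (t + h)}.
Proof.
move=> /negligible_completed [A [mA A0 NA]].
apply: negligible_borel.
have mh : measurable_fun setT (fun t : measurableTypeR R => t + h : measurableTypeR R).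
  exact: measurable_funD.
exists [set t | A (t + h)]; split.
- by rewrite -[X in measurable X]setTI; exact: mh.
- rewrite -A0; apply/esym.
  change (mu A = pushforward mu (fun t : measurableTypeR R => t + h : measurableTypeR R) A).
  apply: lebesgue_measure_unique => //= _ [[u v]] _ <-.
  rewrite /pushforward (_ : _ @^-1` _ = `]u - h, v - h]%classic); last first.
    by apply/seteqP; split=> r /=; rewrite !in_itv/= ltrBlDr lerBrDr.
  rewrite !lebesgue_measure_itv/= !lte_fin ltrD2r.
  by case: ifP => // _; rewrite -!EFinD; congr (_%:E); lra.
- by move=> t /= nP; apply: NA.
Qed.

End NullSets.

(** * Monotonicity of absolutely continuous functions from a.e. slope bounds *)

Section Monotonicity.
Context {R : realType}.
Local Notation mu := (@lebesgue_measure R).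
Local Notation cmu := (@completed_lebesgue_measure R).

Lemma sum_increments_le (psi : R -> R) (b : R) : {homo psi : s t / s <= t} ->
  forall (n : nat) (a : R) (s : 'I_n -> R * R),
  a <= b ->
  (forall i, a <= (s i).1 <= (s i).2 /\ (s i).2 <= b) ->
  (forall i j : 'I_n, (i < j)%N -> (s i).2 <= (s j).1) ->
  \sum_(i < n) (psi (s i).2 - psi (s i).1) <= psi b - psi a.
Proof.
move=> hpsi; elim=> [|n IH] a s ab Hs so.
  by rewrite big_ord0 subr_ge0 hpsi.
rewrite big_ord_recl /=; have [/andP[h1 h2] h3] := Hs ord0.
have : \sum_(i < n) (psi (s (lift ord0 i)).2 - psi (s (lift ord0 i)).1)
    <= psi b - psi (s ord0).2.
  apply: (IH _ (fun i => s (lift ord0 i))) => //.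
    move=> i; have [/andP[g1 g2] g3] := Hs (lift ord0 i); split=> //.
    by rewrite g2 andbT so.
  by move=> i j ij; apply: so; rewrite /= /bump !leq0n !add1n ltnS.
by have := hpsi _ _ h1; lra.
Qed.

Lemma open_left_segment (U : set R) (c a : R) : open U -> U c -> a < c ->
  exists2 u, a <= u < c & `[u, c]%classic `<=` U.
Proof.
move=> oU Uc ac; have /nbhs_ballP[r /= r0 Hr] : nbhs c U by exact: open_nbhs_nbhs.
exists (Num.max a (c - r / 2)); first by rewrite le_max lexx /= gt_max ac /= ltrBlDr ltrDl divr_gt0.
move=> t /=; rewrite in_itv/= ge_max => /andP[/andP[_ h1] h2].
apply: Hr; rewrite /ball /= ger0_norm ?subr_ge0//.
by rewrite ltrBlDr -ltrBlDl (lt_le_trans _ h1)// ltrD2l ltrN2 ltr_pdivrMr// ltr_pMr// ltr1n.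
Qed.

(* A one-sided derivative bound by touching minorants: the subgradient
   inequality provides them for [f \o x], whose differentiability along the
   trajectory is not known a priori. *)
Definition slope_le (D : set R) (phi : R -> R) (t d : R) : Prop :=
  exists l (dl : R), [/\ l t = phi t, forall s, D s -> l s <= phi s,
    is_derive t 1 l dl & dl <= d].

(** When [psi t] measures the part of an open set [U] lying in []a, t]], the condition on [psi] says
    that each interval lies in [U] up to a null set. The supremum of these sums is the variation of
    [phi] carried by [U] between [t] and [b]. *)
Definition increments_in (psi phi : R -> R) (t b : R) : set R :=
  [set v | exists (n : nat) (s : 'I_n -> R * R),
    [/\ forall i, t <= (s i).1 <= (s i).2 /\ (s i).2 <= b,
        forall i j : 'I_n, (i < j)%N -> (s i).2 <= (s j).1,
        forall i, psi (s i).2 - psi (s i).1 = (s i).2 - (s i).1 &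
        v = \sum_(i < n) `|phi (s i).2 - phi (s i).1|]].

(* [psi] measures the part of [a, t] lying in a small open set containing the
   exceptional points; there the increments of [phi] are controlled by absolute
   continuity, and everywhere else by the left slope of [phi]. *)
Lemma nonincreasing_up_to_small_set (a b eps d : R) (phi psi : R -> R) :
  a <= b -> abs_cont_on a b phi -> 0 < eps ->
  (forall (n : nat) (s : 'I_n -> R * R),
      (forall i, a <= (s i).1 <= (s i).2 /\ (s i).2 <= b) ->
      (forall i j : 'I_n, (i < j)%N -> (s i).2 <= (s j).1) ->
      \sum_(i < n) ((s i).2 - (s i).1) < d ->
      \sum_(i < n) `|phi (s i).2 - phi (s i).1| < eps) ->
  {homo psi : s t / s <= t} -> psi b - psi a < d ->
  (forall t, a < t <= b ->
     (exists2 u, a <= u < t & psi t - psi u = t - u) \/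
     (exists2 u, a <= u < t & phi t - phi u <= eps * (t - u))) ->
  phi b - phi a <= eps * (b - a) + eps.
Proof.
move=> ab ac eps0 Hd hpsi psid step.
pose S t := sup (increments_in psi phi t b).
have inc_lt t v : a <= t -> t <= b -> increments_in psi phi t b v -> v < eps.
  move=> at_ tb [n [s [h1 h2 h3 ->]]]; apply: Hd => //.
    move=> i; have [/andP[g1 g2] g3] := h1 i; split=> //.
    by rewrite g2 (le_trans at_ g1).
  under eq_bigr do rewrite -h3.
  apply: le_lt_trans psid; apply: (le_trans (sum_increments_le hpsi tb h1 h2)).
  by rewrite lerD2l lerN2 hpsi.
have inc0 t : increments_in psi phi t b 0.
  exists 0%N, (fun=> (0, 0)); split; try by case.
  by rewrite big_ord0.
have hs t : a <= t -> t <= b -> has_sup (increments_in psi phi t b).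
  move=> at_ tb; split; first by exists 0.
  by exists eps => v /(inc_lt _ _ at_ tb)/ltW.
have S_le t : a <= t -> t <= b -> S t <= eps.
  by move=> at_ tb; apply: ge_sup; [exists 0|move=> v /(inc_lt _ _ at_ tb)/ltW].
(* Adding [[u, t]] in front of an admissible family shows that from [u] to [t] the variation [S]
   drops by at least the increment of [phi], hence can pay for it. *)
have S_step u t : a <= u -> u <= t -> t <= b -> psi t - psi u = t - u ->
    S t + `|phi t - phi u| <= S u.
  move=> au ut tb pu; rewrite -lerBrDr; apply: ge_sup; first by exists 0.
  move=> v [n [s [h1 h2 h3 ->]]]; rewrite lerBrDr.
  apply: ub_le_sup; first by case: (hs u au (le_trans ut tb)).
  exists n.+1, (fun i => if unlift ord0 i is Some j then s j else (u, t)).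
  split.
  - move=> i; case: unliftP => [j _|_] /=; last by rewrite lexx ut tb.
    have [/andP[g1 g2] g3] := h1 j; split=> //.
    by rewrite g2 (le_trans ut g1).
  - move=> i j; case: (unliftP ord0 i) => [i'|] ->; case: (unliftP ord0 j) => [j'|] -> //=.
      by rewrite /bump !leq0n !add1n ltnS; exact: h2.
    by move=> _; have [/andP[]] := h1 j'.
  - by move=> i; case: unliftP.
  - rewrite big_ord_recl /= unlift_none addrC; congr (_ + _).
    by apply: eq_bigr => i _; rewrite liftK.
have S_mono u t : a <= u -> u <= t -> t <= b -> S t <= S u.
  move=> au ut tb; apply: ge_sup; first by exists 0.
  move=> v [n [s [h1 h2 h3 ->]]].
  apply: ub_le_sup; first by case: (hs u au (le_trans ut tb)).
  exists n, s; split=> // i; have [/andP[g1 g2] g3] := h1 i; split=> //.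
  by rewrite g2 (le_trans ut g1).
(* Creeping from right to left: the infimum [c] of [P] lies in [P] by continuity of [phi] and
   monotonicity of [S], and if [a < c] either alternative of [step] produces an element of [P] below
   [c]. *)
pose P := [set t | a <= t <= b /\ phi b - phi t <= eps * (b - t) + S t].
have Sb0 t : a <= t -> t <= b -> 0 <= S t.
  by move=> at_ tb; apply: ub_le_sup; [case: (hs t at_ tb)|exact: inc0].
have Pb : P b by split; rewrite ?ab ?lexx// !subrr mulr0 add0r Sb0.
have hiP : has_inf P by split; [exists b|exists a => t [/andP[]]].
pose c := inf P.
have ac_ : a <= c by apply: lb_le_inf; [exists b|move=> t [/andP[]]].
have cb : c <= b by apply: ge_inf => //; case: hiP.
have Pc : P c.
  split; first by rewrite ac_.
  apply/ler_addgt0Pr => eta eta0.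
  have [r r0 Hr] := ac_cont ac (introT andP (conj ac_ cb)) eta0.
  have [t Pt tc] := inf_adherent r0 hiP.
  have [/andP[at_ tb] ht] := Pt.
  have ct : c <= t by apply: ge_inf => //; case: hiP.
  have := Hr t (introT andP (conj at_ tb)).
  rewrite ger0_norm ?subr_ge0// ltrBlDl => /(_ tc) /ltW; rewrite ler_norml => /andP[_ h].
  have h2 := S_mono _ _ ac_ ct tb.
  have h3 : eps * (b - t) <= eps * (b - c) by rewrite ler_pM2l// lerD2l lerN2.
  by rewrite addrC -/c; lra.
have [ca|] := eqVneq c a.
  by case: Pc => _; rewrite ca => h; have := S_le a (lexx a) ab; lra.
move=> ca; exfalso.
have altc : a < c by rewrite lt_neqAle eq_sym ca.
have [_ hc] := Pc.
have contra u : a <= u < c -> ~ P u.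
  move=> /andP[au uc] Pu; have : c <= u by apply: ge_inf => //; case: hiP.
  by rewrite leNgt uc.
have [[u /andP[au uc] pu]|[u /andP[au uc] pu]] := step c (introT andP (conj altc cb)).
- apply: (contra u); first by rewrite au uc.
  split; first by rewrite au (le_trans (ltW uc)).
  have := S_step u c au (ltW uc) cb pu; have := ler_norm (phi c - phi u).
  have : eps * (b - c) <= eps * (b - u) by rewrite ler_pM2l// lerD2l lerN2 ltW.
  by lra.
- apply: (contra u); first by rewrite au uc.
  split; first by rewrite au (le_trans (ltW uc)).
  have := S_mono u c au (ltW uc) cb.
  by move: hc pu; lra.
Qed.

(** The exceptional null set is enclosed in an open [U] of measure less than the [d] that absolute
    continuity attaches to [eps]. On [U] the variation of [phi] is below [eps]; elsewhere the left
    increments are at most [eps] times the length. Then [eps] tends to 0. *)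
Lemma ac_nonincreasing (a b : R) (phi : R -> R) :
  a <= b -> abs_cont_on a b phi ->
  {ae cmu, forall t, a < t < b -> slope_le [set s | a <= s <= b] phi t 0} ->
  phi b <= phi a.
Proof.
move=> ab ac hae.
suff H eps : 0 < eps -> phi b - phi a <= eps * (b - a) + eps.
  rewrite -subr_le0; apply/ler_addgt0Pr => eps eps0; rewrite add0r.
  have k0 : 0 < b - a + 1 by rewrite ltr_wpDl// subr_ge0.
  have := H (eps / (b - a + 1)) (divr_gt0 eps0 k0).
  suff -> : eps / (b - a + 1) * (b - a) + eps / (b - a + 1) = eps by [].
  by field; rewrite gt_eqF.
move=> eps0; have [d [d0 Hd]] := ac _ eps0.
pose good t := slope_le [set s | a <= s <= b] phi t 0.
(* The endpoint [b] joins the exceptional set: slopes are given only inside []a, b[], whereas each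
   point of []a, b]] needs a step to its left. *)
pose N := [set t | ~ (a < t < b -> good t)] `|` [set b].
have nN : cmu.-negligible N.
  apply: negligibleU; first exact: hae.
  by apply: negligible_borel; apply/negligibleP => //; exact: lebesgue_measure_set1.
have [U [oU NU Ud]] := null_open_cover nN d0.
have mU : measurable U by exact: open_measurable.
have mUI t : measurable (U `&` `]a, t]%classic) by exact: measurableI.
have fin t : mu (U `&` `]a, t]%classic) \is a fin_num.
  rewrite ge0_fin_numE// (le_lt_trans _ (lt_trans Ud (ltry d)))//.
  by apply: le_measure; [rewrite inE; exact: mUI|rewrite inE|exact: subIsetl].
pose psi t := fine (mu (U `&` `]a, t]%classic)).
have hpsi : {homo psi : s t / s <= t}.
  move=> s t st; rewrite fine_le//.
  apply: le_measure; [rewrite inE; exact: mUI|rewrite inE; exact: mUI|apply: setIS => r /=].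
  by rewrite !in_itv/= => /andP[-> /= /le_trans]; apply.
apply: (@nonincreasing_up_to_small_set a b eps d phi psi) => //.
  have -> : psi a = 0 by rewrite /psi set_itv_ge ?setI0 ?measure0// -leNgt/= bnd_simp.
  rewrite subr0 -lte_fin /psi fineK//; apply: le_lt_trans Ud.
  by apply: le_measure; [rewrite inE; exact: mUI|rewrite inE|exact: subIsetl].
move=> t /andP[at_ tb].
have [Ut|nUt] := pselect (U t).
  left; have [u /andP[au ut] uU] := open_left_segment oU Ut at_.
  exists u; first by rewrite au.
  have E : U `&` `]a, t]%classic = (U `&` `]a, u]%classic) `|` `]u, t]%classic.
    apply/seteqP; split=> r /=; rewrite !in_itv/=.
      move=> [Ur /andP[ar rt]]; have [ru|ur] := leP r u; first by left; rewrite ar.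
      by right; rewrite rt.
    move=> [[Ur /andP[ar ru]]|/andP[ur rt]].
      by split=> //; rewrite ar (le_trans ru (ltW ut)).
    split; first by apply: uU; rewrite /= in_itv/= rt ltW.
    by rewrite rt (le_lt_trans au ur).
  have M : mu (U `&` `]a, t]%classic) = (mu (U `&` `]a, u]%classic) + (t - u)%:E)%E.
    have disj : (U `&` `]a, u]%classic) `&` `]u, t]%classic = set0.
      rewrite -subset0 => r /=; rewrite !in_itv/= => -[[_ /andP[_ ru]] /andP[ur _]].
      by have := lt_le_trans ur ru; rewrite ltxx.
    rewrite E; apply: (etrans (measureU mu (mUI u) (measurable_itv _) disj)).
    have L : lebesgue_measure `]u, t]%classic = (t - u)%:E.
      by rewrite lebesgue_measure_itv/= lte_fin ut -EFinD.
    by congr (_ + _)%E; exact: L.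
  by rewrite /psi M -[in LHS](fineK (fin u)) -EFinD /= addrC addKr.
right.
have tb' : t < b.
  rewrite lt_neqAle tb andbT; apply/eqP => tb1; apply: nUt; apply: NU; right.
  exact: tb1.
(* A function touching [phi] from below at [t] bounds the left increments from above:
   [phi t - phi u <= l t - l u], and the derivative of [l] is at most 0. *)
have [l [dl [lt_ ls Dl dl0]]] : good t.
  by apply: contrapT => ng; apply/nUt/NU; left => /= h; apply/ng/h; rewrite at_ tb'.
have [r r0 Hr] := (is_derive_epsP l t dl).1 Dl eps eps0.
pose u := Num.max a (t - r / 2).
have ut : u < t by rewrite gt_max at_ /= ltrBlDr ltrDl divr_gt0.
have au : a <= u by rewrite le_max lexx.
exists u; first by rewrite au.
have := Hr u; rewrite distrC ger0_norm ?subr_ge0 ?(ltW ut)// => /(_ _) h.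
have {h} := h ltac:(by rewrite ltrBlDr -ltrBlDl lt_max; apply/orP; right; rewrite ltrD2l ltrN2 ltr_pdivrMr// ltr_pMr// ltr1n).
rewrite ler_norml => /andP[h _].
have hl := ls u (introT andP (conj au (le_trans (ltW ut) tb))).
have : 0 <= (u - t) *: dl.
  by rewrite /GRing.scale /= mulr_le0// subr_le0 ltW.
by move: h; rewrite lt_; lra.
Qed.

End Monotonicity.

(** * Primitives for the completed Lebesgue measure *)

Section Primitive.
Context {R : realType}.
Local Notation mu := (@lebesgue_measure R).
Local Notation cmu := (@completed_lebesgue_measure R).
Local Notation BT := (measurableTypeR R).
Local Notation CT := (caratheodory_type (wlength (@idfun R))^*%mu).

Lemma measurable_completed_id : measurable_fun [set: CT] (fun t : CT => t : BT).
Proof.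
by move=> _ /= B mB; rewrite setTI; exact: sub_caratheodory.
Qed.

Lemma measurable_borel_completed (B : set R) :
  @measurable _ BT B -> @measurable _ CT B.
Proof. by move=> mB; exact: sub_caratheodory. Qed.

Lemma measurable_fun_borel_completed (D : set R) (h : R -> R) :
  @measurable _ BT D ->
  @measurable_fun _ _ BT R D h -> @measurable_fun _ _ CT R D h.
Proof.
by move=> mD mh _ A mA; apply: measurable_borel_completed; exact: (mh mD A mA).
Qed.

(** [h t] is the supremum of the rationals below it. Each set [ratr q < h t] is a Borel set plus a
    null set; keeping only the Borel parts changes the supremum on a countable union of null
    sets. *)
Lemma borel_representative (h : R -> R) :
  measurable_fun [set: CT] (h : CT -> R) ->
  exists2 k : R -> R, measurable_fun [set: BT] (k : BT -> R) &
    {ae cmu, forall t, k t = h t}.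
Proof.
move=> mh.
have dec (q : rat) : exists BN : set R * set R, [/\ @measurable _ BT BN.1,
    mu.-negligible BN.2 & [set t | ratr q < h t] = BN.1 `|` BN.2].
  have : @measurable _ CT [set t | ratr q < h t].
    have := mh measurableT `]ratr q, +oo[%classic (measurable_itv _).
    rewrite setTI; congr measurable; apply/seteqP; split=> t /=; by rewrite in_itv/= andbT.
  by move=> /completed_decomposition[B [N [mB nN E]]]; exists (B, N).
pose BN q := projT1 (cid (dec q)).
have BN1 q : @measurable _ BT (BN q).1 by rewrite /BN; case: cid => ? [].
have BN2 q : mu.-negligible (BN q).2 by rewrite /BN; case: cid => ? [].
have BNE q : [set t | ratr q < h t] = (BN q).1 `|` (BN q).2.
  by rewrite /BN; case: cid => ? [].
(* Codes that decode to no rational give the neutral value [-oo], as do rationals whose Borel set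
   misses [t]; [esups] at 0 is then the supremum over all rationals. *)
pose g (n : nat) (t : BT) : \bar R := if unpickle n is Some q then
  (if t \in (BN q).1 then (ratr q)%:E else -oo%E) else -oo%E.
have mg n : measurable_fun [set: BT] (g n).
  rewrite /g; case: unpickle => [q|]; last exact: measurable_cst.
  apply: measurable_fun_ifT => //; apply: (measurable_fun_bool true).
  rewrite setTI (_ : _ @^-1` _ = (BN q).1)//.
  by apply/seteqP; split=> t /= tB; [exact: set_mem|exact: mem_set].
have mG : measurable_fun [set: BT] (fun t => esups (g ^~ t) 0%N).
  exact: measurable_fun_esups.
exists (fun t => fine (esups (g ^~ t) 0%N)).
  by apply: measurableT_comp => //.
have nN : mu.-negligible (\bigcup_n
    (if unpickle n is Some q then (BN q).2 else set0)).
  apply: negligible_bigcup => n; case: unpickle => [q|] //.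
  exact: negligible_set0.
apply: negligible_borel; apply: negligibleS nN => t /= nt.
apply: contrapT => hN; apply: nt.
suff -> : esups (g ^~ t) 0%N = (h t)%:E by [].
rewrite /esups /=; apply/eqP; rewrite eq_le; apply/andP; split.
  apply: ge_ereal_sup => _ [n _ <-]; rewrite /g.
  case: unpickle => [q|]; last exact: leNye.
  case: ifPn => [|_]; last exact: leNye.
  rewrite inE lee_fin => tB; apply: ltW.
  suff : [set t | ratr q < h t] t by [].
  by rewrite BNE; left.
apply/lee_subgt0Pr => eps eps0.
have ht : h t - eps < h t by rewrite ltrBlDr ltrDl.
have [q] := rat_in_itvoo ht.
rewrite in_itv/= => /andP[q1 q2].
apply: (@le_trans _ _ (ratr q)%:E); first by rewrite -EFinB lee_fin ltW.
apply: ereal_sup_ubound; exists (pickle q) => //.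
rewrite /g pickleK mem_set//.
have : [set t | ratr q < h t] t by [].
rewrite BNE => -[tB|tN]; first exact: tB.
exfalso; apply: hN; exists (pickle q); first exact: I.
by rewrite pickleK; exact: tN.
Qed.

(** Change of variables along the identity, which is measurable from the completed space to the
    Borel one and pushes the one measure to the other. *)
Lemma integral_borel_completed (D : set R) (k : R -> R) :
  @measurable _ BT D -> measurable_fun [set: BT] (k : BT -> R) ->
  cmu.-integrable [set: CT] (fun t => (k t)%:E) ->
  (\int[cmu]_(t in D) (k t)%:E = \int[mu]_(t in D) (k t)%:E)%E.
Proof.
move=> mD mk ik.
have ikD : cmu.-integrable D (fun t => (k t)%:E).
  by apply: integrableS ik => //; exact: measurable_borel_completed.
by have := @integral_pushforward _ _ CT BT R _ measurable_completed_id cmu D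
  (fun t => (k t)%:E) (proj2 (measurable_EFinP _ _) mk) ikD mD => <-.
Qed.

Lemma ge0_integral_borel_completed (D : set R) (k : R -> \bar R) :
  @measurable _ BT D -> measurable_fun D (k : BT -> \bar R) ->
  (forall t, 0 <= k t)%E ->
  (\int[cmu]_(t in D) k t = \int[mu]_(t in D) k t)%E.
Proof.
move=> mD mk k0.
have := @ge0_integral_pushforward _ _ CT BT R _ measurable_completed_id cmu D
  k mD mk (fun t _ => k0 t).
by move=> <-.
Qed.

Lemma trivIset_ordered_itv n (s : 'I_n -> R * R) :
  (forall i j : 'I_n, (i < j)%N -> (s i).2 <= (s j).1) ->
  trivIset setT (fun i => `](s i).1, (s i).2]%classic).
Proof.
move=> so; apply/trivIsetP => i j _ _ ij.
wlog lij : i j ij / (i < j)%N.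
  move=> W; have := ij; rewrite neq_ltn => /orP[|] h; first exact: W.
  by rewrite setIC; apply: W => //; rewrite eq_sym.
rewrite -subset0 => r /=; rewrite !in_itv/= => -[/andP[_ h1] /andP[h2 _]].
by have := lt_le_trans h2 (le_trans h1 (so _ _ lij)); rewrite ltxx.
Qed.

(** Absolute continuity of the integral, applied to the union of the intervals of the family, whose
    measure is the sum of their lengths. *)
Lemma ac_primitive (k : R -> R) a b : mu.-integrable [set: BT] (EFin \o k) ->
  abs_cont_on a b (fun t => (\int[mu]_(s in `]-oo, t]) k s)%R).
Proof.
move=> ik eps eps0; have [d [d0 Hd]] := integral_normr_continuous ik eps0.
exists d; split=> // n s Hs so sd.
pose F i := `](s i).1, (s i).2]%classic.
have tF := trivIset_ordered_itv so.
have mF i : measurable (F i : set BT) by exact: measurable_itv.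
pose A := \big[setU/set0]_(i < n) F i.
have mA : measurable (A : set BT) by exact: bigsetU_measurable.
have ikn : mu.-integrable [set: BT] (fun t => (`|k t|)%:E).
  exact: (integrable_norm ik).
have muA : mu A = (\sum_(i < n) ((s i).2 - (s i).1))%:E.
  have E : mu A = (\sum_(i < n) lebesgue_measure (F i))%E :=
    @measure_bigsetU_ord _ R BT mu n predT F mF tF.
  rewrite E -sumEFin; apply: eq_bigr => i _.
  have [/andP[_ h2] _] := Hs i.
  rewrite lebesgue_measure_itv/= lte_fin -EFinD; move: h2.
  by rewrite le_eqVlt => /predU1P[->|->//]; rewrite ltxx subrr.
have hA : (mu A < d%:E)%E by rewrite muA lte_fin.
apply: le_lt_trans (Hd A mA hA).
have EA : (\int[mu]_(x in A) `|k x|)%R = \sum_(i < n) (\int[mu]_(x in F i) `|k x|)%R.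
  rewrite /Rintegral /A.
  have := @integral_bigsetU_EFin _ BT R mu _ F (fun t => `|k t|) (index_enum 'I_n) mF
     (index_enum_uniq _).
  move=> -> //.
  - rewrite -sum_fine// => i _; apply: integrable_fin_num => //.
    exact: integrableS ikn.
  - by move=> i j _ _; exact: tF.
  - by apply: measurable_funTS; case/integrableP: ikn.
apply: (@le_trans _ _ (\sum_(i < n) (\int[mu]_(x in F i) `|k x|)%R)); last first.
  by rewrite le_eqVlt; apply/orP; left; apply/eqP; exact: (esym EA).
apply: ler_sum => i _; have [/andP[_ h2] _] := Hs i.
rewrite Rintegral_itvB//; last first.
  by apply: integrableS ik => //; exact: measurable_itv.
apply: le_normr_Rintegral => //.
by apply: integrableS ik => //; exact: measurable_itv.
Qed.

(** Lebesgue differentiation and absolute continuity are obtained for a Borel representative [k] of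
    [h]; derivatives and integrals then carry over because the null sets agree. One [F] serves
    bounded intervals and tails alike. *)
Lemma primitive_ex (h : R -> R) :
  cmu.-integrable [set: CT] (fun t => (h t)%:E) ->
  exists F : R -> R, [/\ forall a b, abs_cont_on a b F,
    {ae cmu, forall t : R, is_derive t 1 F (h t)},
    forall a b, a <= b -> (\int[cmu]_(t in `]a, b]) (h t)%:E = (F b - F a)%:E)%E &
    exists c, forall t, (\int[cmu]_(s in `]t, +oo[) (h s)%:E = (c - F t)%:E)%E].
Proof.
move=> ih; have mh : measurable_fun [set: CT] (h : CT -> R).
  by apply/measurable_EFinP; case/integrableP: ih.
have [k mk kh] := borel_representative mh.
have mkC : measurable_fun [set: CT] (k : CT -> R).
  exact: measurable_fun_borel_completed.
have kh' D : ae_eq cmu D (fun t => (k t)%:E) (fun t => (h t)%:E).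
  by apply: ae_imp kh => t -> _.
have ikC : cmu.-integrable [set: CT] (fun t => (k t)%:E).
  apply/integrableP; split; first exact/measurable_EFinP.
  have mabs (u : CT -> R) : measurable_fun [set: CT] u ->
      measurable_fun [set: CT] (fun t => `|(u t)%:E|)%E.
    by move=> mu_; apply/measurable_EFinP; exact: (measurableT_comp (@normr_measurable R setT) mu_).
  have E : (\int[cmu]_(t in setT) `|(k t)%:E| = \int[cmu]_(t in setT) `|(h t)%:E|)%E.
    apply: (@ae_eq_integral _ CT R cmu setT (fun t => `|(h t)%:E|)%E
      (fun t => `|(k t)%:E|)%E measurableT (mabs _ mkC) (mabs _ mh)).
    by apply: ae_imp kh => t -> _.
  by rewrite E; case/integrableP: ih.
have ik : mu.-integrable [set: BT] (EFin \o k).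
  apply/integrableP; split; first exact/measurable_EFinP.
  case/integrableP: ikC => _; rewrite ge0_integral_borel_completed//.
  by apply: measurableT_comp => //; exact/measurable_EFinP.
have ikD (D : set R) : measurable (D : set BT) -> mu.-integrable D (EFin \o k).
  by move=> mD; apply: integrableS ik.
have Eint (D : set R) : measurable (D : set BT) ->
    (\int[cmu]_(t in D) (h t)%:E = (\int[mu]_(t in D) k t)%R%:E)%E.
  move=> mD; rewrite /Rintegral fineK; last exact/integrable_fin_num/ikD.
  rewrite -integral_borel_completed//; symmetry; apply: ae_eq_integral.
  - exact: measurable_borel_completed.
  - by apply: measurable_funTS; exact/measurable_EFinP.
  - by apply: measurable_funTS; exact/measurable_EFinP.
  - exact: kh'.
exists (fun t => (\int[mu]_(s in `]-oo, t]) k s)%R); split.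
- by move=> a b; exact: ac_primitive.
- have lk : locally_integrable [set: R] k.
    by apply: open_integrable_locally => //; exact: openT.
  have := @FTC1Ny R k (fun y => ikD _ (measurable_itv _)) lk.
  move=> /negligible_borel D; apply: ae_imp2 D kh => t -[dF EF] kt.
  by split=> //; rewrite -kt -EF derive1E.
- move=> a b ab; rewrite Eint; last exact: measurable_itv.
  by rewrite (Rintegral_itvB (ikD _ (measurable_itv _)))// bnd_simp.
- exists (\int[mu]_(s in `]-oo, +oo[) k s)%R => t.
  rewrite Eint; last exact: measurable_itv.
  by rewrite (Rintegral_itvB (ikD _ (measurable_itv _))).
Qed.

End Primitive.

(** * Integral bounds by truncation and exhaustion, measurability of a.e. limits *)

Section AbstractIntegral.
Context d (T : measurableType d) (R : realType).
Variable mu : {measure set T -> \bar R}.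

(** Allows a bound to be proved before integrability is known: on a bounded interval each truncation
    is bounded, so it has a primitive, and monotone convergence removes the truncation. *)
Lemma ge0_integral_truncation_le (D : set T) (h : T -> R) (K : R) :
  measurable D -> measurable_fun D h -> (forall t, D t -> 0 <= h t) ->
  (forall n : nat, (\int[mu]_(t in D) (Num.min (h t) n%:R)%:E <= K%:E)%E) ->
  (\int[mu]_(t in D) (h t)%:E <= K%:E)%E.
Proof.
move=> mD mh h0 hK.
pose g n t := (Num.min (h t) n%:R)%:E.
have cv t : D t -> g n t @[n --> \oo] --> (h t)%:E.
  move=> Dt; apply: cvg_near_cst.
  exists (Num.truncn (h t)).+1 => // n /= tn; rewrite /g; congr (_%:E).
  apply/min_idPl; apply: ltW; apply: lt_le_trans (truncnS_gt _) _.
  by rewrite ler_nat.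
have mg n : measurable_fun D (g n).
  by apply/measurable_EFinP; apply: measurable_minr => //; exact: measurable_cst.
have g0 n t : D t -> (0 <= g n t)%E by move=> Dt; rewrite lee_fin le_min h0/=.
have ndg t : D t -> nondecreasing_seq (g^~ t).
  move=> Dt m n mn; rewrite lee_fin le_min ge_min lexx /=.
  by rewrite ge_min ler_nat mn orbT.
have -> : (\int[mu]_(t in D) (h t)%:E)%E = (\int[mu]_(t in D) limn (g^~ t))%E.
  by apply: eq_integral => t /set_mem Dt; apply/esym/cvg_lim => //; exact: cv.
have cm := @cvg_monotone_convergence _ _ _ mu _ mD _ mg g0 ndg.
rewrite -(cvg_lim _ cm)//; apply: lime_le; first by apply/cvg_ex; eexists; exact: cm.
by apply: nearW.
Qed.

Lemma ge0_integral_bigcup_le (F : (set T)^nat) (h : T -> R) (K : R) :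
  nondecreasing_seq F -> (forall n, measurable (F n)) ->
  (forall n, measurable_fun (F n) h) ->
  (forall n t, F n t -> 0 <= h t) ->
  (forall n, (\int[mu]_(t in F n) (h t)%:E <= K%:E)%E) ->
  (\int[mu]_(t in \bigcup_n F n) (h t)%:E <= K%:E)%E.
Proof.
move=> ndF mF mh h0 hK.
have cm := @ge0_nondecreasing_set_cvg_integral d T R F (fun t => (h t)%:E) mu ndF mF
  (fun n => (measurable_EFinP _ _).2 (mh n)) (fun n t Ft => h0 n t Ft).
rewrite -(cvg_lim _ cm)//; apply: lime_le; first by apply/cvg_ex; eexists; exact: cm.
by apply: nearW.
Qed.

(** On [D], [h] agrees a.e. with the upper limit of the sequence, which is measurable; completeness
    of the measure transfers this to [h]. *)
Lemma ae_lim_measurable (D : set T) (u : nat -> T -> R) (h : T -> R) :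
  measure_is_complete mu -> (forall n, measurable_fun [set: T] (u n)) ->
  {ae mu, forall t, D t -> u n t @[n --> \oo] --> h t} ->
  measurable_fun D h.
Proof.
move=> cmu mun hae; apply/measurable_EFinP.
pose f t := limn_esup (fun n => (u n t)%:E).
apply: (ae_measurable_fun cmu (f := f)); last first.
  apply: measurable_funTS; apply: measurable_fun_limn_esup => n.
  exact/measurable_EFinP.
apply: filterS hae => t /= ht Dt; rewrite /f.
have c : (fun n => (u n t)%:E) @ \oo --> (h t)%:E by apply/cvg_EFin => //; [exact: nearW|exact: ht].
by have [_ ->] := cvg_limn_einf_sup c.
Qed.

Lemma integrable_restrictT (D : set T) (h : T -> R) : measurable D ->
  mu.-integrable D (fun t => (h t)%:E) ->
  mu.-integrable [set: T] (fun t => ((h \_ D) t)%:E).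
Proof.
by move=> mD ih; have := (integrable_mkcond _ mD).1 ih; rewrite restrict_EFin.
Qed.

Lemma integrable_ge0_lty (D : set T) (h : T -> R) :
  measurable_fun D h -> (forall t, D t -> 0 <= h t) ->
  (\int[mu]_(t in D) (h t)%:E < +oo)%E ->
  mu.-integrable D (fun t => (h t)%:E).
Proof.
move=> mh h0 hoo; apply/integrableP; split; first exact/measurable_EFinP.
apply: le_lt_trans hoo; rewrite le_eqVlt; apply/orP; left; apply/eqP.
by apply: eq_integral => t /set_mem Dt; rewrite gee0_abs// lee_fin h0.
Qed.

Lemma ge0_integral_split3_lty (A B N : set T) (h : T -> R) (K L : R) :
  measurable A -> measurable B -> measurable N -> mu N = 0%E ->
  [disjoint A & B] -> [disjoint N & A `|` B] ->
  measurable_fun (N `|` (A `|` B)) h ->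
  (forall t, (N `|` (A `|` B)) t -> 0 <= h t) ->
  (\int[mu]_(t in A) (h t)%:E <= K%:E)%E -> (\int[mu]_(t in B) (h t)%:E <= L%:E)%E ->
  (\int[mu]_(t in N `|` (A `|` B)) (h t)%:E < +oo)%E.
Proof.
move=> mA mB mN N0 dAB dN mh h0 hA hB.
have mU : measurable (N `|` (A `|` B)) by apply: measurableU => //; exact: measurableU.
have mh' : measurable_fun (N `|` (A `|` B)) (fun t => (h t)%:E).
  exact/measurable_EFinP.
rewrite ge0_integral_setU//; last exact: measurableU.
rewrite null_set_integral// ?add0e; last first.
  exact: (measurable_funS mU (@subsetUl _ _ _) mh').
rewrite ge0_integral_setU//.
- by rewrite (le_lt_trans (leeD hA hB))// ltry.
- exact: (measurable_funS mU (@subsetUr _ _ _) mh').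
- by move=> t Ht; rewrite lee_fin; apply: h0; right.
Qed.

Lemma bounded_integrable (D : set T) (h : T -> R) (K : R) :
  measurable D -> (mu D < +oo)%E -> measurable_fun D h ->
  (forall t, D t -> `|h t| <= K) -> mu.-integrable D (fun t => (h t)%:E).
Proof.
move=> mD Doo mh hK; apply: measurable_bounded_integrable => //.
exists K; split; first exact: num_real.
by move=> M KM t Dt; apply: le_trans (hK t Dt) (ltW KM).
Qed.

End AbstractIntegral.

(** * Calculus of one-sided slopes *)

Section SlopeCalculus.
Context {R : realType}.
Implicit Types (D : set R) (phi psi w : R -> R) (t d dw : R).

Lemma slope_le_weaken D D' phi t d d' : D' `<=` D -> d <= d' ->
  slope_le D phi t d -> slope_le D' phi t d'.
Proof.
move=> DD dd [l [dl [lt_ lD Dl ld]]]; exists l, dl; split=> //.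
  by move=> s /DD; exact: lD.
exact: le_trans ld dd.
Qed.

Lemma slope_le_derive D phi t d : is_derive t 1 phi d -> slope_le D phi t d.
Proof. by move=> Dp; exists phi, d. Qed.

Lemma slope_leD D phi psi t d1 d2 : slope_le D phi t d1 -> slope_le D psi t d2 ->
  slope_le D (fun s => phi s + psi s) t (d1 + d2).
Proof.
move=> [l [dl [lt_ lD Dl ld]]] [k [dk [kt kD Dk kd]]].
exists (fun s => l s + k s), (dl + dk); split; last exact: lerD.
- by rewrite lt_ kt.
- by move=> s Ds; apply: lerD; [exact: lD|exact: kD].
- exact: is_deriveD.
Qed.

(** The sign of the weight keeps [w * l] below [w * phi]. *)
Lemma slope_leM D w phi t dw d : (forall s, D s -> 0 <= w s) -> 0 <= w t ->
  is_derive t 1 w dw -> slope_le D phi t d ->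
  slope_le D (fun s => w s * phi s) t (dw * phi t + w t * d).
Proof.
move=> w0 wt Dw [l [dl [lt_ lD Dl ld]]].
exists (fun s => w s * l s), (w t * dl + l t * dw); split.
- by rewrite lt_.
- by move=> s Ds; apply: ler_wpM2l; [exact: w0|exact: lD].
- exact: is_deriveM.
- by rewrite addrC lt_ mulrC lerD2l ler_wpM2l.
Qed.

Lemma slope_leZ D (c : R) phi t d : 0 <= c -> slope_le D phi t d ->
  slope_le D (fun s => c * phi s) t (c * d).
Proof.
move=> c0 h; have := slope_leM (w := fun=> c) (fun _ _ => c0) c0 (is_derive_cst _ _ _) h.
by rewrite mul0r add0r.
Qed.

End SlopeCalculus.

(** * Integrals bounded by the decrease of a function *)

Section HalfLine.
Context {R : realType}.
Local Notation mu := (@lebesgue_measure R).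
Local Notation cmu := (@completed_lebesgue_measure R).
Local Notation BT := (measurableTypeR R).
Local Notation CT := (caratheodory_type (wlength (@idfun R))^*%mu).

Lemma completed_measurable_itv (i : interval R) : @measurable _ CT [set` i].
Proof. by apply: measurable_borel_completed; exact: measurable_itv. Qed.

Lemma half_lineE (a : R) : [set t | a <= t] = `[a, +oo[%classic.
Proof. by apply/seteqP; split=> t /=; rewrite in_itv/= andbT. Qed.

Lemma completed_measurable_half_line (a : R) : @measurable _ CT [set t | a <= t].
Proof. by rewrite half_lineE; exact: completed_measurable_itv. Qed.

Lemma completed_set1 (a : R) : cmu [set a] = 0%E.
Proof. exact: (@lebesgue_measure_set1 R a). Qed.

Lemma ae_neq (a : R) : {ae cmu, forall t : R, t != a}.
Proof.
apply: negligible_borel; exists [set a]; split=> //; first exact: lebesgue_measure_set1.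
by move=> t /= /negP; rewrite negbK => /eqP.
Qed.

Lemma measurable_restrict_continuous (a : R) (u : R -> R) :
  (forall t, a < t -> {for t, continuous u}) ->
  measurable_fun [set: CT] (u \_ `]a, +oo[ : CT -> R).
Proof.
move=> cu; apply/(measurable_restrictT _ (completed_measurable_itv _)).
apply: measurable_fun_borel_completed; first exact: measurable_itv.
apply: open_continuous_measurable_fun; first exact: interval_open.
by move=> t /set_mem /=; rewrite in_itv/= andbT; exact: cu.
Qed.

Lemma ae_lim_continuous_measurable (a : R) (u : nat -> R -> R) (h : R -> R) :
  (forall n t, a < t -> {for t, continuous (u n)}) ->
  {ae cmu, forall t : R, a < t -> u n t @[n --> \oo] --> h t} ->
  @measurable_fun _ _ CT R [set t | a <= t] h.
Proof.
move=> cu hae.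
apply: (@ae_lim_measurable _ CT R cmu _ (fun n => u n \_ `]a, +oo[)).
- exact: completed_lebesgue_measure_is_complete.
- by move=> n; exact: measurable_restrict_continuous (cu n).
apply: ae_imp2 hae (ae_neq a) => t ht ta /= at_.
have at' : a < t by rewrite lt_neqAle eq_sym ta.
have -> : (fun n => (u n \_ `]a, +oo[) t) = u^~ t.
  by apply/funext => n; rewrite patchE mem_set//= in_itv/= at'.
exact: ht.
Qed.

(** If [F] is a primitive of a truncation of [h], then [phi + F] has slope at most 0, so the
    integral of the truncation is at most the drop of [phi]. In this way [phi] itself is never
    differentiated. *)
Lemma integral_le_drop (a b : R) (phi h : R -> R) :
  a <= b -> abs_cont_on a b phi ->
  @measurable_fun _ _ CT R `]a, b] h -> (forall t, a < t <= b -> 0 <= h t) ->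
  {ae cmu, forall t, a < t < b -> slope_le [set s | a <= s <= b] phi t (- h t)} ->
  (\int[cmu]_(t in `]a, b]) (h t)%:E <= (phi a - phi b)%:E)%E.
Proof.
move=> ab ac mh h0 hae.
pose I := `]a, b]%classic : set CT.
have mI : measurable I by exact: completed_measurable_itv.
apply: (@ge0_integral_truncation_le _ CT R cmu I h (phi a - phi b) mI mh).
  by move=> t; rewrite /I /= in_itv/=; exact: h0.
move=> n; pose g t := Num.min (h t) n%:R.
have mg : measurable_fun I (g : CT -> R).
  by apply: measurable_minr mh _; exact: measurable_cst.
have Ioo : (cmu I < +oo)%E.
  have E : mu `]a, b]%classic = (b - a)%:E.
    rewrite lebesgue_measure_itv/= lte_fin -EFinD; move: ab.
    by rewrite le_eqVlt => /predU1P[->|->//]; rewrite ltxx subrr.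
  have -> : cmu I = (b - a)%:E := E.
  exact: ltry.
have ig : cmu.-integrable I (fun t => (g t)%:E).
  apply: (@bounded_integrable _ CT R cmu I g n%:R mI Ioo mg) => t.
  rewrite /I /= in_itv/= => tI; rewrite /g ger0_norm ?le_min ?h0//=.
  by rewrite ge_min lexx orbT.
have [F [acF DF EF _]] := primitive_ex (@integrable_restrictT _ CT R cmu I g mI ig).
have -> : (\int[cmu]_(t in I) (g t)%:E = (F b - F a)%:E)%E.
  rewrite -EF//; apply: eq_integral => t tI; congr (_%:E).
  by rewrite patchE tI.
suff : phi b + F b <= phi a + F a by rewrite lee_fin; lra.
apply: (@ac_nonincreasing R a b (fun t => phi t + F t)) => //; first exact: acD.
apply: ae_imp2 hae DF => t h1 DFt tab.
have := slope_leD (h1 tab) (slope_le_derive [set s | a <= s <= b] DFt).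
apply: slope_le_weaken => //; rewrite patchE mem_set; last first.
  by rewrite /I /= in_itv/=; case/andP: tab => -> /ltW ->.
by rewrite addrC subr_le0 ge_min lexx.
Qed.

(** Made for the initial time, where absolute continuity is lost: the drop of [phi] on []a + (b - a)
    / n.+1, b]] is at most [2 * K], and these intervals exhaust []a, b]]. *)
Lemma integral_left_bound (a b K : R) (phi h : R -> R) : a < b ->
  (forall s, a < s -> s <= b -> abs_cont_on s b phi) ->
  (forall s, a < s -> s <= b -> `|phi s| <= K) ->
  @measurable_fun _ _ CT R `]a, b] h -> (forall t, a < t <= b -> 0 <= h t) ->
  {ae cmu, forall t, a < t < b -> slope_le [set s | a < s <= b] phi t (- h t)} ->
  (\int[cmu]_(t in `]a, b]) (h t)%:E <= (2 * K)%:E)%E.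
Proof.
move=> ab ac bd mh h0 hae.
have step s : a < s -> s <= b -> (\int[cmu]_(t in `]s, b]) (h t)%:E <= (2 * K)%:E)%E.
  move=> as_ sb; apply: le_trans (integral_le_drop sb (ac _ as_ sb) _ _ _) _.
  - apply: measurable_funS mh; first exact: completed_measurable_itv.
    by move=> t /=; rewrite !in_itv/= => /andP[h1 ->]; rewrite (lt_trans as_ h1).
  - by move=> t /andP[h1 h2]; apply: h0; rewrite h2 (lt_trans as_ h1).
  - apply: ae_imp hae => t ht /andP[h1 h2].
    apply: slope_le_weaken (lexx _) (ht _); last by rewrite h2 (lt_trans as_ h1).
    by move=> r /= /andP[h3 ->]; rewrite (lt_le_trans as_ h3).
  have := bd _ as_ sb; have := bd _ ab (lexx b); rewrite !ler_norml lee_fin; lra.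
pose F (n : nat) := `](a + (b - a) / n.+1%:R), b]%classic : set CT.
have aF (n : nat) : a < a + (b - a) / n.+1%:R by rewrite ltrDl divr_gt0// subr_gt0.
have Fb (n : nat) : a + (b - a) / n.+1%:R <= b.
  rewrite -lerBrDl ler_pdivrMr//; apply: ler_peMr; last by rewrite ler1n.
  by rewrite subr_ge0 ltW.
have -> : `]a, b]%classic = \bigcup_n F n.
  apply/seteqP; split=> t /=; rewrite ?in_itv/=.
    move=> /andP[at_ tb].
    have r0 : 0 < (t - a) / (b - a) by rewrite divr_gt0// subr_gt0.
    have [n _ /(_ n (leqnn n)) /= hn] := @near_infty_natSinv_lt R (PosNum r0).
    exists n => //; rewrite /F /= in_itv/= tb andbT -ltrBrDl.
    by rewrite mulrC -ltr_pdivlMr// subr_gt0.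
  by move=> [n _]; rewrite /F /= in_itv/= => /andP[h1 ->]; rewrite (lt_trans (aF n) h1).
apply: (@ge0_integral_bigcup_le _ CT R cmu F h (2 * K)).
- move=> m n mn; rewrite subsetEset => t; rewrite /F /= !in_itv/= => /andP[h1 ->].
  rewrite andbT; apply: le_lt_trans h1; rewrite lerD2l; apply: ler_wpM2l.
    by rewrite subr_ge0 ltW.
  by rewrite lef_pV2 ?posrE// ler_nat ltnS.
- by move=> n; exact: completed_measurable_itv.
- move=> n; apply: measurable_funS mh; first exact: completed_measurable_itv.
  by move=> t; rewrite /F /= !in_itv/= => /andP[h1 ->]; rewrite (lt_trans (aF n) h1).
- by move=> n t; rewrite /F /= in_itv/= => /andP[h1 h2]; apply: h0; rewrite h2 (lt_trans (aF n) h1).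
- by move=> n; exact: step.
Qed.

Lemma integral_right_bound (a K : R) (phi h : R -> R) :
  (forall b, a <= b -> abs_cont_on a b phi) ->
  (forall s, a <= s -> `|phi s| <= K) ->
  @measurable_fun _ _ CT R `]a, +oo[ h -> (forall t, a < t -> 0 <= h t) ->
  {ae cmu, forall t, a < t -> slope_le [set s | a <= s] phi t (- h t)} ->
  (\int[cmu]_(t in `]a, +oo[) (h t)%:E <= (2 * K)%:E)%E.
Proof.
move=> ac bd mh h0 hae.
have step b : a <= b -> (\int[cmu]_(t in `]a, b]) (h t)%:E <= (2 * K)%:E)%E.
  move=> ab; apply: le_trans (integral_le_drop ab (ac _ ab) _ _ _) _.
  - apply: measurable_funS mh; first exact: completed_measurable_itv.
    by move=> t /=; rewrite !in_itv/= => /andP[->].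
  - by move=> t /andP[h1 h2]; apply: h0.
  - apply: ae_imp hae => t ht /andP[h1 h2].
    apply: slope_le_weaken (lexx _) (ht h1).
    by move=> r /= /andP[h3 _].
  have := bd _ ab; have := bd _ (lexx a); rewrite !ler_norml lee_fin; lra.
pose F (n : nat) := `]a, (a + n%:R)]%classic : set CT.
have aF (n : nat) : a <= a + n%:R by rewrite lerDl.
have -> : `]a, +oo[%classic = \bigcup_n F n.
  apply/seteqP; split=> t /=; rewrite ?in_itv/=.
    rewrite andbT => at_; exists (Num.truncn (t - a)).+1 => //.
    rewrite /F /= in_itv/= at_ /= -lerBlDl ltW//; exact: truncnS_gt.
  by move=> [n _]; rewrite /F /= in_itv/= andbT => /andP[].
apply: (@ge0_integral_bigcup_le _ CT R cmu F h (2 * K)).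
- move=> m n mn; rewrite subsetEset => t; rewrite /F /= !in_itv/= => /andP[-> h1] /=.
  by rewrite (le_trans h1)// lerD2l ler_nat.
- by move=> n; exact: completed_measurable_itv.
- move=> n; apply: measurable_funS mh; first exact: completed_measurable_itv.
  by move=> t; rewrite /F /= !in_itv/= => /andP[->].
- by move=> n t; rewrite /F /= in_itv/= => /andP[h1 h2]; apply: h0.
- by move=> n; exact: step.
Qed.

Lemma half_line_split (a b : R) : a < b ->
  [set t | a <= t] = [set a] `|` (`]a, b]%classic `|` `]b, +oo[%classic).
Proof.
move=> ab; apply/seteqP; split=> t /=; rewrite !in_itv/= ?andbT.
  move=> at_; have [->|ta] := eqVneq t a; first by left.
  by right; have [tb|bt] := leP t b; [left; rewrite lt_neqAle eq_sym ta at_|right].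
move=> [->//|[/andP[/ltW]//|bt]]; exact/ltW/(lt_trans ab).
Qed.

Lemma integral_half_line_lty (a b K L : R) (h : R -> R) : a < b ->
  @measurable_fun _ _ CT R [set t | a <= t] h ->
  (forall t, a <= t -> 0 <= h t) ->
  (\int[cmu]_(t in `]a, b]) (h t)%:E <= K%:E)%E ->
  (\int[cmu]_(t in `]b, +oo[) (h t)%:E <= L%:E)%E ->
  (\int[cmu]_(t in [set t | (a <= t)%R]) (h t)%:E < +oo)%E.
Proof.
move=> ab mh h0 hK hL; rewrite (half_line_split ab).
apply: (@ge0_integral_split3_lty _ CT R cmu _ _ _ h K L) hK hL.
- exact: completed_measurable_itv.
- exact: completed_measurable_itv.
- by have := completed_measurable_itv `[a, a]; rewrite set_itv1.
- exact: completed_set1.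
- rewrite disj_set2E; apply/eqP; rewrite -subset0 => t /=; rewrite !in_itv/= andbT.
  by move=> [/andP[_ h1] h2]; have := lt_le_trans h2 h1; rewrite ltxx.
- rewrite disj_set2E; apply/eqP; rewrite -subset0 => t /= [->]; rewrite !in_itv/= ltxx andbT /=.
  by move=> [//|h2]; have := lt_trans ab h2; rewrite ltxx.
- by rewrite -(half_line_split ab).
- by rewrite -(half_line_split ab).
Qed.

End HalfLine.

(** * Gronwall's lemma, a mean value inequality, primitives on half-lines *)

Section Gronwall.
Context {R : realType}.
Local Notation cmu := (@completed_lebesgue_measure R).
Local Notation CT := (caratheodory_type (wlength (@idfun R))^*%mu).

Lemma ac_shift (V : normedModType R) (a b h : R) (g : R -> V) :
  abs_cont_on (a + h) (b + h) g -> abs_cont_on a b (fun t => g (t + h)).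
Proof.
move=> ac eps eps0; have [d [d0 Hd]] := ac _ eps0; exists d; split=> // n s Hs so sd.
apply: (Hd n (fun i => ((s i).1 + h, (s i).2 + h))) => /=.
- by move=> i; have [/andP[h1 h2] h3] := Hs i; rewrite !lerD2r h1 h2 h3.
- by move=> i j ij; rewrite lerD2r so.
- by move: sd; congr (_ < _); apply: eq_bigr => i _; ring.
Qed.

Lemma is_derive_shift (V : normedModType R) (g : R -> V) (t h : R) (dg : V) :
  is_derive (t + h) 1 g dg -> is_derive t 1 (fun s => g (s + h)) dg.
Proof.
move=> /is_derive_epsP H; apply/is_derive_epsP => eps eps0.
have [d d0 Hd] := H _ eps0; exists d => // s sd.
have E : s + h - (t + h) = s - t by ring.
by have := Hd (s + h); rewrite E => /(_ sd).
Qed.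

Lemma ac_expR (a b : R) (c : R -> R) : abs_cont_on a b c ->
  abs_cont_on a b (fun t => expR (c t)).
Proof.
move=> acc; have [K K0 HK] := ac_bounded acc.
apply: (ac_comp (L := expR K) HK) acc => u v _ vK uv.
rewrite ger0_norm ?subr_ge0 ?ler_expR//.
have -> : expR v - expR u = expR v * (1 - expR (u - v)).
  by rewrite mulrBr mulr1 -expRD; congr (_ - expR _); ring.
apply: ler_pM; rewrite ?expR_ge0 ?subr_ge0//.
- by rewrite -expR0 ler_expR subr_le0.
- by rewrite ler_expR (le_trans (ler_norm v)).
- by have := expR_ge1Dx (u - v); lra.
Qed.

Lemma is_derive_expR_comp (c : R -> R) (t dc : R) : is_derive t 1 c dc ->
  is_derive t 1 (fun s => expR (c s)) (expR (c t) * dc).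
Proof.
by move=> Dc; exact: (is_derive1_comp (is_derive_expR (c t)) Dc).
Qed.

(** The product [expR (- Th t) * Z t] has slope at most 0. *)
Lemma gronwall (a b : R) (Z Th : R -> R) : a <= b ->
  abs_cont_on a b Z -> abs_cont_on a b Th ->
  {ae cmu, forall t : R, a < t < b -> exists2 dTh : R, is_derive t 1 Th dTh &
    slope_le [set s | a <= s <= b] Z t (Z t * dTh)} ->
  Z b <= Z a * expR (Th b - Th a).
Proof.
move=> ab acZ acT hae.
have acE : abs_cont_on a b (fun t => expR (- Th t)) by apply/ac_expR/acN.
have := ac_nonincreasing ab (acM acE acZ).
have H : {ae cmu, forall t : R, a < t < b -> slope_le [set s | a <= s <= b]
    (fun t => expR (- Th t) * Z t) t 0}.
  apply: ae_imp hae => t H tab; have [dTh DT sZ] := H tab.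
  have DE : is_derive t 1 (fun s => expR (- Th s)) (expR (- Th t) * (- dTh)).
    by apply: is_derive_expR_comp; exact: is_deriveN.
  have := slope_leM (fun s _ => expR_ge0 (- Th s)) (expR_ge0 (- Th t)) DE sZ.
  by apply: slope_le_weaken => //; lra.
move=> /(_ H) h.
have := ler_wpM2l (expR_ge0 (Th b)) h.
by rewrite !mulrA -!expRD subrr expR0 mul1r mulrC.
Qed.

Section Norm.
Context {H : normedModType R} {ip : H -> H -> R} (hip : is_inner_product ip).

(** Pairing [v] with its own total increment [u] makes the problem scalar: [ip (v t) u - |u| M t]
    does not increase, by Cauchy-Schwarz, and one factor [|u|] cancels. *)
Lemma ac_norm_le (a b : R) (v : R -> H) (M : R -> R) : a <= b ->
  abs_cont_on a b v -> abs_cont_on a b M ->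
  {ae cmu, forall t : R, a < t < b -> exists (dv : H) (dM : R),
     [/\ is_derive t 1 v dv, is_derive t 1 M dM & `|dv| <= dM]} ->
  `|v b - v a| <= M b - M a.
Proof.
move=> ab acv acM_ hae; have [u uE] : exists u, v b - v a = u by eexists.
have ac1 : abs_cont_on a b (fun t => ip (v t) u + - `|u| * M t).
  by apply: acD; [apply: (ac_ip hip) => //; exact: ac_cst|apply: acM => //; exact: ac_cst].
have h : ip (v b) u + - `|u| * M b <= ip (v a) u + - `|u| * M a.
  apply: (ac_nonincreasing ab ac1); apply: ae_imp hae => t H1 tab.
  have [dv [dM [Dv DM le1]]] := H1 tab.
  have D1 := is_derive_ip hip Dv (is_derive_cst u t 1).
  have D2 : is_derive t 1 (fun s => - `|u| * M s) (- `|u| * dM) by exact: is_deriveZ.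
  exists (fun t => ip (v t) u + - `|u| * M t), (ip (v t) 0 + ip dv u + - `|u| * dM).
  split=> //; first exact: is_deriveD.
  rewrite (ip0r hip) add0r mulNr subr_le0 mulrC.
  exact: le_trans (ip_le hip dv u) (ler_wpM2r (normr_ge0 u) le1).
have h2 : ip u u <= `|u| * (M b - M a) by rewrite -{1}uE (ipBl hip); lra.
move: h2; rewrite (ipxx hip) expr2 uE.
(* For [u = 0] there is nothing to cancel; what remains is [M a <= M b], true because the derivative
   of [M] dominates a norm. *)
have [->|u0] := eqVneq u 0; last by rewrite ler_pM2l// normr_gt0.
rewrite normr0 => _.
have := ac_nonincreasing ab (acN acM_); rewrite lerN2 subr_ge0; apply.
apply: ae_imp hae => t H1 tab; have [dv [dM [Dv DM le1]]] := H1 tab.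
apply: (slope_le_weaken (D := setT) (d := - dM)) => //.
  by rewrite oppr_le0 (le_trans _ le1).
by apply: slope_le_derive; exact: is_deriveN.
Qed.

End Norm.

Lemma integral_closed_open (a : R) (h : R -> R) :
  @measurable_fun _ _ CT R [set t | a <= t] h ->
  (\int[cmu]_(s in [set s | (a <= s)%R]) (h s)%:E =
   \int[cmu]_(s in `]a, +oo[) (h s)%:E)%E.
Proof.
move=> mh.
have E : [set t | a <= t] = [set a] `|` `]a, +oo[%classic.
  apply/seteqP; split=> t /=; rewrite in_itv/= andbT.
    by move=> at_; have [->|ta] := eqVneq t a; [left|right; rewrite lt_neqAle eq_sym ta].
  by move=> [->|/ltW].
have m1 : @measurable _ CT [set a].
  by have := completed_measurable_itv `[a, a]; rewrite set_itv1.
have mU : @measurable _ CT ([set a] `|` `]a, +oo[%classic).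
  by rewrite -E; exact: completed_measurable_half_line.
have mh' : @measurable_fun _ _ CT _ ([set a] `|` `]a, +oo[%classic) (fun t => (h t)%:E).
  by apply/measurable_EFinP; rewrite -E.
have disj : [disjoint [set a] & `]a, +oo[%classic].
  rewrite disj_set2E; apply/eqP; rewrite -subset0 => t /= [->].
  by rewrite in_itv/= ltxx.
rewrite E (@integral_setU _ CT R cmu _ _ _ m1 (completed_measurable_itv _) mh' disj).
rewrite (@null_set_integral _ CT R cmu _ _ m1 _ (completed_set1 a)) ?add0e//.
exact: (measurable_funS mU (@subsetUl _ _ _) mh').
Qed.

Lemma primitive_half_line (a : R) (h : R -> R) :
  cmu.-integrable [set t | a <= t] (fun t => (h t)%:E) ->
  exists (F : R -> R) (c : R), [/\ forall u v, abs_cont_on u v F,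
    {ae cmu, forall t : R, a < t -> is_derive t 1 F (h t)} &
    forall t, a <= t ->
      (\int[cmu]_(s in [set s | (t <= s)%R]) (h s)%:E = (c - F t)%:E)%E].
Proof.
move=> ih; have mD := completed_measurable_half_line a.
have [F [acF DF _ [c Ec]]] := primitive_ex (@integrable_restrictT _ CT R cmu _ h mD ih).
exists F, c; split=> //.
  apply: ae_imp DF => t + at_.
  by rewrite patchE mem_set//=; exact: ltW.
move=> t at_; rewrite -Ec integral_closed_open.
  apply: eq_integral => s /set_mem /=; rewrite in_itv/= andbT => ts.
  by rewrite patchE mem_set//=; exact: (le_trans at_ (ltW ts)).
have mh : @measurable_fun _ _ CT R [set t | a <= t] h.
  by apply/measurable_EFinP; case/integrableP: ih.
by apply: measurable_funS mh => // s /=; exact: le_trans.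
Qed.

Lemma primitive_ge0 (a : R) (h : R -> R) : (forall t, a <= t -> 0 <= h t) ->
  cmu.-integrable [set t | a <= t] (fun t => (h t)%:E) ->
  exists (F : R -> R) (K : R), [/\ forall u v, abs_cont_on u v F,
    {ae cmu, forall t : R, a < t -> is_derive t 1 F (h t)},
    forall s t, a <= s -> s <= t -> F s <= F t &
    forall t, a <= t -> 0 <= F t <= K].
Proof.
move=> h0 ih; have [F [c [acF DF Ec]]] := primitive_half_line ih.
have mono s t : a <= s -> s <= t -> F s <= F t.
  move=> as_ st; rewrite -lerN2; apply: (ac_nonincreasing st (acN (acF s t))).
  apply: ae_imp DF => r Hr /andP[sr rt].
  have ar : a < r := le_lt_trans as_ sr.
  apply: (slope_le_weaken (D := setT) (d := - h r)) => //.
    by rewrite oppr_le0 h0// ltW.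
  by apply: slope_le_derive; apply: is_deriveN; exact: Hr.
exists (fun t => F t - F a), (c - F a); split.
- by move=> u v; apply: acB => //; exact: ac_cst.
- apply: ae_imp DF => t Ht at_; rewrite -[h t]subr0.
  by apply: is_deriveB; exact: Ht.
- by move=> s t as_ st; rewrite lerD2r; exact: mono.
- move=> t at_; rewrite subr_ge0 mono//= lerD2r -subr_ge0 -lee_fin -Ec//.
  by apply: integral_ge0 => s /= ts; rewrite lee_fin h0// (le_trans at_ ts).
Qed.

End Gronwall.

(** * Lipschitz regularity of the trajectory and of [f] along it *)

Section Trajectory.
Context {R : realType} {H : normedModType R}.
Variables (ip : H -> H -> R) (alpha beta t0 : R) (f : H -> \bar R)
  (e de x y xi : R -> H).
Local Notation cmu := (@completed_lebesgue_measure R).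
Local Notation CT := (caratheodory_type (wlength (@idfun R))^*%mu).
Hypotheses (hip : is_inner_product ip) (alpha0 : 0 < alpha) (beta0 : 0 < beta)
  (t00 : 0 < t0).
Hypotheses (ace : forall T, t0 < T -> abs_cont_on t0 T e)
  (aede : {ae cmu, forall t : R, t0 < t -> is_derive t 1 e (de t)})
  (ie : cmu.-integrable [set t | t0 <= t] (fun t => (`|e t|)%:E))
  (ide : cmu.-integrable [set t | t0 <= t] (fun t => (`|de t|)%:E)).
Hypotheses (cx : {within [set t | t0 <= t], continuous x})
  (cy : {within [set t | t0 <= t], continuous y})
  (acxy : forall a b, t0 < a -> a <= b -> abs_cont_on a b x /\ abs_cont_on a b y)
  (aesol : {ae cmu, forall t : R, t0 < t ->
     [/\ derivable x t 1, derivable y t 1, subdiff ip f (x t) (xi t),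
         derive1 x t + beta *: xi t + beta *: e t - (beta^-1 - alpha / t) *: x t
           + beta^-1 *: y t = 0
       & derive1 y t - (beta^-1 - alpha / t + alpha * beta / t ^+ 2) *: x t
           + beta^-1 *: y t = 0]}).
Hypotheses (fNy : forall z, f z != -oo%E) (hlsc : lsc_fun f).
Local Notation g := (udot alpha beta e x y).
Local Notation fx := (fun t => fine (f (x t))).

(** The system solved for the derivatives in terms of [g]: the subgradient remains in [x'] only, and
    [y'] equals [g] up to a perturbation made of [e] and [x / t^2]. *)
Record regular (t : R) : Prop := Regular {
  reg_gt : t0 < t;
  reg_e : is_derive t 1 e (de t);
  reg_x : is_derive t 1 x (g t - beta *: xi t);
  reg_y : is_derive t 1 y (g t + beta *: e t + (alpha * beta / t ^+ 2) *: x t);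
  reg_sub : subdiff ip f (x t) (xi t);
  reg_dx : derive1 x t = g t - beta *: xi t }.

Lemma ae_regular : {ae cmu, forall t : R, t0 < t -> regular t}.
Proof.
apply: ae_imp2 aede aesol => t De Hs tt; have [dx dy sd ex ey] := Hs tt.
have Ex : derive1 x t = g t - beta *: xi t.
  apply: (ip_ext hip) => z; have := congr1 (ip^~ z) ex.
  by rewrite /udot !(ipE hip); lra.
have Ey : derive1 y t = g t + beta *: e t + (alpha * beta / t ^+ 2) *: x t.
  apply: (ip_ext hip) => z; have := congr1 (ip^~ z) ey.
  by rewrite /udot !(ipE hip); lra.
split=> //; first exact: De.
- by rewrite -Ex derive1E; exact: derivableP.
- by rewrite -Ey derive1E; exact: derivableP.
Qed.

Lemma ac_e a b : t0 <= a -> abs_cont_on a b e.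
Proof.
move=> ta; apply: (ac_sub ta (_ : b <= Num.max (t0 + 1) b)).
  by rewrite le_max lexx orbT.
by apply: ace; rewrite lt_max ltrDl ltr01.
Qed.

Lemma ac_coef a b : 0 < a -> abs_cont_on a b (fun t => beta^-1 - alpha / t).
Proof.
move=> a0; apply: acB; first exact: ac_cst.
by apply: acM; [exact: ac_cst|exact: ac_inv].
Qed.

Lemma ac_g a b : t0 < a -> a <= b -> abs_cont_on a b g.
Proof.
move=> ta ab; have [hx hy] := acxy ta ab.
apply: acB; last by apply: ac_scale => //; exact: ac_cst.
apply: acD; last by apply: ac_scale => //; exact: (ac_coef _ (lt_trans t00 ta)).
by apply/acN/ac_scale; [exact: ac_cst|exact/ac_e/ltW].
Qed.

Lemma bounded_half_line (v : R -> H) (T : R) :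
  {within [set t | t0 <= t], continuous v} ->
  exists2 K : R, 0 <= K & forall t, t0 <= t <= T -> `|v t| <= K.
Proof.
move=> cv; apply: within_bounded; apply: continuous_subspaceW cv => t /=.
by rewrite in_itv/= => /andP[].
Qed.

Lemma trajectory_bounded T : exists2 K : R, 0 <= K & forall t, t0 <= t <= T ->
  [/\ `|x t| <= K, `|y t| <= K, `|e t| <= K & `|g t| <= K].
Proof.
have [K1 K10 H1] := bounded_half_line T cx.
have [K2 K20 H2] := bounded_half_line T cy.
have [K3 K30 H3] := ac_bounded (ac_e T (lexx t0)).
have [K4 K40 H4] := ac_bounded (ac_coef T t00).
have P1 : 0 <= beta * K3 by rewrite mulr_ge0// ltW.
have P2 : 0 <= K4 * K1 by rewrite mulr_ge0.
have P3 : 0 <= beta^-1 * K2 by rewrite mulr_ge0// invr_ge0 ltW.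
exists (K1 + K2 + K3 + (beta * K3 + K4 * K1 + beta^-1 * K2)).
  by rewrite !addr_ge0.
move=> t tT; have h1 := H1 t tT; have h2 := H2 t tT; have h3 := H3 t tT; have h4 := H4 t tT.
have h5 : `|g t| <= beta * K3 + K4 * K1 + beta^-1 * K2.
  rewrite /udot; apply: (le_trans (ler_normB _ _)); apply: lerD; last first.
    by rewrite normrZ gtr0_norm ?invr_gt0// ler_wpM2l// invr_ge0 ltW.
  apply: (le_trans (ler_normD _ _)); apply: lerD.
    by rewrite normrN normrZ gtr0_norm// ler_wpM2l// ltW.
  by rewrite normrZ ler_pM.
split.
- by apply: (le_trans h1); lra.
- by apply: (le_trans h2); lra.
- by apply: (le_trans h3); lra.
- by apply: (le_trans h5); lra.
Qed.

(** A single bounded function measures the whole perturbation: [M] is the Gronwall exponent for the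
    energy, the correction that makes the energy monotone, and a modulus of continuity for [e]. *)
Lemma perturbation_primitive : exists (M : R -> R) (Mb : R),
  [/\ forall u v, abs_cont_on u v M,
    {ae cmu, forall t : R, t0 < t -> is_derive t 1 M (`|e t| + beta * `|de t|)},
    forall s t, t0 <= s -> s <= t -> M s <= M t,
    forall t, t0 <= t -> 0 <= M t <= Mb &
    forall s t, t0 <= s -> s <= t -> beta * `|e t - e s| <= M t - M s].
Proof.
have mD := completed_measurable_half_line t0.
have im : cmu.-integrable [set t | t0 <= t] (fun t => (`|e t| + beta * `|de t|)%:E).
  have h1 := integrableZl mD beta ide.
  exact: (integrableD mD ie h1).
have m0 t : t0 <= t -> 0 <= `|e t| + beta * `|de t|.
  by move=> _; rewrite addr_ge0// mulr_ge0// ltW.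
have [M [Mb [acM_ DM mono bd]]] := primitive_ge0 m0 im.
exists M, Mb; split=> // s t ts st.
have := @ac_norm_le R H ip hip s t (fun r => beta *: e r) M st.
rewrite -scalerBr normrZ gtr0_norm//; apply.
- by apply: ac_scale; [exact: ac_cst|exact: ac_e].
- exact: acM_.
apply: ae_imp2 DM aede => r DMr Der /andP[sr rt].
have tr := le_lt_trans ts sr.
exists (beta *: de r), (`|e r| + beta * `|de r|); split.
- exact/is_deriveZ/Der.
- exact: DMr.
- by rewrite normrZ gtr0_norm// lerDr.
Qed.

Lemma y_lip s T : t0 < s -> exists2 L : R, 0 <= L &
  forall u v, s <= u -> u <= v -> v <= T -> `|y v - y u| <= L * (v - u).
Proof.
move=> ts; have [K K0 HK] := trajectory_bounded T.
have s0 : 0 < s := lt_trans t00 ts.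
pose L := K + beta * K + (alpha * beta / s ^+ 2) * K.
have L1 : 0 <= alpha * beta / s ^+ 2.
  by apply: ltW; rewrite divr_gt0 ?mulr_gt0 ?exprn_gt0.
have L0 : 0 <= L.
  by rewrite /L !addr_ge0//; apply: mulr_ge0 => //; exact: ltW.
exists L => // u v su uv vT; rewrite mulrBr.
have tu := lt_le_trans ts su.
apply: (@ac_norm_le R H ip hip u v y (fun r => L * r) uv).
- by have [] := acxy tu uv.
- by apply: acM; [exact: ac_cst|exact: ac_id].
apply: ae_imp ae_regular => r Hr /andP[ur rv].
have reg := Hr (lt_trans tu ur).
exists (g r + beta *: e r + (alpha * beta / r ^+ 2) *: x r), L; split.
- exact: reg_y.
- by rewrite -[L in is_derive _ _ _ L]mulr1; exact: is_deriveZ.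
have [h1 h2 h3 h4] : [/\ `|x r| <= K, `|y r| <= K, `|e r| <= K & `|g r| <= K].
  by apply: HK; rewrite (ltW (lt_trans tu ur)) (le_trans (ltW rv) vT).
apply: (le_trans (ler_normD _ _)); apply: lerD.
  apply: (le_trans (ler_normD _ _)); apply: lerD => //.
  by rewrite normrZ gtr0_norm// ler_pM2l.
have sr : s <= r by rewrite (le_trans su)// ltW.
have r0 : 0 < r := lt_le_trans s0 sr.
have q0 : 0 <= alpha * beta / r ^+ 2.
  by apply: ltW; rewrite divr_gt0 ?mulr_gt0 ?exprn_gt0.
rewrite normrZ ger0_norm//; apply: ler_pM => //.
apply: ler_wpM2l; first by apply: ltW; rewrite mulr_gt0.
by rewrite lef_pV2 ?posrE ?exprn_gt0// lerXn2r// nnegrE ltW.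
Qed.

(** [g] is affine in [e], [x], [y]. The coefficients and [y] are Lipschitz in time, but increments
    of [e] are controlled only by those of [M], which are kept as a separate term. *)
Lemma g_increment (M : R -> R) s T :
  (forall u v, t0 <= u -> u <= v -> beta * `|e v - e u| <= M v - M u) ->
  t0 < s -> exists2 C : R, 0 <= C & forall u v, s <= u -> u <= v -> v <= T ->
    `|g v - g u| <= C * (`|x v - x u| + (v - u)) + (M v - M u).
Proof.
move=> hM ts; have [K K0 HK] := trajectory_bounded T.
have [L L0 HL] := y_lip T ts.
have s0 : 0 < s := lt_trans t00 ts.
have [K4 K40 H4] := ac_bounded (ac_coef T s0).
pose Q := alpha * (s^-1 * s^-1).
have Q0 : 0 <= Q by apply: ltW; rewrite /Q !mulr_gt0 ?invr_gt0.
have b1 : 0 <= beta^-1 by rewrite invr_ge0 ltW.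
exists (K4 + Q * K + beta^-1 * L); first by rewrite !addr_ge0// mulr_ge0.
move=> u v su uv vT; have tu := lt_le_trans ts su.
have u0 := lt_trans t00 tu; have v0 := lt_le_trans u0 uv.
have [hx _ _ _] : [/\ `|x u| <= K, `|y u| <= K, `|e u| <= K & `|g u| <= K].
  by apply: HK; rewrite (ltW tu) (le_trans uv vT).
have E : g v - g u = - (beta *: (e v - e u)) + (beta^-1 - alpha / v) *: (x v - x u)
    + (alpha / u - alpha / v) *: x u - beta^-1 *: (y v - y u).
  by apply: (ip_ext hip) => z; rewrite /udot !(ipE hip); lra.
have n1 : `|- (beta *: (e v - e u))| <= M v - M u.
  by rewrite normrN normrZ gtr0_norm//; apply: hM => //; exact: ltW.
have n2 : `|(beta^-1 - alpha / v) *: (x v - x u)| <= K4 * `|x v - x u|.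
  by rewrite normrZ ler_wpM2r// H4// vT (le_trans su uv).
have n3 : `|(alpha / u - alpha / v) *: x u| <= Q * (v - u) * K.
  rewrite normrZ; apply: ler_pM => //.
  have -> : alpha / u - alpha / v = alpha * (u^-1 * v^-1) * (v - u).
    by field; rewrite !gt_eqF.
  rewrite ger0_norm; last first.
    apply: mulr_ge0; last by rewrite subr_ge0.
    by apply: ltW; rewrite !mulr_gt0 ?invr_gt0.
  apply: ler_wpM2r; first by rewrite subr_ge0.
  apply: ler_wpM2l; first exact: ltW.
  apply: ler_pM; rewrite ?invr_ge0 ?(ltW u0) ?(ltW v0)// lef_pV2 ?posrE//.
  exact: le_trans su uv.
have n4 : `|beta^-1 *: (y v - y u)| <= beta^-1 * (L * (v - u)).
  by rewrite normrZ ger0_norm// ler_wpM2l// HL.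
have n0 : `|g v - g u| <= (M v - M u) + K4 * `|x v - x u| + Q * (v - u) * K
    + beta^-1 * (L * (v - u)).
  rewrite E; apply: (le_trans (ler_normB _ _)); apply: lerD n4.
  apply: (le_trans (ler_normD _ _)); apply: lerD n3.
  by apply: (le_trans (ler_normD _ _)); exact: lerD.
apply: (le_trans n0).
have p1 : 0 <= K4 * (v - u) by rewrite mulr_ge0// subr_ge0.
have p2 : 0 <= Q * K * `|x v - x u|.
  by apply: mulr_ge0 => //; apply: mulr_ge0.
have p3 : 0 <= beta^-1 * L * `|x v - x u| by rewrite !mulr_ge0.
lra.
Qed.

Lemma subdiff_monotone x1 x2 xi1 xi2 :
  subdiff ip f x1 xi1 -> subdiff ip f x2 xi2 ->
  0 <= ip (x2 - x1) (xi2 - xi1).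
Proof.
move=> [f1 s1] [f2 s2].
have h1 : fine (f x1) + ip xi1 (x2 - x1) <= fine (f x2).
  by rewrite -lee_fin (fineK f2).
have h2 : fine (f x2) + ip xi2 (x1 - x2) <= fine (f x1).
  by rewrite -lee_fin (fineK f1).
move: h1 h2; rewrite !(ipE hip) !(ipC hip _ xi1) !(ipC hip _ xi2); lra.
Qed.

(** The quotient [(N (r + h) - N r) / h] has derivative [(M (r + h) - M r) / h], a rate that blows
    up as [h] tends to 0, yet it stays between 0 and [Mb]. This makes it a Gronwall exponent that is
    uniform in [h]. *)
Lemma bounded_primitive (M : R -> R) (Mb a b : R) :
  (forall u v, abs_cont_on u v M) -> (forall t, a <= t -> 0 <= M t <= Mb) ->
  exists N : R -> R, [/\ forall u v, abs_cont_on u v N,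
    {ae cmu, forall t : R, a < t <= b -> is_derive t 1 N (M t)} &
    forall u v, a <= u -> u <= v -> v <= b -> 0 <= N v - N u <= Mb * (v - u)].
Proof.
move=> acM_ bd; pose I := `]a, b]%classic : set CT.
have mI : measurable I by exact: completed_measurable_itv.
have cM t : {for t, continuous M}.
  apply/cvgrPdist_lt => eps eps0.
  have tt : t - 1 <= t <= t + 1 by lra.
  have [d d0 Hd] := ac_cont (acM_ (t - 1) (t + 1)) tt eps0.
  apply/nbhs_normP; exists (Num.min d 1) => /=; first by rewrite lt_min d0 /=.
  move=> s /=; rewrite lt_min => /andP[h1 h2]; rewrite distrC; apply: Hd.
    by move: h2; rewrite ltr_norml; lra.
  by rewrite distrC.
have mM : measurable_fun I (M : CT -> R).
  apply: measurable_fun_borel_completed; first exact: measurable_itv.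
  by apply: measurable_funTS; apply: continuous_measurable_fun => t; exact: cM.
have Ioo : (cmu I < +oo)%E.
  have E : (lebesgue_measure `]a, b]%classic < +oo :> \bar R)%E.
    by rewrite lebesgue_measure_itv/=; case: ifP => _; rewrite ?ltry// -EFinD ltry.
  exact: E.
have iM : cmu.-integrable I (fun t => (M t)%:E).
  apply: (@bounded_integrable _ CT R cmu I M Mb mI Ioo mM) => t.
  rewrite /I /= in_itv/= => /andP[/ltW/bd/andP[h1 h2] _].
  by rewrite ger0_norm.
have [N [acN_ DN _ _]] := primitive_ex (@integrable_restrictT _ CT R cmu I M mI iM).
have DN' : {ae cmu, forall t : R, a < t <= b -> is_derive t 1 N (M t)}.
  by apply: ae_imp DN => t + tab; rewrite patchE mem_set// /I /= in_itv.
exists N; split=> // u v au uv vb; apply/andP; split.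
  rewrite subr_ge0 -lerN2; apply: (ac_nonincreasing uv (acN (acN_ u v))).
  apply: ae_imp DN' => t Ht /andP[ut tv].
  have h1 : a < t := le_lt_trans au ut; have h2 : t <= b := le_trans (ltW tv) vb.
  apply: (slope_le_weaken (D := setT) (d := - M t)) => //.
    by rewrite oppr_le0; case/andP: (bd t (ltW h1)).
  by apply: slope_le_derive; apply: is_deriveN; apply: Ht; rewrite h1.
suff : N v - Mb * v <= N u - Mb * u by lra.
have ac2 : abs_cont_on u v (fun t => N t - Mb * t).
  by apply: acB => //; apply: acM; [exact: ac_cst|exact: ac_id].
apply: (ac_nonincreasing uv ac2).
apply: ae_imp DN' => t Ht /andP[ut tv].
have h1 : a < t := le_lt_trans au ut; have h2 : t <= b := le_trans (ltW tv) vb.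
apply: (slope_le_weaken (D := setT) (d := M t - Mb * 1)) => //.
  by rewrite mulr1 subr_le0; case/andP: (bd t (ltW h1)).
by apply: slope_le_derive; apply: is_deriveB; apply: Ht; rewrite h1.
Qed.

(* Monotonicity of the subdifferential makes [|x (t + h) - x t| / h] satisfy a
   Gronwall inequality, so it stays bounded to the right of any point of
   differentiability. *)
Lemma x_lip a b : t0 < a -> a <= b -> exists2 L : R, 0 <= L &
  forall u v, a <= u -> u <= v -> v <= b -> `|x v - x u| <= L * (v - u).
Proof.
move=> ta ab.
(* The estimate starts at a point [s] left of [a] where [x] is differentiable, so that the initial
   difference quotient is bounded. *)
have [s /andP[ts sa] rs'] := ae_ex ta ae_regular.
have rs := rs' ts; pose T := b + 1.
have [M [Mb [acM_ _ _ bdM hM]]] := perturbation_primitive.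
have [C C0 HC] := g_increment T hM ts.
have [N [acN_ DN bN]] := bounded_primitive T acM_ bdM.
have [K K0 HK] := trajectory_bounded T.
have sb : s <= b := le_trans (ltW sa) ab.
have step h t : 0 < h -> h <= 1 -> s <= t -> t <= b ->
    `|x (t + h) - x t| ^+ 2 + h ^+ 2 <=
    (`|x (s + h) - x s| ^+ 2 + h ^+ 2) * expR (3 * C * (b - s) + Mb).
  move=> h0 h1 st tb.
  (* With [n] the norm of the increment and [dM] the increment of [M], the term [h ^+ 2] absorbs
     what is linear in [n]: [2 n dM <= (dM / h) (n^2 + h^2)] and [2 C n (n + h) <= 3 C (n^2 + h^2)].
     These are the two rates in [Th]. *)
  pose Z r := ip (x (r + h) - x r) (x (r + h) - x r) + h ^+ 2.
  pose Th r := 3 * C * r + h^-1 * (N (r + h) - N r).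
  have acx r u v : t0 < u -> u <= v -> 0 <= r -> abs_cont_on u v (fun t => x (t + r)).
    move=> tu uv r0; apply: ac_shift.
    have h2 : t0 < u + r by rewrite (lt_le_trans tu)// lerDl.
    have h3 : u + r <= v + r by rewrite lerD2r.
    by case: (acxy h2 h3).
  have acD_ : abs_cont_on s t (fun r => x (r + h) - x r).
    by apply: acB; [apply: acx => //; exact: ltW|case: (acxy ts st)].
  have acZ : abs_cont_on s t Z.
    by apply: acD; [exact: (ac_ip hip)|exact: ac_cst].
  have acT : abs_cont_on s t Th.
    apply: acD; first by apply: acM; [exact: ac_cst|exact: ac_id].
    by apply: acM; [exact: ac_cst|apply: acB => //; exact: ac_shift].
  have G : Z t <= Z s * expR (Th t - Th s).
    apply: gronwall => //.
    have hae := ae_and (ae_and ae_regular (ae_shift h ae_regular)) (ae_and DN (ae_shift h DN)).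
    apply: ae_imp hae => r [[R1 R2] [N1 N2]] /andP[sr rt].
    have tr : t0 < r := lt_trans ts sr.
    have rT : r + h <= T by rewrite /T; apply: lerD => //; exact: le_trans (ltW rt) tb.
    have trh : t0 < r + h by rewrite (lt_le_trans tr)// lerDl ltW.
    have {}R1 := R1 tr; have {}R2 := R2 trh.
    have {}N1 : is_derive r 1 N (M r).
      by apply: N1; rewrite tr (le_trans _ rT)// lerDl ltW.
    have {}N2 : is_derive (r + h) 1 N (M (r + h)) by apply: N2; rewrite trh.
    pose dD := (g (r + h) - beta *: xi (r + h)) - (g r - beta *: xi r).
    have DD : is_derive r 1 (fun r => x (r + h) - x r) dD.
      by apply: is_deriveB; [exact/is_derive_shift/(reg_x R2)|exact: (reg_x R1)].
    exists (3 * C * 1 + h^-1 * (M (r + h) - M r)).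
      apply: is_deriveD; apply: is_deriveZ.
      by apply: is_deriveB; exact: is_derive_shift.
    have DZ := is_deriveD (is_derive_ip hip DD DD) (is_derive_cst (h ^+ 2) r 1).
    apply: (slope_le_weaken (D := setT)) (slope_le_derive _ DZ) => //.
    have [D DE] : exists D, x (r + h) - x r = D by eexists.
    have mono : 0 <= ip D (xi (r + h) - xi r).
      by rewrite -DE; apply: subdiff_monotone; [exact: (reg_sub R1)|exact: (reg_sub R2)].
    have gi : `|g (r + h) - g r| <= C * (`|D| + h) + (M (r + h) - M r).
      have := HC r (r + h) (ltW sr); rewrite DE (_ : r + h - r = h); last by ring.
      by apply=> //; rewrite lerDl ltW.
    have dM0 : 0 <= M (r + h) - M r.
      apply: (le_trans _ (hM r (r + h) (ltW tr) _)); last by rewrite lerDl ltW.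
      by rewrite mulr_ge0// ltW.
    have [n nE] : exists n : R, `|D| = n by eexists.
    have n0 : 0 <= n by rewrite -nE.
    have [dM dME] : exists d : R, M (r + h) - M r = d by eexists.
    have ipg : ip D (g (r + h) - g r) <= n * (C * (n + h) + dM).
      apply: (le_trans (ip_le hip _ _)); rewrite nE; apply: ler_wpM2l => //.
      by rewrite -dME -nE.
    rewrite /Z /= DE dME (ipxx hip) nE (ipC hip dD) mulr1 addr0.
    have -> : ip D dD = ip D (g (r + h) - g r) - beta * ip D (xi (r + h) - xi r).
      by rewrite /dD !(ipE hip); ring.
    have bm : 0 <= beta * ip D (xi (r + h) - xi r) by rewrite mulr_ge0// ltW.
    apply: (@le_trans _ _ (2 * (n * (C * (n + h) + dM)))).
      by move: ipg bm; lra.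
    rewrite dME in dM0.
    have q1 : 0 <= dM * h^-1 * (n - h) ^+ 2.
      apply: mulr_ge0; last exact: sqr_ge0.
      by rewrite mulr_ge0// invr_ge0 ltW.
    have q2 : 0 <= C * (n - h) ^+ 2 by rewrite mulr_ge0// sqr_ge0.
    have q3 : 0 <= C * h ^+ 2 by rewrite mulr_ge0// sqr_ge0.
    have -> : (n ^+ 2 + h ^+ 2) * (3 * C + h^-1 * dM) =
       3 * C * (n ^+ 2 + h ^+ 2) + dM * h^-1 * (n - h) ^+ 2 + 2 * n * dM.
      by field; rewrite gt_eqF.
    nra.
  have ThB : Th t - Th s <= 3 * C * (b - s) + Mb.
    have rh r : r <= r + h by rewrite lerDl ltW.
    have rT r : r <= b -> r + h <= T by move=> rb; rewrite /T lerD.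
    have /andP[h2 _] := bN s (s + h) (ltW ts) (rh s) (rT s sb).
    have /andP[_ h3] := bN t (t + h) (ltW (lt_le_trans ts st)) (rh t) (rT t tb).
    have hh : h^-1 * (N (t + h) - N t) <= Mb.
      by rewrite ler_pdivrMl// mulrC (le_trans h3)// addrC addKr.
    have hh2 : 0 <= h^-1 * (N (s + h) - N s) by rewrite mulr_ge0// invr_ge0 ltW.
    have hh3 : 3 * C * t <= 3 * C * b by rewrite ler_wpM2l// mulr_ge0.
    by rewrite /Th; lra.
  move: G; rewrite /Z !(ipxx hip) => G; apply: (le_trans G).
  apply: ler_wpM2l; first by rewrite addr_ge0 ?exprn_even_ge0.
  by rewrite ler_expR.
have [d d0 Hd] := (is_derive_epsP _ _ _).1 (reg_x rs) 1 ltr01.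
pose B := `|g s - beta *: xi s|.
have B0 : 0 <= B := normr_ge0 _.
pose h0 := Num.min (d / 2) 1.
have h00 : 0 < h0 by rewrite lt_min divr_gt0//=.
have h0d : h0 < d by rewrite gt_min; apply/orP; left; rewrite ltr_pdivrMr// ltr_pMr// ltr1n.
have h01 : h0 <= 1 by rewrite ge_min lexx orbT.
pose Q := ((1 + B) ^+ 2 + 1) * expR (3 * C * (b - s) + Mb).
have Q0 : 0 <= Q by rewrite mulr_ge0 ?expR_ge0// addr_ge0 ?exprn_even_ge0.
have small h t : 0 < h -> h <= h0 -> s <= t -> t <= b -> `|x (t + h) - x t| <= (Q + 1) * h.
  move=> hp hh st tb.
  have xs : `|x (s + h) - x s| <= (1 + B) * h.
    have := Hd (s + h); rewrite (_ : s + h - s = h); last by ring.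
    rewrite gtr0_norm// => /(_ (le_lt_trans hh h0d)) hq.
    rewrite -[x (s + h) - x s](subrK (h *: (g s - beta *: xi s))).
    apply: (le_trans (ler_normD _ _)); rewrite mulrDl; apply: lerD => //.
    by rewrite normrZ gtr0_norm// mulrC.
  have hst := step h t hp (le_trans hh h01) st tb.
  have B1 : 0 <= (1 + B) * h by apply: mulr_ge0 (addr_ge0 ler01 B0) (ltW hp).
  have Q1 : 0 <= (Q + 1) * h by apply: mulr_ge0 (addr_ge0 Q0 ler01) (ltW hp).
  have xs2 : `|x (s + h) - x s| ^+ 2 <= ((1 + B) * h) ^+ 2.
    by rewrite lerXn2r ?nnegrE.
  have e0 := expR_ge0 (3 * C * (b - s) + Mb).
  have {}hst : `|x (t + h) - x t| ^+ 2 <= Q * h ^+ 2.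
    have := ler_wpM2r e0 xs2; rewrite /Q; have := sqr_ge0 h; move: hst; rewrite exprMn.
    by lra.
  rewrite -(@ler_pXn2r _ 2) ?nnegrE// exprMn; apply: (le_trans hst); apply: ler_wpM2r; first exact: sqr_ge0.
  by nra.
have K2 : 0 <= 2 * K / h0 by apply: divr_ge0 (ltW h00); rewrite mulr_ge0.
(* [Q + 1] serves steps up to [h0]; for longer steps, boundedness of [x] by [K] gives the last
   term. *)
exists (Q + 1 + 2 * K / h0); first by rewrite !addr_ge0.
move=> u v au uv vb.
have su : s <= u := le_trans (ltW sa) au.
have [vu|huv] := leP (v - u) h0.
  have [->|uv'] := eqVneq u v; first by rewrite !subrr normr0 mulr0.
  have hp : 0 < v - u by rewrite subr_gt0 lt_neqAle uv'.
  have := small (v - u) u hp vu su (le_trans uv vb).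
  rewrite (_ : u + (v - u) = v); last by ring.
  move=> /le_trans; apply; apply: ler_wpM2r; first exact: ltW.
  by rewrite lerDl.
have bT : b <= T by rewrite /T lerDl.
have [hu _ _ _] : [/\ `|x u| <= K, `|y u| <= K, `|e u| <= K & `|g u| <= K].
  by apply: HK; rewrite (le_trans (ltW ts) su) (le_trans (le_trans uv vb) bT).
have [hv _ _ _] : [/\ `|x v| <= K, `|y v| <= K, `|e v| <= K & `|g v| <= K].
  by apply: HK; rewrite (le_trans (le_trans (ltW ts) su) uv) (le_trans vb bT).
apply: (le_trans (ler_normB _ _)); apply: (le_trans (lerD hv hu)).
have k1 : K + K <= 2 * K / h0 * (v - u).
  rewrite mulrAC ler_pdivlMr//; have := ler_wpM2l K0 (ltW huv); lra.
apply: (le_trans k1); apply: ler_wpM2r; first by rewrite subr_ge0.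
by rewrite lerDr addr_ge0.
Qed.

Lemma derive_lip_bound (v : R -> H) (a b L t : R) (dv : H) : a < t -> t < b ->
  (forall r s, a <= r -> r <= s -> s <= b -> `|v s - v r| <= L * (s - r)) ->
  is_derive t 1 v dv -> `|dv| <= L.
Proof.
move=> at_ tb lip /is_derive_epsP Dv; apply/ler_addgt0Pr => eps eps0.
have [d d0 Hd] := Dv _ eps0.
pose h := Num.min (d / 2) (b - t).
have h0 : 0 < h by rewrite lt_min divr_gt0// subr_gt0.
have hd : h < d by rewrite gt_min ltr_pdivrMr// ltr_pMr// ltr1n.
have hb : t + h <= b by rewrite -lerBrDl ge_min lexx orbT.
have := Hd (t + h); rewrite (_ : t + h - t = h); last by ring.
rewrite gtr0_norm// => /(_ hd) h1.
have h2 := lip t (t + h) (ltW at_) (ltac:(by rewrite lerDl ltW)) hb.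
rewrite (_ : t + h - t = h) in h2; last by ring.
have : `|h *: dv| <= (L + eps) * h.
  rewrite -[h *: dv](subKr (v (t + h) - v t)).
  by apply: (le_trans (ler_normB _ _)); rewrite mulrDl; exact: lerD.
by rewrite normrZ gtr0_norm// mulrC ler_pM2r.
Qed.

(** Since [x] is Lipschitz, [x'] and hence [xi] are bounded at regular points. The subgradient
    inequality at a regular [s] then gives [f (x t) >= f (x s) - C |t - s|] for every [t]; the
    reverse bound at an arbitrary [t] comes from lower semicontinuity and density of regular
    points. *)
Lemma fx_lip a b : t0 < a -> a <= b -> exists2 C : R, 0 <= C &
  (forall t, a <= t <= b -> f (x t) \is a fin_num) /\
  (forall u v, a <= u -> u <= v -> v <= b -> `|fx v - fx u| <= C * (v - u)).
Proof.
move=> ta ab; pose a' := (t0 + a) / 2; pose b' := b + 1.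
have ta' : t0 < a' by rewrite /a'; lra.
have aa' : a' < a by rewrite /a'; lra.
have bb' : b < b' by rewrite /b'; lra.
have ab' : a' <= b' by lra.
have [L L0 HL] := x_lip ta' ab'.
have [K K0 HK] := trajectory_bounded b'.
have HL2 u v : a' <= u <= b' -> a' <= v <= b' -> `|x v - x u| <= L * `|v - u|.
  move=> /andP[u1 u2] /andP[v1 v2]; have [uv|vu] := leP u v.
    by rewrite [`|v - u|]ger0_norm ?subr_ge0//; exact: HL.
  rewrite distrC [`|v - u|]distrC [`|u - v|]ger0_norm ?subr_ge0 ?(ltW vu)//.
  by apply: HL => //; exact: ltW.
pose Kx := beta^-1 * (K + L).
have b1 : 0 <= beta^-1 by rewrite invr_ge0 ltW.
have Kx0 : 0 <= Kx by rewrite mulr_ge0// addr_ge0.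
have xiB t : regular t -> a' < t -> t < b' -> `|xi t| <= Kx.
  move=> rt at_ tb; have h1 := derive_lip_bound at_ tb HL (reg_x rt).
  have [_ _ _ h2] : [/\ `|x t| <= K, `|y t| <= K, `|e t| <= K & `|g t| <= K].
    by apply: HK; rewrite (ltW (lt_trans ta' at_)) ltW.
  have E : xi t = beta^-1 *: (g t - (g t - beta *: xi t)).
    by rewrite subKr scalerA mulVf ?scale1r// gt_eqF.
  rewrite E normrZ ger0_norm// /Kx ler_wpM2l//.
  by apply: (le_trans (ler_normB _ _)); exact: lerD.
pose C := Kx * L.
have C0 : 0 <= C by rewrite mulr_ge0.
have lower s t : regular s -> a' < s < b' -> a' <= t <= b' ->
    ((fx s - C * `|t - s|)%:E <= f (x t))%E.
  move=> rs /andP[s1 s2] tab; have [fs sub] := reg_sub rs.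
  apply: le_trans (sub (x t)); rewrite lee_fin lerD2l.
  have := ip_norm hip (xi s) (x t - x s); rewrite ler_norml => /andP[h1 _].
  apply: le_trans h1; rewrite lerN2 /C -mulrA; apply: ler_pM => //.
    exact: xiB.
  by apply: HL2 => //; rewrite (ltW s1) ltW.
have dense u v : a' <= u -> u < v -> v <= b' -> exists2 s, u < s < v & regular s.
  move=> au uv vb; have [s sv rs] := ae_ex uv ae_regular; exists s => //.
  by apply: rs; case/andP: sv => us _; rewrite (lt_trans ta')// (le_lt_trans au us).
(* If [f (x t)] exceeded some [c] above the bound, lower semicontinuity would give [c < f (x r)] at
   a regular [r] near [t], against the lower estimate based at [r]. *)
have upper s t : regular s -> a' < s < b' -> a' < t < b' ->
    (f (x t) <= (fx s + C * `|t - s|)%:E)%E.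
  move=> rs sab /andP[t1 t2]; rewrite leNgt; apply/negP => lt1.
  have [c c1 c2] : exists2 c : R, fx s + C * `|t - s| < c & (c%:E < f (x t))%E.
    move: lt1 (fNy (x t)); case: (f (x t)) => [r| |] //.
      rewrite lte_fin => lt1 _; exists ((fx s + C * `|t - s| + r) / 2); first by lra.
      by rewrite lte_fin; lra.
    by move=> _ _; exists (fx s + C * `|t - s| + 1); [lra|rewrite ltry].
  have /nbhs_normP[eps /= eps0 Heps] := hlsc c2.
  (* [d] keeps the error [C (r - t)] below the gap up to [c]; [d2] keeps [x r] in the neighbourhood
     of [x t] where [f] exceeds [c]. *)
  pose d := (c - (fx s + C * `|t - s|)) / (C + 1).
  have C1 : 0 < C + 1 by rewrite ltr_wpDl.
  have d0 : 0 < d by rewrite divr_gt0// subr_gt0.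
  pose d2 := eps / (L + 1).
  have L1 : 0 < L + 1 by rewrite ltr_wpDl.
  have d20 : 0 < d2 by rewrite divr_gt0.
  pose v := Num.min b' (t + Num.min d d2).
  have tv : t < v by rewrite lt_min t2 ltrDl lt_min d0.
  have vb : v <= b' by rewrite ge_min lexx.
  have [r /andP[tr rv] rr] := dense _ _ (ltW t1) tv vb.
  have rt1 : r - t < d /\ r - t < d2.
    have : r < t + Num.min d d2 by rewrite (lt_le_trans rv)// ge_min lexx orbT.
    by rewrite -ltrBlDl lt_min => /andP[].
  have rab : a' < r < b' by rewrite (lt_trans t1 tr) (lt_le_trans rv vb).
  have hc : (c%:E < f (x r))%E.
    apply: Heps; rewrite /= distrC.
    apply: le_lt_trans (HL2 _ _ _ _) _; rewrite ?(ltW t1) ?(ltW t2)//.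
      by case/andP: rab => /ltW -> /ltW ->.
    rewrite gtr0_norm ?subr_gt0//; apply: (@le_lt_trans _ _ ((L + 1) * (r - t))).
      by rewrite ler_wpM2r ?lerDl// subr_ge0 ltW.
    by rewrite mulrC -ltr_pdivlMr//; case: rt1.
  have [fr _] := reg_sub rr.
  have sI : a' <= s <= b' by case/andP: sab => /ltW -> /ltW ->.
  have := lower r s rr rab sI; have [fs _] := reg_sub rs.
  rewrite -(fineK fs) lee_fin => h1.
  have h2 : c < fx r by rewrite -lte_fin (fineK fr).
  have h3 : `|s - r| <= `|t - s| + (r - t).
    rewrite distrC (_ : r - s = (t - s) + (r - t)); last by ring.
    by apply: (le_trans (ler_normD _ _)); rewrite [`|r - t|]gtr0_norm// subr_gt0.
  have h4 : C * `|s - r| <= C * `|t - s| + C * (r - t).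
    by rewrite -mulrDr ler_wpM2l.
  have h5 : C * (r - t) < c - (fx s + C * `|t - s|).
    apply: (@le_lt_trans _ _ ((C + 1) * (r - t))).
      by rewrite ler_wpM2r ?lerDl// subr_ge0 ltW.
    by rewrite mulrC -ltr_pdivlMr//; case: rt1.
  by move: h1 h2 h4 h5; rewrite /=; lra.
have [s0 s0ab rs0] := dense a' b' (lexx _) (ltac:(lra)) (lexx _).
have fin t : a <= t <= b -> f (x t) \is a fin_num.
  move=> /andP[t1 t2].
  have h1 := lower s0 t rs0 s0ab (ltac:(lra)).
  have h2 := upper s0 t rs0 s0ab (ltac:(lra)).
  rewrite fin_numElt (lt_le_trans _ h1) ?ltNyr//=.
  by rewrite (le_lt_trans h2)// ltry.
exists C => //; split=> // u v au uv vb.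
have [->|uv'] := eqVneq u v; first by rewrite !subrr normr0 mulr0.
have {}uv' : u < v by rewrite lt_neqAle uv'.
have [s /andP[us sv] rs] := dense u v (ltac:(lra)) uv' (ltac:(lra)).
have sab : a' < s < b' by lra.
have fu := fin u (ltac:(lra)); have fv := fin v (ltac:(lra)).
have h1 := lower s u rs sab (ltac:(lra)); have h2 := upper s u rs sab (ltac:(lra)).
have h3 := lower s v rs sab (ltac:(lra)); have h4 := upper s v rs sab (ltac:(lra)).
move: h1 h2 h3 h4; rewrite -(fineK fu) -(fineK fv) !lee_fin.
rewrite (distrC u) [`|s - u|]gtr0_norm ?subr_gt0// [`|v - s|]gtr0_norm ?subr_gt0//.
rewrite ler_norml /=.
by move=> *; apply/andP; split; lra.
Qed.

Lemma fx_fin t : t0 < t -> f (x t) \is a fin_num.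
Proof.
move=> tt; have [C _ [fin _]] := fx_lip tt (lexx t).
by apply: fin; rewrite lexx.
Qed.

Lemma fx_ac a b : t0 < a -> a <= b -> abs_cont_on a b fx.
Proof.
by move=> ta ab; have [C _ [_ lip]] := fx_lip ta ab; exact: ac_lip lip.
Qed.

Lemma fx_slope t : regular t ->
  slope_le [set s | t0 < s] fx t (ip (xi t) (g t - beta *: xi t)).
Proof.
move=> rt; have [ft sub] := reg_sub rt.
exists (fun s => fx t + ip (xi t) (x s - x t)), (ip (xi t) (g t - beta *: xi t)); split=> //.
- by rewrite subrr (ip0r hip) addr0.
- move=> s /= ts; rewrite -lee_fin (fineK (fx_fin ts)); exact: sub.
- have D1 := is_deriveB (reg_x rt) (is_derive_cst (x t) t 1).
  have := is_deriveD (is_derive_cst (fx t) t 1)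
    (is_derive_ip hip (is_derive_cst (xi t) t 1) D1).
  by rewrite subr0 (ip0l hip) addr0 add0r.
Qed.

End Trajectory.

(** * Energy estimates and the Lyapunov function *)

Section Energy.
Context {R : realType} {H : normedModType R}.
Variables (ip : H -> H -> R) (alpha beta t0 : R) (f : H -> \bar R)
  (e de x y xi : R -> H) (phi M : R -> R) (Mb : R).
Local Notation cmu := (@completed_lebesgue_measure R).
Local Notation g := (udot alpha beta e x y).
Local Notation reg := (regular ip alpha beta t0 f e de x y xi).
Local Notation m := (fun t => `|e t| + beta * `|de t|).
Local Notation v := (fun t => g t - beta *: xi t).
Hypotheses (hip : is_inner_product ip) (alpha0 : 0 < alpha) (beta0 : 0 < beta)
  (t00 : 0 < t0).
Hypotheses (acx : forall a b, t0 < a -> a <= b -> abs_cont_on a b x)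
  (acy : forall a b, t0 < a -> a <= b -> abs_cont_on a b y)
  (acg : forall a b, t0 < a -> a <= b -> abs_cont_on a b g)
  (acphi : forall a b, t0 < a -> a <= b -> abs_cont_on a b phi)
  (acM_ : forall a b, abs_cont_on a b M)
  (M_bd : forall t, t0 <= t -> 0 <= M t <= Mb)
  (e_M : forall s t, t0 <= s -> s <= t -> beta * `|e t - e s| <= M t - M s)
  (phi_ge0 : forall t, t0 < t -> 0 <= phi t)
  (phi_slope : forall t, reg t -> slope_le [set s | t0 < s] phi t (ip (xi t) (v t)))
  (hae : {ae cmu, forall t : R, t0 < t -> reg t /\ is_derive t 1 M (m t)}).

Lemma is_derive_scale (c : R -> R) (w : R -> H) (t dc : R) (dw : H) :
  is_derive t 1 c dc -> is_derive t 1 w dw ->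
  is_derive t 1 (fun s => c s *: w s) (c t *: dw + dc *: w t).
Proof.
move=> /[dup] Dc /is_derive_cvg cc /is_derive_cvg cw; apply/is_derive_cvg.
have cc0 : c (h + t) @[h --> 0^'] --> c t.
  have /differentiable_continuous cont : differentiable c t.
    by apply/derivable1_diffP; case: Dc.
  apply: (@cvg_comp _ _ _ (fun h => h + t) c _ (nbhs t)) cont.
  have := @cvgD _ _ _ (0^') _ (fun h : R => h) (cst t) (0 : R) t.
  by rewrite add0r; apply; [exact: cvg_within|exact: cvg_cst].
have -> : (fun h : R => h^-1 *: (c (h + t) *: w (h + t) - c t *: w t)) =
   (fun h => c (h + t) *: (h^-1 *: (w (h + t) - w t)) +
             (h^-1 *: (c (h + t) - c t)) *: w t).
  apply/funext => h; apply: (ip_ext hip) => z.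
  by rewrite !(ipE hip) /GRing.scale /=; ring.
apply: cvgD; first exact: cvgZ.
by apply: cvgZ => //; exact: cvg_cst.
Qed.

Lemma is_derive_inv (t : R) : 0 < t -> is_derive t 1 (fun s : R => s^-1) (- (t^-1 * t^-1)).
Proof.
move=> tp; have := @is_deriveV R id t 1 1 (lt0r_neq0 tp) (is_derive_id _ _).
by rewrite /GRing.scale /= mulr1 expr2 invfM.
Qed.

Lemma is_derive_half_normsq (w : R -> H) (t : R) (dw : H) : is_derive t 1 w dw ->
  is_derive t 1 (fun s => 2^-1 * ip (w s) (w s)) (ip (w t) dw).
Proof.
move=> Dw; have := is_deriveZ 2^-1 (is_derive_ip hip Dw Dw).
set d := (X in is_derive _ _ _ X -> _).
suff -> : d = ip (w t) dw by [].
by rewrite /d (ipC hip dw) /GRing.scale /=; field.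
Qed.

Lemma reg_gt0 t : reg t -> 0 < t.
Proof. by move=> rt; exact: lt_trans t00 (reg_gt rt). Qed.

Lemma g_derive t : reg t -> is_derive t 1 g
  (- (alpha / t *: v t) - xi t - e t - beta *: de t).
Proof.
move=> rt; have tp := reg_gt0 rt.
have D1 := is_deriveN (is_deriveZ beta (reg_e rt)).
have Dc : is_derive t 1 (fun s => beta^-1 - alpha * s^-1) (0 - alpha * (- (t^-1 * t^-1))).
  apply: is_deriveB; apply: is_deriveZ; exact: is_derive_inv.
have D2 := is_derive_scale Dc (reg_x rt).
have D3 := is_deriveZ beta^-1 (reg_y rt).
have := is_deriveB (is_deriveD D1 D2) D3.
set d := (X in is_derive _ _ _ X -> _).
suff -> : d = - (alpha / t *: v t) - xi t - e t - beta *: de t by [].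
apply: (ip_ext hip) => z; rewrite /d /udot !(ipE hip).
by field; rewrite !gt_eqF.
Qed.

Local Notation E := (fun t => 2^-1 * ip (g t) (g t) + phi t).

Lemma E_ac a b : t0 < a -> a <= b -> abs_cont_on a b E.
Proof.
move=> ta ab; apply: acD; last exact: acphi.
by apply: acM; [exact: ac_cst|apply: (ac_ip hip); exact: acg].
Qed.

Lemma E_slope t : reg t -> slope_le [set s | t0 < s] E t
  (- (alpha / t) * ip (v t) (v t) - alpha * beta / t * ip (v t) (xi t)
   - beta * ip (xi t) (xi t) - ip (g t) (e t + beta *: de t)).
Proof.
move=> rt; have tp := reg_gt0 rt; have Dg := g_derive rt.
have D1 := is_derive_half_normsq Dg.
have := slope_leD (slope_le_derive [set s | t0 < s] D1) (phi_slope rt).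
apply: slope_le_weaken => //.
rewrite le_eqVlt; apply/orP; left; apply/eqP.
rewrite /=; move: (g t) (xi t) (e t) (de t) => G X e1 d1.
rewrite !(ipE hip) (ipC hip X G).
by field; rewrite gt_eqF.
Qed.

(** The cross term is completed by subtracting [alpha / (2t)] times [|v + beta xi|^2]. This leaves
    [alpha beta^2 / (2t) |xi|^2], at most half of [beta |xi|^2] when [alpha beta <= t]. *)
Lemma E_dissipation t : reg t -> alpha * beta <= t -> slope_le [set s | t0 < s] E t
  (- (alpha / (2 * t)) * ip (v t) (v t) - beta / 2 * ip (xi t) (xi t)
   - ip (g t) (e t + beta *: de t)).
Proof.
move=> rt tab; have tp := reg_gt0 rt; apply: slope_le_weaken (E_slope rt) => //.
rewrite lerD2r /=; move: (xi t) (g t - beta *: xi t) => Xi v1.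
have h : 0 <= ip (v1 + beta *: Xi) (v1 + beta *: Xi).
  by rewrite (ipxx hip) exprn_ge0.
rewrite !(ipE hip) (ipC hip Xi v1) in h.
have [V VE] : exists p, ip v1 v1 = p by eexists.
have [X XE] : exists p, ip Xi Xi = p by eexists.
have [W WE] : exists p, ip v1 Xi = p by eexists.
rewrite VE XE WE in h *.
have X0 : 0 <= X by rewrite -XE (ipxx hip) exprn_ge0.
have a1 : 0 <= alpha / (2 * t) by rewrite divr_ge0 ?mulr_ge0// ltW.
have h2 : 0 <= alpha / (2 * t) * (V + beta * W + beta * (W + beta * X)).
  by apply: mulr_ge0 => //; move: h; lra.
have h3 : alpha / (2 * t) * (beta * beta * X) <= beta / 2 * X.
  rewrite mulrA ler_wpM2r//.
  have -> : alpha / (2 * t) * (beta * beta) = alpha * beta / t * (beta / 2).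
    by field; rewrite gt_eqF.
  apply: ler_piMl; last by rewrite ler_pdivrMr// mul1r.
  by apply: ltW; rewrite divr_gt0.
have -> : - (alpha / t) * V - alpha * beta / t * W - beta * X =
   - (alpha / (2 * t)) * V - alpha / (2 * t) * (V + beta * W + beta * (W + beta * X))
   + alpha / (2 * t) * (beta * beta * X) - beta * X by field; rewrite gt_eqF.
by move: h2 h3; move: (alpha / (2 * t)) => k; lra.
Qed.

(** Young's inequality for [ip xi g]. It holds for all times, in particular before the energy
    becomes dissipative. *)
Lemma phi_slope_const t K : reg t -> `|g t| <= K ->
  slope_le [set s | t0 < s] phi t (K ^+ 2 / (2 * beta) - beta / 2 * ip (xi t) (xi t)).
Proof.
move=> rt gK; apply: slope_le_weaken (phi_slope rt) => //.
rewrite /=; move: gK; move: (g t) (xi t) => G Xi gK.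
rewrite (ipBr hip) (ipZr hip).
have h : 0 <= ip (G - beta *: Xi) (G - beta *: Xi) by rewrite (ipxx hip) exprn_ge0.
rewrite !(ipE hip) (ipC hip Xi G) (ipxx hip G) in h.
have gK2 : `|G| ^+ 2 <= K ^+ 2 by rewrite lerXn2r ?nnegrE// (le_trans _ gK).
rewrite (ipC hip Xi G).
have [X XE] : exists p, ip Xi Xi = p by eexists.
have [W WE] : exists p, ip G Xi = p by eexists.
rewrite XE WE in h *.
have h1 : 2 * beta * W <= K ^+ 2 + beta ^+ 2 * X by move: h gK2; lra.
have h2 : W <= (K ^+ 2 + beta ^+ 2 * X) / (2 * beta).
  by rewrite ler_pdivlMr ?mulr_gt0// mulrC.
have E1 : (K ^+ 2 + beta ^+ 2 * X) / (2 * beta) = K ^+ 2 / (2 * beta) + beta / 2 * X.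
  by field; rewrite gt_eqF.
by rewrite E1 in h2; lra.
Qed.

(** As [phi] grows at rate at most [C], a large value at [t] forces large values on all of []t0,
    t]]. By the subgradient inequality at [x0], [|x r - x0|^2 / 2] then decreases there at rate at
    least [A], which keeps [x] away from [x0] near [t0]. *)
Lemma phi_bounded_near (x0 : H) (c0 T K : R) :
  t0 < T -> (forall t, t0 < t -> t <= T -> `|x t| <= K /\ `|g t| <= K) -> 0 <= K ->
  `|x0| <= K ->
  (forall t, reg t -> phi t - c0 <= ip (xi t) (x t - x0)) ->
  (forall eps, 0 < eps -> exists2 s, t0 < s & forall r, t0 < r -> r < s ->
     `|x r - x0| ^+ 2 < eps) ->
  exists B : R, forall t, t0 < t -> t <= T -> phi t <= B.
Proof.
move=> tT bd K0 x0K sub x0lim.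
pose C := K ^+ 2 / (2 * beta).
have C0 : 0 <= C.
  by apply: divr_ge0; [exact: exprn_ge0|apply: mulr_ge0 => //; exact: ltW].
have step s t : t0 < s -> s <= t -> t <= T -> phi t <= phi s + C * (t - s).
  move=> ts st tT'.
  have ac1 : abs_cont_on s t (fun r => phi r + - C * r).
    by apply: acD; [exact: acphi|apply: acM; [exact: ac_cst|exact: ac_id]].
  suff : phi t + - C * t <= phi s + - C * s by lra.
  apply: (ac_nonincreasing st ac1); apply: ae_imp hae => r Hr /andP[sr rt].
  have tr := lt_trans ts sr; have [rr _] := Hr tr.
  have [_ gK] := bd r tr (le_trans (ltW rt) tT').
  have D2 : is_derive r 1 (fun s => - C * s) (- C * 1) by exact: is_deriveZ.
  have := slope_leD (phi_slope_const rr gK) (slope_le_derive [set s | t0 < s] D2).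
  apply: slope_le_weaken; first by move=> q /= /andP[h1 _]; exact: lt_le_trans ts h1.
  have : 0 <= beta / 2 * ip (xi r) (xi r).
    apply: mulr_ge0; first by apply: ltW; rewrite divr_gt0.
    by rewrite (ipxx hip) exprn_ge0.
  by rewrite -/C mulr1; lra.
pose C1 := (K + K) * K.
exists (C * (T - t0) + c0 + C1 / beta) => t tt tT'.
pose A := beta * (phi t - C * (T - t0) - c0) - C1.
suff : A <= 0.
  rewrite /A subr_le0 -ler_pdivlMl// mulrC; lra.
rewrite leNgt; apply/negP => A0.
have key s : t0 < s -> s <= t -> A * (t - s) <= 2^-1 * `|x s - x0| ^+ 2.
  move=> ts st.
  pose F r := 2^-1 * ip (x r - x0) (x r - x0) + A * r.
  have acF : abs_cont_on s t F.
    apply: acD; last by apply: acM; [exact: ac_cst|exact: ac_id].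
    have acB_ : abs_cont_on s t (fun r => x r - x0) by apply: acB; [exact: acx|exact: ac_cst].
    by apply: acM; [exact: ac_cst|exact: (ac_ip hip)].
  have : F t <= F s.
    apply: (ac_nonincreasing st acF); apply: ae_imp hae => r Hr /andP[sr rt].
    have tr := lt_trans ts sr; have [rr _] := Hr tr.
    have [xK gK] := bd r tr (le_trans (ltW rt) tT').
    have Dx : is_derive r 1 (fun s => x s - x0) (v r).
      by have := is_deriveB (reg_x rr) (is_derive_cst x0 r 1); rewrite subr0.
    have D2 : is_derive r 1 (fun s => A * s) (A * 1) by exact: is_deriveZ.
    have D1 := is_deriveD (is_derive_half_normsq Dx) D2.
    apply: slope_le_weaken (slope_le_derive setT D1) => //.
    have h1 := sub r rr; have h2 := step r t tr (ltW rt) tT'.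
    have h3 : ip (x r - x0) (g r) <= C1.
      apply: (le_trans (ip_le hip _ _)); apply: ler_pM => //.
      by apply: (le_trans (ler_normB _ _)); exact: lerD.
    have h4 : C * (t - r) <= C * (T - t0).
      by apply: ler_wpM2l => //; apply: lerB => //; exact: ltW.
    have h5 : beta * (phi t - C * (T - t0) - c0) <= beta * ip (xi r) (x r - x0).
      by rewrite ler_pM2l//; lra.
    rewrite mulr1.
    move: h3 h5; rewrite /A; move: (x r - x0) (g r) (xi r) => w G Xi h3 h5.
    have -> : ip w (G - beta *: Xi) = ip w G - beta * ip Xi w.
      by rewrite !(ipE hip) (ipC hip w Xi).
    by lra.
  have p0 : 0 <= ip (x t - x0) (x t - x0) by rewrite (ipxx hip) exprn_ge0.
  by rewrite /F (ipxx hip (x s - x0)); lra.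
have eps0 : 0 < A * (t - t0) by rewrite mulr_gt0// subr_gt0.
have [s ts Hs] := x0lim _ eps0.
(* [r] is close enough to [t0] for the smallness of [|x r - x0|^2], and [t - r] is at least half of
   [t - t0]; the two estimates of [A (t - t0)] collide. *)
pose r := t0 + Num.min (s - t0) (t - t0) / 2.
have mp : 0 < Num.min (s - t0) (t - t0) by rewrite lt_min !subr_gt0 ts.
have ms : Num.min (s - t0) (t - t0) <= s - t0 by rewrite ge_min lexx.
have mt : Num.min (s - t0) (t - t0) <= t - t0 by rewrite ge_min lexx orbT.
have tr : t0 < r by rewrite /r; lra.
have rs : r < s by rewrite /r; lra.
have rt : r <= t by rewrite /r; lra.
have := key r tr rt; have := Hs r tr rs.
have : A * (t - t0) <= 2 * (A * (t - r)).
  rewrite mulrCA ler_pM2l// /r; lra.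
lra.
Qed.

Lemma E_ge0 t : t0 < t -> 0 <= E t.
Proof.
move=> tt; rewrite addr_ge0 ?phi_ge0// mulr_ge0 ?invr_ge0//.
by rewrite (ipxx hip) exprn_ge0.
Qed.

Lemma g_norm_le t : t0 < t -> `|g t| <= 1 + E t.
Proof.
move=> tt; have := phi_ge0 tt; rewrite (ipxx hip).
have : 0 <= (`|g t| - 1) ^+ 2 by exact: sqr_ge0.
move: (`|g t|) => n; nra.
Qed.

Lemma ip_e_le t : `|ip (g t) (e t + beta *: de t)| <= `|g t| * m t.
Proof.
apply: (le_trans (ip_norm hip _ _)); apply: ler_wpM2l => //.
by apply: (le_trans (ler_normD _ _)); rewrite normrZ gtr0_norm.
Qed.

(** [4 alpha beta <= t1] makes [alpha beta / t] at most [1/4], so that corrections of order [1/t^2]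
    are dominated by [1/t]; [1 <= t1] gives [1/t <= 1] and a nonnegative logarithm. *)
Variable t1 : R.
Hypotheses (t01 : t0 < t1) (t1ab : 4 * alpha * beta <= t1) (t1_ge1 : 1 <= t1).

Lemma t1_ab t : t1 <= t -> alpha * beta <= t.
Proof.
move=> tt; have : 0 <= alpha * beta by apply: ltW; rewrite mulr_gt0.
by move: t1ab tt; lra.
Qed.

(** Bounding [|g|] by [1 + E] makes the perturbation linear in [1 + E], with rate the derivative of
    the bounded function [M]. *)
Lemma E_bounded : exists2 G : R, 1 <= G & forall t, t1 <= t -> 1 + E t <= G.
Proof.
have Mb0 : 0 <= Mb by have /andP[h1 h2] := M_bd (lexx t0); exact: le_trans h1 h2.
exists ((1 + E t1) * expR Mb).
  have h1 : 1 <= expR Mb by have := expR_ge1Dx Mb; lra.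
  have h2 : 1 <= 1 + E t1 by rewrite lerDl E_ge0.
  by rewrite -[leLHS]mulr1; apply: ler_pM.
move=> t tt.
have ac1 : abs_cont_on t1 t (fun s => 1 + E s).
  by apply: acD; [exact: ac_cst|exact: E_ac].
have Gr := @gronwall R t1 t (fun s => 1 + E s) M tt ac1 (acM_ t1 t).
apply: (le_trans (Gr _)).
  apply: ae_imp hae => s Hs /andP[h1 h2].
  have ts : t0 < s := lt_trans t01 h1.
  have [rs DM] := Hs ts; exists (m s) => //.
  have sE := E_dissipation rs (t1_ab (ltW h1)).
  have := slope_leD (slope_le_derive [set s | t0 < s] (is_derive_cst (1 : R) s 1)) sE.
  apply: slope_le_weaken; first by move=> r /= /andP[q1 _]; exact: lt_le_trans t01 q1.
  rewrite add0r.
  have sp := reg_gt0 rs.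
  have p1 : 0 <= alpha / (2 * s) * ip (v s) (v s).
    by rewrite (ipxx hip) mulr_ge0 ?exprn_ge0// ltW// divr_gt0// mulr_gt0.
  have p2 : 0 <= beta / 2 * ip (xi s) (xi s).
    by rewrite (ipxx hip) mulr_ge0 ?exprn_ge0// ltW// divr_gt0.
  have p3 : - ip (g s) (e s + beta *: de s) <= `|g s| * m s.
    by have := ip_e_le s; rewrite ler_norml => /andP[q1 _]; rewrite lerNl.
  have p4 : `|g s| * m s <= (1 + E s) * m s.
    apply: ler_wpM2r; last exact: g_norm_le.
    by apply: addr_ge0 => //; apply: mulr_ge0 => //; exact: ltW.
  by move: p1 p2 p3 p4 => /=; lra.
apply: ler_wpM2l; first by rewrite addr_ge0// E_ge0.
have /andP[_ h3] := M_bd (ltW (lt_le_trans t01 tt)).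
have /andP[h4 _] := M_bd (ltW t01).
by rewrite ler_expR; lra.
Qed.

Variable G : R.
Hypotheses (G_ge1 : 1 <= G) (EG : forall t, t1 <= t -> 1 + E t <= G).

Lemma g_le_G t : t1 <= t -> `|g t| <= G.
Proof.
by move=> tt; apply: le_trans (g_norm_le (lt_le_trans t01 tt)) (EG tt).
Qed.

(** As [|g| <= G], the work of the perturbation is at most [G] times the derivative of [M].
    Subtracting [G * M] leaves pure dissipation, and [V] stays bounded. *)
Local Notation V := (fun t => E t + - G * M t).

Lemma V_ac a b : t0 < a -> a <= b -> abs_cont_on a b V.
Proof.
by move=> ta ab; apply: acD; [exact: E_ac|apply: acM; [exact: ac_cst|exact: acM_]].
Qed.

Lemma V_ge t : t1 <= t -> - (G * Mb) <= V t.
Proof.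
move=> tt; have tt0 := lt_le_trans t01 tt.
have /andP[_ h] := M_bd (ltW tt0); have := E_ge0 tt0.
have := ler_wpM2l (le_trans ler01 G_ge1) h; rewrite mulNr; lra.
Qed.

Lemma V_le t : t1 <= t -> V t <= G.
Proof.
move=> tt; have tt0 := lt_le_trans t01 tt.
have /andP[h _] := M_bd (ltW tt0).
have := mulr_ge0 (le_trans ler01 G_ge1) h; have := EG tt; rewrite mulNr; lra.
Qed.

Lemma V_slope t : reg t -> is_derive t 1 M (m t) -> t1 <= t ->
  slope_le [set s | t0 < s] V t
    (- (alpha / (2 * t)) * ip (v t) (v t) - beta / 2 * ip (xi t) (xi t)).
Proof.
move=> rt DM tt.
have D2 : is_derive t 1 (fun s => - G * M s) (- G * m t) by exact: is_deriveZ.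
have := slope_leD (E_dissipation rt (t1_ab tt)) (slope_le_derive [set s | t0 < s] D2).
apply: slope_le_weaken => //.
have p3 : - ip (g t) (e t + beta *: de t) <= `|g t| * m t.
  by have := ip_e_le t; rewrite ler_norml => /andP[q1 _]; rewrite lerNl.
have p4 : `|g t| * m t <= G * m t.
  apply: ler_wpM2r; last exact: g_le_G.
  by apply: addr_ge0 => //; apply: mulr_ge0 => //; exact: ltW.
by move: p3 p4 => /=; lra.
Qed.

(** Completing the square [|x/t - v/2|^2 / t] bounds the derivative of [|x/t|^2 / 2] by
    [|v|^2 / (4t)], which is exactly what [(2 alpha)^-1 V] dissipates in [v]. *)
Lemma x_growth : exists2 X : R, 0 <= X & forall t, t1 <= t -> `|x t| <= X * t.
Proof.
pose w s := s^-1 *: x s.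
pose Y s := 2^-1 * ip (w s) (w s) + (2 * alpha)^-1 * V s.
pose Q := 2 * (Y t1 + (2 * alpha)^-1 * (G * Mb)).
have a1 : 0 < (2 * alpha)^-1 by rewrite invr_gt0 mulr_gt0.
have QH t : t1 <= t -> `|w t| ^+ 2 <= Q.
  move=> tt; have tp : 0 < t1 := lt_trans t00 t01.
  have acw : abs_cont_on t1 t w by apply: ac_scale; [exact: ac_inv|exact: acx].
  have acY : abs_cont_on t1 t Y.
    apply: acD; apply: acM; try exact: ac_cst; first exact: (ac_ip hip).
    exact: V_ac.
  have : Y t <= Y t1.
    apply: (ac_nonincreasing tt acY); apply: ae_imp hae => s Hs /andP[h1 h2].
    have [rs DM] := Hs (lt_trans t01 h1); have sp := reg_gt0 rs.
    have Dw := is_derive_half_normsq (is_derive_scale (is_derive_inv sp) (reg_x rs)).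
    have := slope_leD (slope_le_derive [set s | t0 < s] Dw)
      (slope_leZ (ltW a1) (V_slope rs DM (ltW h1))).
    apply: slope_le_weaken; first by move=> r /= /andP[q1 _]; exact: lt_le_trans t01 q1.
    rewrite /=; move: (xi s) (g s - beta *: xi s) (x s) => Xi v1 xs.
    have i0 : 0 < s^-1 by rewrite invr_gt0.
    have sq : 0 <= s^-1 * ip (s^-1 *: xs - 2^-1 *: v1) (s^-1 *: xs - 2^-1 *: v1).
      by rewrite (ipxx hip) mulr_ge0 ?exprn_ge0// ltW.
    have Xi0 : 0 <= (2 * alpha)^-1 * (beta / 2 * ip Xi Xi).
      rewrite (ipxx hip); apply: mulr_ge0; first exact: ltW.
      by apply: mulr_ge0; [apply: ltW; rewrite divr_gt0|exact: exprn_ge0].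
    have E1 : (2 * alpha)^-1 * (- (alpha / (2 * s)) * ip v1 v1 - beta / 2 * ip Xi Xi)
      = - (s^-1 / 4 * ip v1 v1) - (2 * alpha)^-1 * (beta / 2 * ip Xi Xi).
      by field; rewrite !gt_eqF.
    rewrite E1; move: sq; rewrite !(ipE hip) (ipC hip v1 xs); lra.
  have h1 := V_ge tt; have h2 := ler_wpM2l (ltW a1) h1.
  by rewrite {1}/Y (ipxx hip) /Q /=; move: h2 => /=; lra.
have Q0 : 0 <= Q by apply: le_trans (QH t1 (lexx _)); exact: exprn_ge0.
exists (1 + Q); first exact: addr_ge0.
move=> t tt; have tp : 0 < t := lt_trans t00 (lt_le_trans t01 tt).
have := QH t tt; rewrite /w normrZ gtr0_norm ?invr_gt0// => h.
rewrite -ler_pdivrMr// mulrC; move: h; move: (t^-1 * `|x t|) => n h.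
have : 0 <= (n - 1) ^+ 2 by exact: sqr_ge0.
by nra.
Qed.

(** The definition of [g] gives [y - x = - (alpha beta / t) x - beta g - beta^2 e], which is even
    bounded. *)
Lemma growth (z : H) : exists2 P : R, 0 <= P & forall t, t1 <= t ->
  [/\ `|x t| <= P * t, `|y t - z| <= P * t & `|y t - x t| <= P * t].
Proof.
have [X X0 HX] := x_growth.
have Mb0 : 0 <= Mb by have /andP[h1 h2] := M_bd (lexx t0); exact: le_trans h1 h2.
pose eb := `|e t0| + beta^-1 * Mb.
have bi : 0 <= beta^-1 by rewrite invr_ge0 ltW.
have eb0 : 0 <= eb by apply: addr_ge0 => //; exact: mulr_ge0.
have G0 := le_trans ler01 G_ge1.
pose Q := alpha * beta * X + beta * G + beta * (beta * eb).
have ge_a := ltW alpha0; have ge_b := ltW beta0.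
have Q0 : 0 <= Q.
  apply: addr_ge0; first by apply: addr_ge0; do ?[exact: mulr_ge0|apply: mulr_ge0].
  by apply: mulr_ge0 => //; exact: mulr_ge0.
exists (2 * X + Q + `|z|).
  by apply: addr_ge0 => //; apply: addr_ge0 => //; exact: mulr_ge0.
move=> t tt; have hx := HX t tt; have hg := g_le_G tt.
have tt0 := lt_le_trans t01 tt.
have tp : 0 < t := lt_trans t00 tt0; have t_ge1 := le_trans t1_ge1 tt.
have he : `|e t| <= eb.
  rewrite -[e t](subrK (e t0)) addrC; apply: (le_trans (ler_normD _ _)).
  rewrite lerD2l ler_pdivlMl//; apply: (le_trans (e_M (lexx t0) (ltW tt0))).
  have /andP[_ h1] := M_bd (ltW tt0); have /andP[h2 _] := M_bd (lexx t0); lra.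
have Eq : y t - x t = - ((alpha * beta / t) *: x t) - beta *: g t - beta *: (beta *: e t).
  apply: (ip_ext hip) => w; rewrite /udot !(ipE hip).
  by field; rewrite !gt_eqF.
have hq : `|y t - x t| <= Q.
  rewrite Eq; apply: (le_trans (ler_normB _ _)); apply: lerD; last first.
    by rewrite !normrZ gtr0_norm// !ler_pM2l.
  apply: (le_trans (ler_normB _ _)); apply: lerD; last first.
    by rewrite normrZ gtr0_norm// ler_pM2l.
  rewrite normrN normrZ gtr0_norm ?divr_gt0 ?mulr_gt0// mulrAC ler_pdivrMr//.
  by rewrite -[leRHS]mulrA ler_pM2l// mulr_gt0.
have Qt : Q <= Q * t by rewrite ler_peMr.
have zt : `|z| <= `|z| * t by rewrite ler_peMr.
have Xt : 0 <= X * t by rewrite mulr_ge0// ltW.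
have zt0 := le_trans (normr_ge0 z) zt.
have qt0 := le_trans Q0 Qt.
have -> : (2 * X + Q + `|z|) * t = 2 * (X * t) + Q * t + `|z| * t by ring.
move: hx Qt zt Xt zt0 qt0.
move: (X * t) (Q * t) (`|z| * t) => a b c hx Qt zt Xt zt0 qt0.
split.
- by apply: (le_trans hx); lra.
- rewrite -(subrKA (x t)); apply: (le_trans (ler_normD _ _)).
  apply: (le_trans (lerD hq (ler_normB _ _))).
  by apply: (le_trans (lerD Qt (lerD hx zt))); lra.
- by apply: (le_trans hq); lra.
Qed.

(* With [p = y - z] and [q = y - x], so that [q' = beta xi + r], the terms in
   [<y', p>] cancel and [<xi, q>] is an exact derivative up to [<r, q>]. *)
Lemma lyapunov_estimate (g1 Xi es r p q : H) (i P mm : R) :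
  0 < i -> i <= 1 -> 4 * alpha * beta * i <= 1 -> 0 <= P -> 0 <= mm ->
  i * `|p| <= P -> i * `|q| <= P -> `|g1| <= G -> `|es| <= mm ->
  `|r| <= beta * mm + alpha * beta * P * i ->
  i * (ip g1 (g1 + r) + ip (- (alpha * i *: (g1 - beta *: Xi)) - Xi - es) p)
  + ip g1 p * - (i * i)
  + (1 + alpha) * ip (i *: p) (i *: (g1 + r) + (- (i * i)) *: p)
  + beta^-1 * ((i - alpha * beta * (i * i)) * ip q (beta *: Xi + r)
      + 2^-1 * ip q q * (- (i * i) + alpha * beta * (2 * (i * (i * i))))) <=
  - (i - alpha * beta * (i * i)) * ip Xi (p - q) + i * ip g1 g1
  + (2 * P + (1 + alpha) * P * beta + G * beta) * mm
  + (beta * (alpha * P) ^+ 2 + (1 + alpha) * P * (alpha * beta * P)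
     + G * (alpha * beta * P)) * (i * i).
Proof.
move=> i0 i1 ab P0 mm0 pP qP gG esm rB.
(* An exact identity that separates the two leading terms; each remaining term is bounded by a
   multiple of [mm] or of [i * i], both of which are integrable in time. *)
have E1 : i * (ip g1 (g1 + r) + ip (- (alpha * i *: (g1 - beta *: Xi)) - Xi - es) p)
  + ip g1 p * - (i * i)
  + (1 + alpha) * ip (i *: p) (i *: (g1 + r) + (- (i * i)) *: p)
  + beta^-1 * ((i - alpha * beta * (i * i)) * ip q (beta *: Xi + r)
      + 2^-1 * ip q q * (- (i * i) + alpha * beta * (2 * (i * (i * i))))) =
  - (i - alpha * beta * (i * i)) * ip Xi (p - q) + i * ip g1 g1
  + ((i - alpha * beta * (i * i)) * (beta^-1 * ip q r)
     + (i * `|q|) ^+ 2 * ((- 1 + 2 * (alpha * beta * i)) / (2 * beta))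
     + (1 + alpha) * (i * (i * ip r p)) - (1 + alpha) * (i * (i * (i * ip p p)))
     - i * ip es p + i * ip g1 r).
  rewrite [(i * `|q|) ^+ 2]exprMn -(ipxx hip q) !(ipE hip).
  rewrite (ipC hip p g1) (ipC hip p r) (ipC hip q Xi).
  by field; rewrite gt_eqF.
rewrite E1 -!addrA lerD2l lerD2l !addrA.
have [u uE] : exists u, i * `|q| = u by eexists.
have [n nE] : exists n, i * `|p| = n by eexists.
have n0 : 0 <= n by rewrite -nE mulr_ge0// ltW.
have u0 : 0 <= u by rewrite -uE mulr_ge0// ltW.
rewrite uE nE in pP qP *.
have [nr nrE] : exists nr, `|r| = nr by eexists.
have nr0 : 0 <= nr by rewrite -nrE.
rewrite nrE in rB.
have ab0 : 0 < alpha * beta by rewrite mulr_gt0.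
have abi : alpha * beta * i <= 4^-1 by move: ab; lra.
have abi0 : 0 < alpha * beta * i by rewrite mulr_gt0.
have w0 : 0 <= 1 - alpha * beta * i by lra.
have G0 := le_trans ler01 G_ge1.
have T1 : (i - alpha * beta * (i * i)) * (beta^-1 * ip q r) <= P * mm + alpha * P * (i * u).
  have -> : (i - alpha * beta * (i * i)) * (beta^-1 * ip q r) =
     beta^-1 * ((1 - alpha * beta * i) * (i * ip q r)) by ring.
  rewrite ler_pdivrMl//.
  apply: (@le_trans _ _ (u * nr)).
    have iq : i * ip q r <= u * nr.
      by rewrite -uE -nrE -mulrA ler_pM2l//; exact: ip_le.
    apply: (@le_trans _ _ ((1 - alpha * beta * i) * (u * nr))).
      by apply: ler_wpM2l.
    by apply: ler_piMl; [exact: mulr_ge0|lra].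
  apply: (@le_trans _ _ (u * (beta * mm + alpha * beta * P * i))); first exact: ler_wpM2l.
  have : beta * mm * u <= beta * mm * P by apply: ler_wpM2l => //; rewrite mulr_ge0// ltW.
  lra.
(* Here [alpha * beta * i <= 1/4] keeps half of the decay of the weight. *)
have T2 : u ^+ 2 * ((- 1 + 2 * (alpha * beta * i)) / (2 * beta)) <= - (u ^+ 2 / (4 * beta)).
  rewrite -mulrN; apply: ler_wpM2l; first exact: sqr_ge0.
  rewrite ler_pdivrMr ?mulr_gt0//.
  have -> : - (4 * beta)^-1 * (2 * beta) = - 2^-1 by field; rewrite gt_eqF.
  lra.
(* AM-GM: the cross term is absorbed by the decay of the weight of [|q|^2] *)
have T12 : alpha * P * (i * u) <= u ^+ 2 / (4 * beta) + beta * (alpha * P) ^+ 2 * (i * i).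
  have -> : u ^+ 2 / (4 * beta) + beta * (alpha * P) ^+ 2 * (i * i) =
    alpha * P * (i * u) + beta * (u / (2 * beta) - alpha * P * i) ^+ 2.
    by field; rewrite gt_eqF.
  by rewrite lerDl mulr_ge0 ?sqr_ge0// ltW.
have a1 : 0 <= 1 + alpha by rewrite addr_ge0// ltW.
have imm : i * mm <= mm by apply: ler_piMl.
have inr : i * nr <= beta * mm + alpha * beta * P * (i * i).
  apply: (@le_trans _ _ (i * (beta * mm + alpha * beta * P * i))).
    by rewrite ler_pM2l.
  by have := ler_wpM2l (ltW beta0) imm; lra.
have T3 : (1 + alpha) * (i * (i * ip r p)) <=
   (1 + alpha) * P * beta * mm + (1 + alpha) * P * (alpha * beta * P) * (i * i).
  have h : i * (i * ip r p) <= P * (beta * mm + alpha * beta * P * (i * i)).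
    apply: (@le_trans _ _ (n * (i * nr))).
      have : ip r p <= nr * `|p| by rewrite -nrE; exact: ip_le.
      move=> /(ler_wpM2l (ltW i0)) /(ler_wpM2l (ltW i0)); rewrite -nE; lra.
    by apply: ler_pM => //; apply: mulr_ge0 => //; exact: ltW.
  by have := ler_wpM2l a1 h; lra.
have T4 : 0 <= (1 + alpha) * (i * (i * (i * ip p p))).
  rewrite mulr_ge0// (ipxx hip).
  by do 3 (apply: mulr_ge0; first exact: ltW); exact: exprn_ge0.
have T5 : - (i * ip es p) <= P * mm.
  have : - ip es p <= `|es| * `|p|.
    by have := ip_norm hip es p; rewrite ler_norml => /andP[h _]; rewrite lerNl.
  move=> /(ler_wpM2l (ltW i0)).
  have h : n * `|es| <= P * mm by apply: ler_pM.
  by rewrite mulrN; move: h; rewrite -nE; lra.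
have T6 : i * ip g1 r <= G * beta * mm + G * (alpha * beta * P) * (i * i).
  have : ip g1 r <= G * nr.
    by apply: (le_trans (ip_le hip _ _)); rewrite nrE ler_wpM2r.
  move=> /(ler_wpM2l (ltW i0)).
  by have := ler_wpM2l G0 inr; lra.
by move: T1 T2 T12 T3 T4 T5 T6; lra.
Qed.

(** The slope of the first three terms is [- w <xi, x - z>] up to [|g|^2 / t] and integrable errors.
    The subgradient inequality turns [<xi, x - z>] into [phi - cz]; the kinetic part of [E] and the
    [|g|^2 / t] are paid by dissipation. *)
Lemma lyapunov (z : H) (cz : R) :
  (forall t, reg t -> phi t - cz <= ip (xi t) (x t - z)) ->
  exists (Lam : R -> R) (K : R),
  [/\ forall a b, t0 < a -> a <= b -> abs_cont_on a b Lam,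
      forall t, t1 <= t -> - K <= Lam t &
      {ae cmu, forall t : R, t1 < t -> slope_le [set s | t0 < s] Lam t
        (- (t^-1 - alpha * beta * (t^-1 * t^-1)) * (E t - cz))}].
Proof.
move=> sub; have [P P0 HP] := growth z.
pose A := 2 * P + (1 + alpha) * P * beta + G * beta.
pose B := beta * (alpha * P) ^+ 2 + (1 + alpha) * P * (alpha * beta * P)
     + G * (alpha * beta * P).
(* The terms to absorb total at most [(3/2) i |g|^2], hence [3 i |v|^2 + 3 beta^2 |xi|^2]. In
   [D * V], the part [8 / alpha] dissipates [4 i |v|^2] and the part [8 beta] dissipates
   [4 beta^2 |xi|^2]. *)
pose D := 8 / alpha + 8 * beta.
have D0 : 0 <= D by apply: ltW; rewrite addr_gt0 ?divr_gt0 ?mulr_gt0.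
have G0 := le_trans ler01 G_ge1.
have ge_a := ltW alpha0; have ge_b := ltW beta0.
have A0 : 0 <= A.
  rewrite /A; apply: addr_ge0; last exact: mulr_ge0.
  by apply: addr_ge0; do ?[exact: mulr_ge0|exact: addr_ge0|apply: mulr_ge0].
have B0 : 0 <= B.
  rewrite /B; apply: addr_ge0; last by do ?[exact: mulr_ge0|apply: mulr_ge0].
  apply: addr_ge0; first by apply: mulr_ge0 => //; exact: sqr_ge0.
  by do ?[exact: mulr_ge0|exact: addr_ge0|apply: mulr_ge0].
(* This is the coefficient with which [- <xi, y - z>] appears in the derivative of [L1]; giving [L3]
   the same weight turns [y - z] into [x - z]. *)
pose w s := s^-1 - alpha * beta * (s^-1 * s^-1).
pose L1 s := s^-1 * ip (g s) (y s - z).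
pose L2 s := 2^-1 * ip (s^-1 *: (y s - z)) (s^-1 *: (y s - z)).
pose L3 s := w s * (2^-1 * ip (y s - x s) (y s - x s)).
pose L4 s := - A * M s + B * s^-1.
(* In [L1'] the terms [<g, y - z> / t^2] have total coefficient [- (1 + alpha)], whence the factor
   of [L2]. The derivative of [L4] cancels the errors in [m] and in [1 / t^2]. *)
exists (fun s => L1 s + (1 + alpha) * L2 s + beta^-1 * L3 s + D * V s + L4 s).
exists (G * P + D * (G * Mb) + A * Mb); split.
- move=> a b ta ab; have a0 := lt_trans t00 ta.
  have aci := ac_inv b a0.
  have acp : abs_cont_on a b (fun s => y s - z) by apply: acB; [exact: acy|exact: ac_cst].
  have acq : abs_cont_on a b (fun s => y s - x s) by apply: acB; [exact: acy|exact: acx].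
  have acw : abs_cont_on a b w.
    by apply: acB => //; apply: acM; [exact: ac_cst|exact: acM].
  have ac1 : abs_cont_on a b L1.
    by apply: acM => //; apply: (ac_ip hip) => //; exact: acg.
  have ac2 : abs_cont_on a b L2.
    by apply: acM; [exact: ac_cst|apply: (ac_ip hip); exact: ac_scale].
  have ac3 : abs_cont_on a b L3.
    by apply: acM => //; apply: acM; [exact: ac_cst|exact: (ac_ip hip)].
  have ac4 : abs_cont_on a b L4.
    by apply: acD; apply: acM => //; exact: ac_cst.
  apply: acD => //; apply: acD; last by apply: acM; [exact: ac_cst|exact: V_ac].
  apply: acD; last by apply: acM => //; exact: ac_cst.
  by apply: acD => //; apply: acM => //; exact: ac_cst.
- move=> t tt; have tt0 := lt_le_trans t01 tt; have tp := lt_trans t00 tt0.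
  have [_ hp _] := HP t tt; have gG := g_le_G tt.
  have i0 : 0 < t^-1 by rewrite invr_gt0.
  have w0 : 0 <= w t.
    rewrite /w; have -> : t^-1 - alpha * beta * (t^-1 * t^-1) =
      t^-1 * t^-1 * (t - alpha * beta) by field; rewrite gt_eqF.
    by rewrite mulr_ge0 ?subr_ge0 ?t1_ab// ltW// mulr_gt0.
  have h1 : - (G * P) <= L1 t.
    have : `|L1 t| <= G * P.
      rewrite /L1 normrM gtr0_norm// ler_pdivrMl//.
      apply: (le_trans (ip_norm hip _ _)).
      have -> : t * (G * P) = G * (P * t) by ring.
      exact: ler_pM.
    by rewrite ler_norml => /andP[].
  have h2 : 0 <= (1 + alpha) * L2 t.
    rewrite /L2 (ipxx hip); apply: mulr_ge0; first exact: addr_ge0.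
    by apply: mulr_ge0; [rewrite invr_ge0|exact: exprn_ge0].
  have h3 : 0 <= beta^-1 * L3 t.
    have s0 : 0 <= 2^-1 * ip (y t - x t) (y t - x t).
      by rewrite (ipxx hip); apply: mulr_ge0; [rewrite invr_ge0|exact: exprn_ge0].
    by apply: mulr_ge0 (mulr_ge0 w0 s0); rewrite invr_ge0.
  have h4 := ler_wpM2l D0 (V_ge tt).
  have h5 : - (A * Mb) <= L4 t.
    have /andP[_ q] := M_bd (ltW tt0).
    have := ler_wpM2l A0 q; have := mulr_ge0 B0 (ltW i0); rewrite /L4 mulNr; lra.
  by move: h1 h2 h3 h4 h5 => /=; rewrite mulrN; lra.
apply: ae_imp hae => t Ht tt.
have tt0 := lt_trans t01 tt; have [rt DM] := Ht tt0.
have tp := reg_gt0 rt; have t_ge1 := le_trans t1_ge1 (ltW tt).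
have [hx hp hq] := HP t (ltW tt); have gG := g_le_G (ltW tt).
have [i iE] : exists i, t^-1 = i by eexists.
have Di := is_derive_inv tp.
have i0 : 0 < i by rewrite -iE invr_gt0.
have i1 : i <= 1 by rewrite -iE invf_le1.
have ti : t * i = 1 by rewrite -iE mulfV// gt_eqF.
pose es := e t + beta *: de t.
pose r := beta *: e t + (alpha * beta / t ^+ 2) *: x t.
have Dy : is_derive t 1 y (g t + r) by rewrite addrA; exact: (reg_y rt).
have Dg : is_derive t 1 g (- (alpha * t^-1 *: v t) - xi t - es).
  by rewrite /es opprD addrA; exact: g_derive.
have Dp : is_derive t 1 (fun s => y s - z) (g t + r).
  by have := is_deriveB Dy (is_derive_cst z t 1); rewrite subr0.
have Dq : is_derive t 1 (fun s => y s - x s) (beta *: xi t + r).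
  have := is_deriveB Dy (reg_x rt).
  suff -> : g t + r - v t = beta *: xi t + r by [].
  by rewrite opprB addrC addrA subrK addrC.
have Dw : is_derive t 1 w (- (t^-1 * t^-1) + alpha * beta * (2 * (t^-1 * (t^-1 * t^-1)))).
  have := is_deriveB Di (is_deriveZ (alpha * beta) (is_deriveM Di Di)).
  set d := (X in is_derive _ _ _ X -> _).
  suff -> : d = - (t^-1 * t^-1) + alpha * beta * (2 * (t^-1 * (t^-1 * t^-1))) by [].
  by rewrite /d /GRing.scale /=; ring.
have D1 : is_derive t 1 L1 (t^-1 * (ip (g t) (g t + r)
    + ip (- (alpha * t^-1 *: v t) - xi t - es) (y t - z))
    + ip (g t) (y t - z) * - (t^-1 * t^-1)).
  exact: (is_deriveM Di (is_derive_ip hip Dg Dp)).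
have D2 := is_derive_half_normsq (is_derive_scale Di Dp).
have D2' : is_derive t 1 (fun s => (1 + alpha) * L2 s) ((1 + alpha) *
    ip (t^-1 *: (y t - z)) (t^-1 *: (g t + r) + - (t^-1 * t^-1) *: (y t - z))).
  exact: (is_deriveZ (1 + alpha) D2).
have D3 : is_derive t 1 (fun s => beta^-1 * L3 s) (beta^-1 *
    (w t * ip (y t - x t) (beta *: xi t + r) +
     2^-1 * ip (y t - x t) (y t - x t) *
     (- (t^-1 * t^-1) + alpha * beta * (2 * (t^-1 * (t^-1 * t^-1)))))).
  exact: (is_deriveZ beta^-1 (is_deriveM Dw (is_derive_half_normsq Dq))).
have D4 : is_derive t 1 L4 (- A * m t + B * - (t^-1 * t^-1)).
  exact: (is_deriveD (is_deriveZ (- A) DM) (is_deriveZ B Di)).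
pose U := [set s : R | t0 < s].
have S := slope_leD (slope_leD (slope_leD (slope_leD (slope_le_derive U D1)
  (slope_le_derive U D2')) (slope_le_derive U D3))
  (slope_leZ D0 (V_slope rt DM (ltW tt)))) (slope_le_derive U D4).
apply: slope_le_weaken S => //.
have abi : 4 * alpha * beta * i <= 1.
  by have := ler_wpM2r (ltW i0) (le_trans t1ab (ltW tt)); rewrite ti.
have mm0 : 0 <= m t by apply: addr_ge0 => //; exact: mulr_ge0.
have pP : i * `|y t - z| <= P by rewrite -iE mulrC ler_pdivrMr.
have qP : i * `|y t - x t| <= P by rewrite -iE mulrC ler_pdivrMr.
have xP : i * `|x t| <= P by rewrite -iE mulrC ler_pdivrMr.
have esm : `|es| <= m t.
  by apply: (le_trans (ler_normD _ _)); rewrite normrZ gtr0_norm.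
have rB : `|r| <= beta * m t + alpha * beta * P * i.
  apply: (le_trans (ler_normD _ _)); apply: lerD.
    rewrite normrZ gtr0_norm// ler_pM2l// lerDl; exact: mulr_ge0.
  have -> : alpha * beta / t ^+ 2 = alpha * beta * i * i.
    by rewrite -iE; field; rewrite gt_eqF.
  rewrite normrZ gtr0_norm ?mulr_gt0//.
  have -> : alpha * beta * i * i * `|x t| = alpha * beta * i * (i * `|x t|) by ring.
  have -> : alpha * beta * P * i = alpha * beta * i * P by ring.
  by rewrite ler_pM2l ?mulr_gt0.
have est := lyapunov_estimate (xi t) i0 i1 abi P0 mm0 pP qP gG esm rB.
have sx := sub t rt.
have pq : y t - z - (y t - x t) = x t - z by rewrite opprB addrC subrKA.
rewrite pq in est.
have w0 : 0 <= i - alpha * beta * (i * i).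
  have -> : i - alpha * beta * (i * i) = i * (1 - alpha * beta * i) by ring.
  have : 0 < alpha * beta * i by rewrite !mulr_gt0.
  by move=> h; apply: mulr_ge0; [exact: ltW|move: abi h; lra].
have wi : i - alpha * beta * (i * i) <= i.
  by rewrite lerBlDr lerDl ltW// !mulr_gt0.
have sx2 := ler_wpM2l w0 sx.
have at2 : alpha / (2 * t) = alpha * i / 2 by rewrite -iE; field; rewrite gt_eqF.
have gg : ip (g t) (g t) <= 2 * ip (v t) (v t) + 2 * beta ^+ 2 * ip (xi t) (xi t).
  have : 0 <= ip (v t - beta *: xi t) (v t - beta *: xi t) by rewrite (ipxx hip) exprn_ge0.
  rewrite /=; move: (g t) (xi t) => g1 Xi; rewrite !(ipE hip) (ipC hip Xi g1); lra.
have gg0 : 0 <= ip (g t) (g t) by rewrite (ipxx hip) exprn_ge0.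
have vv0 : 0 <= ip (v t) (v t) by rewrite (ipxx hip) exprn_ge0.
have xx0 : 0 <= ip (xi t) (xi t) by rewrite (ipxx hip) exprn_ge0.
rewrite /w -/es iE at2 -/A -/B in est *.
move: est sx2 gg gg0 vv0 xx0.
move: (ip (v t) (v t)) (ip (xi t) (xi t)) (ip (g t) (g t)) => vv xx gg_ est sx2 gg gg0 vv0 xx0.
have absorb : i * gg_ + (i - alpha * beta * (i * i)) * (2^-1 * gg_) +
    D * (- (alpha * i / 2) * vv - beta / 2 * xx) <= 0.
  have h1 : (i - alpha * beta * (i * i)) * (2^-1 * gg_) <= i * (2^-1 * gg_).
    by apply: ler_wpM2r => //; rewrite mulr_ge0 ?invr_ge0.
  have h2 : i * gg_ <= i * (2 * vv + 2 * beta ^+ 2 * xx) by rewrite ler_pM2l.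
  have h3 : D * (- (alpha * i / 2) * vv - beta / 2 * xx) =
     - (4 * i * vv) - 4 * (alpha * beta) * (i * vv) - 4 * (beta / alpha) * xx - 4 * beta ^+ 2 * xx.
    by rewrite /D; field; rewrite gt_eqF.
  have h4 : i * (beta ^+ 2 * xx) <= beta ^+ 2 * xx.
    by apply: ler_piMl => //; apply: mulr_ge0 => //; exact: sqr_ge0.
  have h5 : 0 <= alpha * beta * (i * vv).
    exact: mulr_ge0 (mulr_ge0 ge_a ge_b) (mulr_ge0 (ltW i0) vv0).
  have h6 : 0 <= beta / alpha * xx by apply: mulr_ge0 => //; exact: divr_ge0.
  have h7 : 0 <= i * vv by apply: mulr_ge0 => //; exact: ltW.
  have h8 : 0 <= i * gg_ by apply: mulr_ge0 => //; exact: ltW.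
  have h9 : 0 <= beta ^+ 2 * xx by apply: mulr_ge0 => //; exact: sqr_ge0.
  by rewrite h3; lra.
apply: (le_trans (lerD (lerD est (lexx _)) (lexx _))).
by move: absorb sx2; lra.
Qed.

End Energy.

(** * Projection onto closed convex sets and weak limits *)

Section Projection.
Context {R : realType} {H : completeNormedModType R}.
Variable ip : H -> H -> R.
Hypothesis hip : is_inner_product ip.

(** A minimizing sequence for the distance is Cauchy by the parallelogram identity; the variational
    inequality is first-order optimality along segments of [C]. *)
Lemma closed_convex_projection (C : set H) (x : H) : C !=set0 -> closed C ->
  (forall (u v : H) (l : R), 0 <= l <= 1 -> C u -> C v -> C (l *: u + (1 - l) *: v)) ->
  exists2 p, C p & forall c, C c -> ip (x - p) (c - p) <= 0.
Proof.
move=> [c0 Cc0] clC cvC.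
pose S := [set `|x - c| ^+ 2 | c in C].
have hS : has_inf S.
  by split; [exists (`|x - c0| ^+ 2), c0|exists 0 => _ [c _ <-]; exact: exprn_ge0].
pose d := inf S.
have dle c : C c -> d <= `|x - c| ^+ 2.
  by move=> Cc; apply: ge_inf; [case: hS|exists c].
have near_d n : exists c, C c /\ `|x - c| ^+ 2 < d + n.+1%:R^-1.
  have n0 : 0 < n.+1%:R^-1 :> R by rewrite invr_gt0.
  by have [_ [c Cc <-] h] := inf_adherent n0 hS; exists c.
pose c n := projT1 (cid (near_d n)).
have Cc n : C (c n) by rewrite /c; case: cid => ? [].
have cd n : `|x - c n| ^+ 2 < d + n.+1%:R^-1 by rewrite /c; case: cid => ? [].
have par n m : `|c n - c m| ^+ 2 <= 2 * n.+1%:R^-1 + 2 * m.+1%:R^-1.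
  (* The midpoint is at squared distance at least [d], while both ends are barely farther than
     that. *)
  have hmid : C (2^-1 *: c n + (1 - 2^-1) *: c m) by apply: cvC => //; lra.
  have := dle _ hmid; have := cd n; have := cd m; rewrite -!(ipxx hip).
  move: (n.+1%:R^-1) (m.+1%:R^-1) (c n) (c m) => a b u v; rewrite !(ipE hip).
  by rewrite (ipC hip u x) (ipC hip v x) (ipC hip v u); lra.
have cvgc : cvg (c @ \oo).
  apply/cauchy_cvgP/cauchy_ballP => eps eps0.
  have e0 : 0 < eps ^+ 2 / 4 by rewrite divr_gt0// exprn_gt0.
  have [N _ HN] := @near_infty_natSinv_lt R (PosNum e0).
  near_simpl; near=> a; rewrite -ball_normE /= -(@ltr_pXn2r _ 2) ?nnegrE ?(ltW eps0)//.
  apply: le_lt_trans (par _ _) _.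
  have a1 : (N <= a.1)%N by near: a; exists ([set n | (N <= n)%N], setT) => //=; [split; [exists N|exact: filterT]|move=> [? ?] []].
  have a2 : (N <= a.2)%N by near: a; exists (setT, [set n | (N <= n)%N]) => //=; [split; [exact: filterT|exists N]|move=> [? ?] []].
  have q1 : a.1.+1%:R^-1 < eps ^+ 2 / 4 := HN _ a1.
  have q2 : a.2.+1%:R^-1 < eps ^+ 2 / 4 := HN _ a2.
  by move: q1 q2; move: (a.1.+1%:R^-1) (a.2.+1%:R^-1) => r1 r2; lra.
pose p := lim (c @ \oo).
have Cp : C p.
  by apply: (closed_cvg C) cvgc => //; exact: nearW.
have pd : `|x - p| ^+ 2 <= d.
  have c1 : `|x - c n| ^+ 2 @[n --> \oo] --> `|x - p| ^+ 2.
    apply: (@cvg_comp _ _ _ (fun n => `|x - c n|) (fun r : R => r ^+ 2) _ (nbhs (`|x - p|))).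
      by apply: cvg_norm; apply: cvgB cvgc; exact: cvg_cst.
    exact: exprn_continuous.
  apply/ler_addgt0Pr => eps eps0.
  apply: (cvgr_to_le c1).
  have [N _ HN] := @near_infty_natSinv_lt R (PosNum eps0).
  exists N => // n /= Nn; apply: ltW; apply: lt_trans (cd n) _.
  by rewrite ltrD2l; exact: HN.
exists p => // w Cw; rewrite leNgt; apply/negP => ip0.
have [q qE] : exists q, ip (x - p) (w - p) = q by eexists.
have [n nE] : exists n, ip (w - p) (w - p) = n by eexists.
rewrite qE in ip0.
have n0 : 0 <= n by rewrite -nE (ipxx hip) exprn_ge0.
(* A move of length [l] towards [w] changes the squared distance by [l (l n - 2 q)], negative
   because [l n < q]. *)
pose l := Num.min 1 (q / (n + 1)).
have n1 : 0 < n + 1 by rewrite ltr_wpDl.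
have l0 : 0 < l by rewrite lt_min ltr01 divr_gt0.
have l1 : l <= 1 by rewrite ge_min lexx.
have lq : l * (n + 1) <= q by rewrite -ler_pdivlMr// ge_min lexx orbT.
have Cl : C (l *: w + (1 - l) *: p) by apply: cvC => //; rewrite (ltW l0).
have := le_trans pd (dle _ Cl).
have -> : x - (l *: w + (1 - l) *: p) = (x - p) - l *: (w - p).
  by apply: (ip_ext hip) => z; rewrite !(ipE hip); ring.
rewrite -!(ipxx hip); move: qE nE; move: (x - p) (w - p) => a b qE nE.
rewrite !(ipE hip) (ipC hip b a) qE nE => h.
have : l * (2 * q - l * n) <= 0 by move: h; lra.
rewrite pmulr_rle0//; nra.
Unshelve. all: by end_near. Qed.

(** Sublevel sets are closed and convex, hence weakly closed: if [p] is the projection of [z], then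
    [<u n - p, z - p> <= 0] eventually, and the weak limit gives [|z - p|^2 <= 0]. *)
Lemma weak_limit_argmin (f : H -> \bar R) (u : nat -> H) (z : H) :
  lsc_fun f -> convex_fun f ->
  (forall a : R, (inf_fun f < a%:E)%E -> \forall n \near \oo, (f (u n) <= a%:E)%E) ->
  weak_cvg ip u z -> argmin f z.
Proof.
move=> lsc cvx hu wu w; rewrite leNgt; apply/negP => wz.
have [a wa az] : exists2 a : R, (f w < a%:E)%E & (a%:E < f z)%E.
  move: wz; case: (f w) => [r| |]; case: (f z) => [s| |] //=.
  - by rewrite lte_fin => rs; exists ((r + s) / 2); rewrite lte_fin; lra.
  - by move=> _; exists (r + 1); [rewrite lte_fin; lra|rewrite ltry].
  - by move=> _; exists (s - 1); [rewrite ltNyr|rewrite lte_fin; lra].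
  - by move=> _; exists 0; [rewrite ltNyr|rewrite ltry].
have infa : (inf_fun f < a%:E)%E.
  by apply: le_lt_trans wa; apply: ereal_inf_lbound; exists w.
pose C := [set c | (f c <= a%:E)%E].
have clC : closed C.
  rewrite -[C]setCK; apply: open_closedC; rewrite openE => c /=.
  rewrite /C /= => /negP; rewrite -ltNge => /lsc; apply: filterS => c' /=.
  by rewrite ltNge => /negP.
have ne : C !=set0 by exists w; exact: ltW.
have cvC (u0 v0 : H) (l : R) : 0 <= l <= 1 -> C u0 -> C v0 ->
    C (l *: u0 + (1 - l) *: v0).
  move=> l01 Cc1 Cc2; apply: (le_trans (cvx _ _ _ l01)).
  have /andP[l0 l1] := l01.
  have -> : a%:E = (l%:E * a%:E + (1 - l)%:E * a%:E)%E.
    by rewrite -!EFinM -EFinD; congr (_%:E); ring.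
  by apply: leeD; apply: lee_wpmul2l; rewrite ?lee_fin// subr_ge0.
have [p Cp Hp] := closed_convex_projection z ne clC cvC.
have zp : ip (z - p) (z - p) <= 0.
  have c1 : ip (u n - p) (z - p) @[n --> \oo] --> ip (z - p) (z - p).
    have -> : (fun n => ip (u n - p) (z - p)) = (fun n => ip (u n) (z - p) - ip p (z - p)).
      by apply/funext => n; rewrite (ipBl hip).
    rewrite [ip (z - p) (z - p)](ipBl hip).
    by apply: cvgB; [exact: wu|exact: cvg_cst].
  apply: (cvgr_to_le c1); apply: filterS (hu a infa) => n Cn.
  by rewrite (ipC hip); exact: Hp.
have zp0 : z = p.
  apply/eqP; rewrite -subr_eq0 -normr_eq0 -sqrf_eq0 -(ipxx hip) eq_le zp /=.
  by rewrite (ipxx hip) exprn_ge0.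
by move: az; rewrite zp0 ltNge => /negP; apply.
Qed.

End Projection.

(** * Vanishing tails, decay of the energy, difference quotients *)

Section Asymptotics.
Context {R : realType}.
Local Notation cmu := (@completed_lebesgue_measure R).
Local Notation CT := (caratheodory_type (wlength (@idfun R))^*%mu).

Lemma ac_ln (a b : R) : 0 < a -> abs_cont_on a b (@ln R).
Proof.
move=> a0; apply: (ac_lip (C := a^-1)) => s t h1 h2 h3.
have s0 := lt_le_trans a0 h1; have t0 := lt_le_trans s0 h2.
rewrite ger0_norm; last by rewrite subr_ge0 ler_ln.
rewrite -ln_div ?posrE//.
have -> : t / s = 1 + (t - s) / s by field; rewrite gt_eqF.
have ts : 0 <= (t - s) / s by rewrite divr_ge0 ?subr_ge0// ltW.
apply: (le_trans (le_ln1Dx (lt_le_trans (ltrN10 _) ts))).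
by rewrite mulrC ler_wpM2r ?subr_ge0// lef_pV2.
Qed.

(** If every tail exceeded [eps], the primitive [F] would rise by at most the full integral minus
    [eps], and the integral would be smaller than itself. *)
Lemma tail_small (a : R) (h : R -> R) : (forall t, a <= t -> 0 <= h t) ->
  cmu.-integrable [set t | a <= t] (fun t => (h t)%:E) ->
  forall eps, 0 < eps -> exists2 T, a <= T & forall t, T <= t ->
    (\int[cmu]_(s in [set s | (t <= s)%R]) (h s)%:E <= eps%:E)%E.
Proof.
move=> h0 ih eps eps0.
have mD := completed_measurable_half_line a.
have mh : @measurable_fun _ _ CT R [set t | a <= t] h.
  by apply/measurable_EFinP; case/integrableP: ih.
have [F [c [acF DF Ec]]] := primitive_half_line ih.
have sub : `]a, +oo[%classic `<=` [set t | a <= t].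
  by move=> t /=; rewrite in_itv/= andbT => /ltW.
have mh' : @measurable_fun _ _ CT R `]a, +oo[ h.
  exact: (measurable_funS mD sub mh).
have mono s t : a <= s -> s <= t -> F s <= F t.
  move=> as_ st; rewrite -lerN2; apply: (ac_nonincreasing st (acN (acF s t))).
  apply: ae_imp DF => r Hr /andP[sr rt].
  have ar : a < r := le_lt_trans as_ sr.
  apply: (slope_le_weaken (D := setT) (d := - h r)) => //.
    by rewrite oppr_le0 h0// ltW.
  by apply: slope_le_derive; apply: is_deriveN; exact: Hr.
apply: contrapT => nT.
have tail t : a <= t -> eps < c - F t.
  move=> at_; rewrite ltNge; apply/negP => ct; apply: nT; exists t => // s ts.
  rewrite Ec ?(le_trans at_ ts)// lee_fin; have := mono t s at_ ts; lra.
(* Half the supposed range of [F]: centring [F] makes the two-sided bound [K], so that [2 * K] is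
   the whole range. *)
pose K := (c - F a - eps) / 2.
have Fb t : a <= t -> `|F a + K - F t| <= K.
  move=> at_; have := tail t at_; have := mono a t (lexx a) at_.
  by rewrite ler_norml /K; lra.
have acG b : a <= b -> abs_cont_on a b (fun t => F a + K - F t).
  by move=> ab; apply: acB => //; exact: ac_cst.
have := integral_right_bound acG Fb mh' (fun t at_ => h0 t (ltW at_)).
rewrite -integral_closed_open// Ec// => hh.
have {hh} : ((c - F a)%:E <= (2 * K)%:E)%E.
  apply: hh; apply: ae_imp DF => t Ht at_.
  apply: slope_le_derive; rewrite -[- h t]add0r.
  by apply: is_deriveB; exact: Ht.
by rewrite lee_fin /K; lra.
Qed.

(** If [E] stayed above [cz + d], [Lam] would decrease at least like [(d / 2) ln t], against its
    lower bound; so [E] is small at some arbitrarily late time. It stays small because [E - G M]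
    does not increase and [M] is by then close to its supremum. *)
Lemma energy_vanishes (t1 ab G Mb : R) (E M : R -> R) :
  0 < t1 -> 0 <= ab -> 4 * ab <= t1 -> 0 <= G ->
  (forall s t, t1 <= s -> s <= t -> M s <= M t) ->
  (forall t, t1 <= t -> 0 <= M t <= Mb) ->
  (forall s t, t1 <= s -> s <= t -> E t + - G * M t <= E s + - G * M s) ->
  (forall eps, 0 < eps -> exists2 cz, cz < eps & exists (Lam : R -> R) (K : R),
    [/\ forall a b, t1 <= a -> a <= b -> abs_cont_on a b Lam,
        forall t, t1 <= t -> - K <= Lam t &
        {ae cmu, forall t : R, t1 < t -> slope_le [set s | t1 <= s] Lam t
          (- (t^-1 - ab * (t^-1 * t^-1)) * (E t - cz))}]) ->
  forall eps, 0 < eps -> exists2 T, t1 <= T & forall t, T <= t -> E t <= eps.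
Proof.
move=> t10 ab0 abt G0 monoM bdM monoV hL eps eps0.
(* The budget: one [d] for [cz], one for [E s - cz], one for the later variation of [G * M]. *)
have [d dE] : exists d : R, eps = 4 * d by exists (eps / 4); field.
have d0 : 0 < d by move: eps0; rewrite dE; lra.
have [cz czd [Lam [K [acL geL slL]]]] := hL d d0.
have low T : t1 <= T -> exists2 s, T <= s & E s < cz + d.
  move=> tT; apply: contrapT => nS.
  have Ege s : T <= s -> d <= E s - cz.
    move=> Ts; rewrite leNgt; apply/negP => h; apply: nS; exists s => //; lra.
  have Tp := lt_le_trans t10 tT.
  have dec t : T <= t -> Lam t + d / 2 * ln t <= Lam T + d / 2 * ln T.
    move=> Tt.
    have ac1 : abs_cont_on T t (fun s => Lam s + d / 2 * ln s).
      by apply: acD; [exact: acL|apply: acM; [exact: ac_cst|exact: ac_ln]].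
    apply: (ac_nonincreasing Tt ac1); apply: ae_imp slL => s Hs /andP[Ts st].
    have sp := lt_trans Tp Ts.
    have Dln : is_derive s 1 (fun s => d / 2 * ln s) (d / 2 * s^-1).
      exact: (is_deriveZ (d / 2) (is_derive1_ln sp)).
    have := slope_leD (Hs (le_lt_trans tT Ts)) (slope_le_derive [set s | t1 <= s] Dln).
    apply: slope_le_weaken; first by move=> r /= /andP[q1 _]; exact: le_trans tT q1.
    have i0 : 0 < s^-1 by rewrite invr_gt0.
    have w : 2^-1 * s^-1 <= s^-1 - ab * (s^-1 * s^-1).
      have h : ab * s^-1 <= 4^-1.
        by rewrite ler_pdivrMr//; have := ltW (le_lt_trans tT Ts); lra.
      by have := ler_wpM2r (ltW i0) h; lra.
    have e1 := Ege s (ltW Ts).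
    have w00 : 0 <= 2^-1 * s^-1 by apply: mulr_ge0; [rewrite invr_ge0|exact: ltW].
    by have := ler_pM w00 (ltW d0) w e1; lra.
  pose Q := Lam T + d / 2 * ln T + K + 1.
  (* Late enough for [(d / 2) ln t] to exceed by 1 what the bounds on [Lam] allow. *)
  pose t := Num.max T (expR (2 / d * Q)).
  have Tt : T <= t by rewrite le_max lexx.
  have tp : 0 < t := lt_le_trans Tp Tt.
  have lnt : 2 / d * Q <= ln t.
    by rewrite -[leLHS]expRK ler_ln ?posrE ?expR_gt0// le_max lexx orbT.
  have := dec t Tt; have := geL t (le_trans tT Tt).
  have : Q <= d / 2 * ln t.
    have d2 : 0 <= d / 2 by rewrite divr_ge0// ltW.
    have := ler_wpM2l d2 lnt.
    suff -> : d / 2 * (2 / d * Q) = Q by [].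
    by field; rewrite gt_eqF.
  by rewrite /Q; lra.
pose S := [set M t | t in [set t | t1 <= t]].
have hS : has_sup S.
  by split; [exists (M t1), t1 => //=|exists Mb => _ [t /= tt <-]; case/andP: (bdM t tt)].
have G1 : 0 < d / (G + 1) by rewrite divr_gt0// ltr_wpDl.
have [_ [T /= tT <-] hT] := sup_adherent G1 hS.
have [s Ts Es] := low T tT.
exists s; first exact: le_trans tT Ts.
move=> t st; have ts := le_trans tT Ts.
have Mt : M t <= sup S by apply: ub_le_sup; [case: hS|exists t => //=; exact: le_trans ts st].
have Ms := monoM T s tT Ts; have := monoV s t ts st.
have h1 : G * (M t - M s) <= G * (d / (G + 1)).
  by apply: ler_wpM2l => //; lra.
have h2 : G * (d / (G + 1)) <= d.
  rewrite mulrCA -[leRHS]mulr1; apply: ler_wpM2l; first exact: ltW.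
  by rewrite ler_pdivrMr ?mul1r ?lerDl// ltr_wpDl.
have h3 : G * (M t - M s) <= d := le_trans h1 h2.
by rewrite dE; move: Es czd h3; lra.
Qed.

Section Quotients.
Context {V : normedModType R}.

(** Continuous in [t] wherever [u] is, so that a.e. derivatives appear as a.e. limits of a sequence
    of continuous functions. *)
Definition diff_quotient (u : R -> V) (n : nat) (t : R) : V :=
  n.+1%:R *: (u (t + n.+1%:R^-1) - u t).

Lemma diff_quotient_cvg (u : R -> V) (t : R) (du : V) : is_derive t 1 u du ->
  diff_quotient u n t @[n --> \oo] --> du.
Proof.
move=> /is_derive_epsP Du; apply/cvgrPdist_le => eps eps0.
have [d d0 Hd] := Du _ eps0.
have [N _ HN] := @near_infty_natSinv_lt R (PosNum d0).
exists N => // n /= Nn; have n0 : 0 < n.+1%:R^-1 :> R by rewrite invr_gt0.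
have Ek : t + n.+1%:R^-1 - t = n.+1%:R^-1 by rewrite addrC addKr.
have := Hd (t + n.+1%:R^-1); rewrite Ek gtr0_norm// => /(_ (HN n Nn)) h.
rewrite distrC /diff_quotient.
have -> : n.+1%:R *: (u (t + n.+1%:R^-1) - u t) - du =
    n.+1%:R *: (u (t + n.+1%:R^-1) - u t - n.+1%:R^-1 *: du).
  by rewrite [in RHS]scalerBr scalerA mulfV// scale1r.
by rewrite normrZ gtr0_norm// -ler_pdivlMl// mulrC.
Qed.

Lemma diff_quotient_continuous (a : R) (u : R -> V) n t :
  (forall s, a < s -> {for s, continuous u}) -> a < t ->
  {for t, continuous (diff_quotient u n)}.
Proof.
move=> cu at_; apply: cvgZr; apply: cvgB; last exact: cu.
have at' : a < t + n.+1%:R^-1 by rewrite (lt_trans at_)// ltrDl invr_gt0.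
apply: (@cvg_comp _ _ _ (fun s => s + n.+1%:R^-1) u _ (nbhs (t + n.+1%:R^-1))).
  by apply: cvgD; [exact: cvg_id|exact: cvg_cst].
exact: cu.
Qed.

End Quotients.

End Asymptotics.

(** * Measurability, integrability, limits and rates for the trajectory *)

Section Main.
Context {R : realType} {H : completeNormedModType R}.
Variables (ip : H -> H -> R) (alpha beta t0 : R) (f : H -> \bar R)
  (e de x y xi : R -> H).
Local Notation cmu := (@completed_lebesgue_measure R).
Local Notation CT := (caratheodory_type (wlength (@idfun R))^*%mu).
Hypotheses (hip : is_inner_product ip) (alpha0 : 0 < alpha) (beta0 : 0 < beta)
  (t00 : 0 < t0) (fprop : proper_fun f) (hlsc : lsc_fun f) (hcvx : convex_fun f)
  (hinf : (-oo < inf_fun f)%E).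
Hypotheses (ace : forall T, t0 < T -> abs_cont_on t0 T e)
  (aede : {ae cmu, forall t : R, t0 < t -> is_derive t 1 e (de t)})
  (ie : cmu.-integrable [set t | t0 <= t] (fun t => (`|e t|)%:E))
  (ide : cmu.-integrable [set t | t0 <= t] (fun t => (`|de t|)%:E)).
Hypotheses (fx0 : f (x t0) \is a fin_num)
  (cx : {within [set t | t0 <= t], continuous x})
  (cy : {within [set t | t0 <= t], continuous y})
  (acxy : forall a b, t0 < a -> a <= b -> abs_cont_on a b x /\ abs_cont_on a b y)
  (aesol : {ae cmu, forall t : R, t0 < t ->
     [/\ derivable x t 1, derivable y t 1, subdiff ip f (x t) (xi t),
         derive1 x t + beta *: xi t + beta *: e t - (beta^-1 - alpha / t) *: x t
           + beta^-1 *: y t = 0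
       & derive1 y t - (beta^-1 - alpha / t + alpha * beta / t ^+ 2) *: x t
           + beta^-1 *: y t = 0]}).
Local Notation g := (udot alpha beta e x y).
Local Notation reg := (regular ip alpha beta t0 f e de x y xi).
Local Notation m := (fun t => `|e t| + beta * `|de t|).
Local Notation v := (fun t => g t - beta *: xi t).
Local Notation finf := (fine (inf_fun f)).
Local Notation phi := (fun t => fine (f (x t)) - finf).
Local Notation E := (fun t => 2^-1 * ip (g t) (g t) + phi t).

Lemma f_notNy z : f z != -oo%E. Proof. by case: fprop. Qed.

Lemma inf_fun_le z : (inf_fun f <= f z)%E.
Proof. by apply: ereal_inf_lbound; exists z. Qed.

Lemma inf_fun_fin : inf_fun f \is a fin_num.
Proof.
rewrite fin_numElt hinf /= (le_lt_trans (inf_fun_le (x t0)))//.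
by rewrite -(fineK fx0) ltry.
Qed.

Lemma x_ac a b : t0 < a -> a <= b -> abs_cont_on a b x.
Proof. by move=> ta ab; case: (acxy ta ab). Qed.

Lemma y_ac a b : t0 < a -> a <= b -> abs_cont_on a b y.
Proof. by move=> ta ab; case: (acxy ta ab). Qed.

Lemma fxt_fin t : t0 < t -> f (x t) \is a fin_num.
Proof.
exact: (fx_fin hip alpha0 beta0 t00 ace aede ie ide cx cy acxy aesol f_notNy hlsc).
Qed.

Lemma phi_nonneg t : t0 < t -> 0 <= phi t.
Proof.
move=> tt; rewrite subr_ge0 -lee_fin (fineK inf_fun_fin) (fineK (fxt_fin tt)).
exact: inf_fun_le.
Qed.

Lemma phi_ac a b : t0 < a -> a <= b -> abs_cont_on a b phi.
Proof.
move=> ta ab; apply: acB; last exact: ac_cst.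
exact: (fx_ac hip alpha0 beta0 t00 ace aede ie ide cx cy acxy aesol f_notNy hlsc ta ab).
Qed.

Lemma phi_slope_le t : reg t -> slope_le [set s | t0 < s] phi t (ip (xi t) (v t)).
Proof.
move=> rt.
have := slope_leD
  (fx_slope hip alpha0 beta0 t00 ace aede ie ide cx cy acxy aesol f_notNy hlsc rt)
  (slope_le_derive [set s | t0 < s] (is_derive_cst (- finf) t 1)).
by rewrite addr0.
Qed.

Lemma phi_subgradient z : f z \is a fin_num -> forall t, reg t ->
  phi t - (fine (f z) - finf) <= ip (xi t) (x t - z).
Proof.
move=> fz t rt; have [ft sub] := reg_sub rt.
have : fine (f (x t)) + ip (xi t) (z - x t) <= fine (f z).
  by rewrite -lee_fin (fineK fz).
by rewrite !(ipBr hip); lra.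
Qed.

Lemma g_ac a b : t0 < a -> a <= b -> abs_cont_on a b g.
Proof. exact: (ac_g alpha beta t00 ace acxy). Qed.

Lemma ac_continuous (V : normedModType R) (u : R -> V) :
  (forall a b, t0 < a -> a <= b -> abs_cont_on a b u) ->
  forall t, t0 < t -> {for t, continuous u}.
Proof.
move=> acu t tt; pose a := (t0 + t) / 2.
have ta : t0 < a by rewrite /a; lra.
have at_ : a < t by rewrite /a; lra.
have ab : a <= t + 1 by lra.
apply/cvgrPdist_lt => eps eps0.
have tI : a <= t <= t + 1 by lra.
have [d d0 Hd] := ac_cont (acu a (t + 1) ta ab) tI eps0.
apply/nbhs_normP; exists (Num.min d (Num.min 1 (t - a))) => /=.
  by rewrite !lt_min d0 ltr01 subr_gt0.
move=> s /=; rewrite !lt_min => /and3P[h1 h2 h3]; rewrite distrC; apply: Hd.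
  by move: h2 h3; rewrite !ltr_norml; lra.
by rewrite distrC.
Qed.

Lemma e_ac a b : t0 < a -> a <= b -> abs_cont_on a b e.
Proof. by move=> ta ab; apply: (ac_e ace); exact: ltW. Qed.

Lemma continuous_inv (t : R) : t0 < t -> {for t, continuous (fun s : R => s^-1)}.
Proof.
by apply: ac_continuous => a b ta ab; apply: ac_inv; exact: lt_trans t00 ta.
Qed.

Lemma continuous_normsq (u : R -> H) t : {for t, continuous u} ->
  {for t, continuous (fun s => `|u s| ^+ 2)}.
Proof.
move=> cu; have -> : (fun s => `|u s| ^+ 2) = (fun s => ip (u s) (u s)).
  by apply/funext => s; rewrite (ipxx hip).
exact: (cvg_ip hip).
Qed.

Lemma ae_reg : {ae cmu, forall t : R, t0 < t -> reg t}.
Proof. exact: ae_regular hip aede aesol. Qed.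

Lemma measurable_dx : @measurable_fun _ _ CT R [set t | t0 <= t]
  (fun t => t^-1 * `|derive1 x t| ^+ 2).
Proof.
apply: (ae_lim_continuous_measurable
  (u := fun n t => t^-1 * `|diff_quotient x n t| ^+ 2)).
  move=> n t tt; apply: cvgM; first exact: continuous_inv.
  apply: continuous_normsq; apply: (diff_quotient_continuous _ tt).
  exact: ac_continuous x_ac.
apply: ae_imp ae_reg => t Ht tt; have rt := Ht tt.
apply: cvgM; first exact: cvg_cst.
under eq_fun do rewrite -(ipxx hip); rewrite -(ipxx hip) (reg_dx rt).
have c := diff_quotient_cvg (reg_x rt).
exact: (cvg_ip hip _ c c).
Qed.

(** At regular points [xi = (g - x') / beta], so the selection [xi] inherits measurability from
    [x']. *)
Lemma measurable_xi : @measurable_fun _ _ CT R [set t | t0 <= t]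
  (fun t => t^-1 * `|xi t| ^+ 2).
Proof.
apply: (ae_lim_continuous_measurable
  (u := fun n t => t^-1 * `|beta^-1 *: (g t - diff_quotient x n t)| ^+ 2)).
  move=> n t tt; apply: cvgM; first exact: continuous_inv.
  have cg : {for t, continuous g} := ac_continuous g_ac tt.
  have cq : {for t, continuous (diff_quotient x n)}.
    exact: (diff_quotient_continuous (a := t0) (ac_continuous x_ac) tt).
  apply: continuous_normsq; apply: cvgZr.
  exact: (cvgB cg cq).
apply: ae_imp ae_reg => t Ht tt; have rt := Ht tt.
apply: cvgM; first exact: cvg_cst.
have Exi : xi t = beta^-1 *: (g t - v t).
  by rewrite subKr scalerA mulVf ?scale1r// gt_eqF.
under eq_fun do rewrite -(ipxx hip); rewrite -(ipxx hip) Exi.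
have c : beta^-1 *: (g t - diff_quotient x n t) @[n --> \oo] --> beta^-1 *: (g t - v t).
  apply: cvgZr; apply: cvgB; first exact: cvg_cst.
  exact: diff_quotient_cvg (reg_x rt).
exact: (cvg_ip hip _ c c).
Qed.

Lemma measurable_work : @measurable_fun _ _ CT R [set t | t0 <= t]
  (fun t => ip (g t) (e t + beta *: de t)).
Proof.
apply: (ae_lim_continuous_measurable
  (u := fun n t => ip (g t) (e t + beta *: diff_quotient e n t))).
  move=> n t tt; have cg : {for t, continuous g} := ac_continuous g_ac tt.
  have ce : {for t, continuous e} := ac_continuous e_ac tt.
  have cq : {for t, continuous (diff_quotient e n)}.
    exact: (diff_quotient_continuous (a := t0) (ac_continuous e_ac) tt).
  have cz : {for t, continuous (fun s => beta *: diff_quotient e n s)}.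
    by apply: cvgZr; exact: cq.
  exact: (cvg_ip hip _ cg (cvgD ce cz)).
apply: ae_imp ae_reg => t Ht tt; have rt := Ht tt.
apply: (cvg_ip hip); first exact: cvg_cst.
apply: cvgD; first exact: cvg_cst.
by apply: cvgZr; exact: diff_quotient_cvg (reg_e rt).
Qed.

Lemma measurable_phi : @measurable_fun _ _ CT R [set t | t0 <= t]
  (fun t => t^-1 * phi t).
Proof.
apply: (ae_lim_continuous_measurable (u := fun n t => t^-1 * phi t)).
  move=> n t tt; apply: cvgM; first exact: continuous_inv.
  exact: (ac_continuous phi_ac tt).
by apply: ae_imp ae_reg => t Ht tt; exact: cvg_cst.
Qed.

Lemma perturbation_integrable (a : R) : t0 <= a ->
  cmu.-integrable [set t | a <= t] (fun t => (m t)%:E).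
Proof.
move=> ta; have mD := completed_measurable_half_line t0.
have h1 := integrableZl mD beta ide.
have h2 := integrableD mD ie h1.
apply: integrableS (h2) => //; first exact: completed_measurable_half_line.
by move=> t /=; exact: le_trans.
Qed.

Variables (M : R -> R) (Mb : R).
Hypotheses (M_ac : forall u v, abs_cont_on u v M)
  (M_derive : {ae cmu, forall t : R, t0 < t -> is_derive t 1 M (m t)})
  (M_mono : forall s t, t0 <= s -> s <= t -> M s <= M t)
  (M_bd : forall t, t0 <= t -> 0 <= M t <= Mb)
  (M_e : forall s t, t0 <= s -> s <= t -> beta * `|e t - e s| <= M t - M s).

Lemma ae_regM : {ae cmu, forall t : R, t0 < t -> reg t /\ is_derive t 1 M (m t)}.
Proof. by apply: ae_imp2 ae_reg M_derive => t h1 h2 tt; split; [exact: h1|exact: h2]. Qed.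

Variable t1 : R.
Hypotheses (t01 : t0 < t1) (t1ab : 4 * alpha * beta <= t1) (t1_ge1 : 1 <= t1).

Lemma energy_bounded : exists2 G : R, 1 <= G & forall t, t1 <= t -> 1 + E t <= G.
Proof.
exact: (E_bounded hip alpha0 beta0 t00 g_ac phi_ac M_ac M_bd phi_nonneg phi_slope_le
  ae_regM t01 t1ab).
Qed.

Variable G : R.
Hypotheses (G_ge1 : 1 <= G) (EG : forall t, t1 <= t -> 1 + E t <= G).
Local Notation V := (fun t => E t + - G * M t).

Lemma G_ge0 : 0 <= G. Proof. exact: le_trans ler01 G_ge1. Qed.

Lemma E_nonneg t : t0 < t -> 0 <= E t.
Proof. exact: (E_ge0 alpha beta e x y hip phi_nonneg). Qed.

Lemma g_le t : t1 <= t -> `|g t| <= G.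
Proof. exact: (g_le_G hip phi_nonneg t01 EG). Qed.

Lemma V_slope_le t : reg t -> is_derive t 1 M (m t) -> t1 <= t ->
  slope_le [set s | t0 < s] V t
    (- (alpha / (2 * t)) * ip (v t) (v t) - beta / 2 * ip (xi t) (xi t)).
Proof.
exact: (V_slope hip alpha0 beta0 t00 phi_nonneg phi_slope_le t01 t1ab EG).
Qed.

Lemma V_abs_cont a b : t0 < a -> a <= b -> abs_cont_on a b V.
Proof. exact: (V_ac hip g_ac phi_ac M_ac). Qed.

Lemma dissipation_ge0 t : t0 < t ->
  0 <= alpha / (2 * t) * ip (v t) (v t) + beta / 2 * ip (xi t) (xi t).
Proof.
move=> tt; have tp := lt_trans t00 tt; rewrite !(ipxx hip).
apply: addr_ge0; apply: mulr_ge0; try exact: exprn_ge0; apply: ltW.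
  by rewrite divr_gt0// mulr_gt0.
by rewrite divr_gt0.
Qed.

Lemma V_nonincreasing s t : t1 <= s -> s <= t -> V t <= V s.
Proof.
move=> ts st; have t0s := lt_le_trans t01 ts.
apply: (ac_nonincreasing st (V_abs_cont t0s st)).
apply: ae_imp ae_regM => r Hr /andP[sr rt].
have [rr DM] := Hr (lt_trans t0s sr).
apply: slope_le_weaken (V_slope_le rr DM (le_trans ts (ltW sr))).
  by move=> q /= /andP[h _]; exact: lt_le_trans t0s h.
by have := dissipation_ge0 (reg_gt rr) => /=; lra.
Qed.

Lemma lyapunov_ex z : f z \is a fin_num -> exists (Lam : R -> R) (K : R),
  [/\ forall a b, t1 <= a -> a <= b -> abs_cont_on a b Lam,
      forall t, t1 <= t -> - K <= Lam t &
      {ae cmu, forall t : R, t1 < t -> slope_le [set s | t1 <= s] Lam t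
        (- (t^-1 - alpha * beta * (t^-1 * t^-1)) * (E t - (fine (f z) - finf)))}].
Proof.
move=> fz.
have [Lam [K [acL geL slL]]] := lyapunov hip alpha0 beta0 t00 x_ac y_ac g_ac phi_ac
  M_ac M_bd M_e phi_nonneg phi_slope_le ae_regM t01 t1ab t1_ge1 G_ge1 EG (phi_subgradient fz).
exists Lam, K; split=> //.
  by move=> a b ta ab; apply: acL => //; exact: lt_le_trans t01 ta.
apply: ae_imp slL => t Ht tt; apply: slope_le_weaken (Ht tt) => // s /=.
exact: lt_le_trans.
Qed.

Lemma E_vanishes eps : 0 < eps ->
  exists2 T, t1 <= T & forall t, T <= t -> E t <= eps.
Proof.
apply: (@energy_vanishes R t1 (alpha * beta) G Mb E M).
- exact: lt_trans t00 t01.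
- by rewrite mulr_ge0// ltW.
- by rewrite mulrA.
- exact: G_ge0.
- by move=> s t ts; apply: M_mono; exact: le_trans (ltW t01) ts.
- by move=> t tt; apply: M_bd; exact: le_trans (ltW t01) tt.
- exact: V_nonincreasing.
move=> {}eps eps0.
have [_ [z _ <-] fzl'] := lb_ereal_inf_adherent eps0 inf_fun_fin.
have fzl : (f z < inf_fun f + eps%:E)%E := fzl'.
have fz : f z \is a fin_num.
  rewrite fin_numElt ltNye f_notNy /= (lt_trans fzl)//.
  by rewrite -(fineK inf_fun_fin) -EFinD ltry.
exists (fine (f z) - finf); last exact: lyapunov_ex.
rewrite ltrBlDl -lte_fin (fineK fz) EFinD (fineK inf_fun_fin).
exact: fzl.
Qed.

(** The initial point [x t0] serves as reference: [f] is finite there and [x] tends to it. *)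
Lemma phi_bounded : exists B : R, forall t, t0 < t -> t <= t1 -> phi t <= B.
Proof.
have [K K0 HK] := trajectory_bounded alpha beta0 t00 ace cx cy t1.
have t0I : t0 <= t0 <= t1 by rewrite lexx ltW.
apply: (phi_bounded_near hip beta0 x_ac phi_ac phi_slope_le ae_regM t01 (K := K)
  (x0 := x t0) _ K0 _ (phi_subgradient fx0)).
- by move=> t tt tT; have [] := HK t (introT andP (conj (ltW tt) tT)).
- by have [] := HK t0 t0I.
move=> eps eps0.
have /subspace_continuousP cx' := cx.
have /cvgrPdist_lt c := cx' t0 (lexx t0).
have e1 : 0 < Num.min 1 eps by rewrite lt_min ltr01.
have := c _ e1; rewrite near_withinE => /nbhs_normP[d /= d0 Hd].
exists (t0 + d); first by rewrite ltrDl.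
move=> r tr rd; have := Hd r; rewrite /= => /(_ _ (ltW tr)) h.
have {h} : `|x t0 - x r| < Num.min 1 eps.
  by apply: h; rewrite distrC gtr0_norm ?subr_gt0// ltrBlDl.
rewrite distrC lt_min => /andP[h1 h2].
apply: le_lt_trans h2; rewrite expr2 -[leRHS]mulr1.
by apply: ler_wpM2l => //; exact: ltW.
Qed.

(** The dissipation estimate and the bound [G] start at [t1]. Before that, [g] is bounded, so [phi]
    loses [(beta / 2) |xi|^2] up to a constant, and it is bounded down to [t0]; the linear term
    [- l * s] compensates the constants. *)
Lemma left_piece (h : R -> R) (kappa lambda : R) : 0 <= kappa ->
  @measurable_fun _ _ CT R [set t | t0 <= t] h -> (forall t, t0 <= t -> 0 <= h t) ->
  (forall t, reg t -> t <= t1 -> h t <= kappa * ip (xi t) (xi t) + lambda) ->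
  exists K : R, (\int[cmu]_(t in `]t0, t1]) (h t)%:E <= K%:E)%E.
Proof.
move=> k0 mh h0 hle; have [B HB] := phi_bounded.
have [K K0 HK] := trajectory_bounded alpha beta0 t00 ace cx cy t1.
pose c := K ^+ 2 / (2 * beta).
pose k2 := kappa * (2 / beta).
have k20 : 0 <= k2 by apply: mulr_ge0 => //; apply: ltW; rewrite divr_gt0.
pose l := k2 * c + lambda.
exists (2 * (k2 * B + `|l| * t1)).
apply: (@integral_left_bound R t0 t1 _ (fun s => k2 * phi s + - l * s) h t01).
- move=> s ts st; apply: acD; apply: acM; try exact: ac_cst; last exact: ac_id.
  exact: phi_ac.
- move=> s ts st; apply: (le_trans (ler_normD _ _)); apply: lerD.
    rewrite normrM ger0_norm// ler_wpM2l// ger0_norm; first exact: HB.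
    exact: phi_nonneg.
  rewrite normrM normrN ler_wpM2l// gtr0_norm//; exact: lt_trans t00 ts.
- apply: measurable_funS mh; first exact: completed_measurable_half_line.
  by move=> t /=; rewrite in_itv/= => /andP[/ltW].
- by move=> t /andP[/ltW tt _]; exact: h0.
apply: ae_imp ae_reg => t Ht /andP[tt tt1]; have rt := Ht tt.
have [_ _ _ gK] := HK t (introT andP (conj (ltW tt) (ltW tt1))).
have D2 : is_derive t 1 (fun s => - l * s) (- l * 1) by exact: is_deriveZ.
have := slope_leD (slope_leZ k20 (phi_slope_const hip beta0 phi_slope_le rt gK))
  (slope_le_derive [set s | t0 < s] D2).
apply: slope_le_weaken; first by move=> s /= /andP[].
have := hle t rt (ltW tt1).
have -> : k2 * (K ^+ 2 / (2 * beta) - beta / 2 * ip (xi t) (xi t)) =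
   k2 * c - kappa * ip (xi t) (xi t) by rewrite /k2 /c; field; rewrite gt_eqF.
by rewrite /l mulr1; lra.
Qed.

(** From [t1] on, the bounded function [kappa * V] pays for [h] by its dissipation. *)
Lemma right_piece (h : R -> R) (kappa : R) : 0 <= kappa ->
  @measurable_fun _ _ CT R [set t | t0 <= t] h -> (forall t, t0 <= t -> 0 <= h t) ->
  (forall t, reg t -> t1 <= t ->
    h t <= kappa * (alpha / (2 * t) * ip (v t) (v t) + beta / 2 * ip (xi t) (xi t))) ->
  exists K : R, (\int[cmu]_(t in `]t1, +oo[) (h t)%:E <= K%:E)%E.
Proof.
move=> k0 mh h0 hle.
exists (2 * (kappa * (G + G * Mb))).
apply: (@integral_right_bound R t1 _ (fun s => kappa * V s) h).
- by move=> b tb; apply: acM; [exact: ac_cst|exact: V_abs_cont].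
- move=> s ts; rewrite normrM ger0_norm// ler_wpM2l//.
  have h1 := V_ge alpha beta e x y hip M_bd phi_nonneg t01 G_ge1 ts.
  have h2 := V_le M_bd t01 G_ge1 EG ts.
  have Mb0 : 0 <= Mb by have /andP[q1 q2] := M_bd (lexx t0); exact: le_trans q1 q2.
  have := mulr_ge0 G_ge0 Mb0; have := G_ge0; rewrite ler_norml.
  by move: h1 h2 => /= *; apply/andP; split; lra.
- apply: measurable_funS mh; first exact: completed_measurable_half_line.
  by move=> t /=; rewrite in_itv/= andbT => /(lt_trans t01)/ltW.
- by move=> t tt; apply: h0; exact: ltW (lt_trans t01 tt).
apply: ae_imp ae_regM => t Ht tt; have [rt DM] := Ht (lt_trans t01 tt).
have := slope_leZ k0 (V_slope_le rt DM (ltW tt)).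
apply: slope_le_weaken; first by move=> s /=; exact: lt_le_trans t01.
by have := hle t rt (ltW tt); lra.
Qed.

Lemma pieces_lty (h : R -> R) (K L : R) :
  @measurable_fun _ _ CT R [set t | t0 <= t] h -> (forall t, t0 <= t -> 0 <= h t) ->
  (\int[cmu]_(t in `]t0, t1]) (h t)%:E <= K%:E)%E ->
  (\int[cmu]_(t in `]t1, +oo[) (h t)%:E <= L%:E)%E ->
  cmu.-integrable [set t | t0 <= t] (fun t => (h t)%:E).
Proof.
move=> mh h0 hK hL; apply: (@integrable_ge0_lty _ CT R cmu _ h mh h0).
exact: (integral_half_line_lty t01 mh h0 hK hL).
Qed.

Lemma integrable_xi : cmu.-integrable [set t | t0 <= t] (fun t => (t^-1 * `|xi t| ^+ 2)%:E).
Proof.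
have h0 t : t0 <= t -> 0 <= t^-1 * `|xi t| ^+ 2.
  by move=> tt; rewrite mulr_ge0 ?exprn_ge0// invr_ge0 (le_trans (ltW t00)).
have [K hK] : exists K : R,
    (\int[cmu]_(t in `]t0, t1]) (t^-1 * `|xi t| ^+ 2)%:E <= K%:E)%E.
  apply: (left_piece (kappa := t0^-1) (lambda := 0) _ measurable_xi h0).
    by rewrite invr_ge0 ltW.
  move=> t rt _; rewrite addr0 (ipxx hip) ler_wpM2r ?exprn_ge0//.
  by have tt := reg_gt rt; rewrite lef_pV2 ?posrE ?(lt_trans t00 tt)// ltW.
have [L hL] : exists L : R,
    (\int[cmu]_(t in `]t1, +oo[) (t^-1 * `|xi t| ^+ 2)%:E <= L%:E)%E.
  apply: (right_piece (kappa := 2 / beta) _ measurable_xi h0).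
    by apply: ltW; rewrite divr_gt0.
  move=> t rt tt; have tp := lt_trans t00 (reg_gt rt).
  have h1 : 0 <= alpha / (2 * t) * ip (v t) (v t).
    rewrite (ipxx hip); apply: mulr_ge0; last exact: exprn_ge0.
    by apply: ltW; rewrite divr_gt0// mulr_gt0.
  have h2 : t^-1 * `|xi t| ^+ 2 <= ip (xi t) (xi t).
    rewrite (ipxx hip) ler_piMl ?exprn_ge0// invf_le1//; exact: le_trans t1_ge1 tt.
  apply: (le_trans h2).
  have b2 : 0 <= 2 / beta by apply: ltW; rewrite divr_gt0.
  have := mulr_ge0 b2 h1.
  have : 2 / beta * (beta / 2 * ip (xi t) (xi t)) = ip (xi t) (xi t).
    by field; rewrite gt_eqF.
  by move=> /=; lra.
exact: (pieces_lty measurable_xi h0 hK hL).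
Qed.

Lemma integrable_dx : cmu.-integrable [set t | t0 <= t]
  (fun t => (t^-1 * `|derive1 x t| ^+ 2)%:E).
Proof.
have h0 t : t0 <= t -> 0 <= t^-1 * `|derive1 x t| ^+ 2.
  by move=> tt; rewrite mulr_ge0 ?exprn_ge0// invr_ge0 (le_trans (ltW t00)).
have [Kg Kg0 HK] := trajectory_bounded alpha beta0 t00 ace cx cy t1.
have [K hK] : exists K : R,
    (\int[cmu]_(t in `]t0, t1]) (t^-1 * `|derive1 x t| ^+ 2)%:E <= K%:E)%E.
  (* The constants come from [|g - beta xi|^2 <= 2 |g|^2 + 2 beta^2 |xi|^2] and [1/t <= 1/t0]. *)
  apply: (left_piece (kappa := t0^-1 * (2 * beta ^+ 2))
    (lambda := t0^-1 * (2 * Kg ^+ 2)) _ measurable_dx h0).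
    by rewrite mulr_ge0 ?invr_ge0 ?(ltW t00)// mulr_ge0// sqr_ge0.
  move=> t rt tt1; have tt := reg_gt rt; have tp := lt_trans t00 tt.
  have [_ _ _ gK] := HK t (introT andP (conj (ltW tt) tt1)).
  rewrite (reg_dx rt) -[X in _ <= X + _]mulrA -mulrDr; apply: ler_pM.
  - by rewrite invr_ge0 ltW.
  - exact: exprn_ge0.
  - by rewrite lef_pV2 ?posrE// ltW.
  have g2 : `|g t| ^+ 2 <= Kg ^+ 2 by rewrite lerXn2r ?nnegrE.
  have : 0 <= ip (g t + beta *: xi t) (g t + beta *: xi t) by rewrite (ipxx hip) exprn_ge0.
  move: g2; rewrite -!(ipxx hip); move: (g t) (xi t) => g1 Xi; rewrite !(ipE hip).
  by rewrite (ipC hip Xi g1); lra.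
have [L hL] : exists L : R,
    (\int[cmu]_(t in `]t1, +oo[) (t^-1 * `|derive1 x t| ^+ 2)%:E <= L%:E)%E.
  apply: (right_piece (kappa := 2 / alpha) _ measurable_dx h0).
    by apply: ltW; rewrite divr_gt0.
  move=> t rt tt; have tp := lt_trans t00 (reg_gt rt).
  have h1 : 0 <= beta / 2 * ip (xi t) (xi t).
    rewrite (ipxx hip); apply: mulr_ge0; last exact: exprn_ge0.
    by apply: ltW; rewrite divr_gt0.
  have a2 : 0 <= 2 / alpha by apply: ltW; rewrite divr_gt0.
  have := mulr_ge0 a2 h1; rewrite (reg_dx rt) -(ipxx hip).
  have : 2 / alpha * (alpha / (2 * t) * ip (v t) (v t)) = t^-1 * ip (v t) (v t).
    by field; rewrite !gt_eqF.
  by move=> /=; lra.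
exact: (pieces_lty measurable_dx h0 hK hL).
Qed.

Local Notation work := (fun t => ip (g t) (e t + beta *: de t)).

Lemma work_le t : t1 <= t -> `|work t| <= G * m t.
Proof.
move=> tt; apply: (le_trans (ip_e_le alpha e de x y hip beta0 t)).
apply: ler_wpM2r; last exact: g_le.
by apply: addr_ge0 => //; apply: mulr_ge0 => //; exact: ltW.
Qed.

Lemma work_integrable t : t1 <= t ->
  cmu.-integrable [set s | t <= s] (fun s => (work s)%:E).
Proof.
move=> tt; have t0t := le_trans (ltW t01) tt.
have mD := completed_measurable_half_line t.
have mD0 := completed_measurable_half_line t0.
have iG := integrableZl mD G (perturbation_integrable t0t).
apply: (le_integrable mD _ _ iG).
  apply/measurable_EFinP; apply: measurable_funS measurable_work => //.
  by move=> s /=; exact: le_trans.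
move=> s /= ts; rewrite lee_fin.
exact: (le_trans (work_le (le_trans tt ts)) (ler_norm _)).
Qed.

Lemma work_tail eps : 0 < eps -> exists2 T, t1 <= T & forall t, T <= t ->
  (`|\int[cmu]_(s in [set s | (t <= s)%R]) (work s)%:E| <= eps%:E)%E.
Proof.
move=> eps0.
have iw := integrable_norm (work_integrable (lexx t1)).
have [T t1T HT] := tail_small (h := fun s => `|work s|) (fun t _ => normr_ge0 _) iw eps0.
exists T => // t Tt; apply: le_trans (HT t Tt).
have iwt := work_integrable (le_trans t1T Tt).
apply: (le_trans (le_abse_integral _ (completed_measurable_half_line t) _)) => //.
by case/integrableP: iwt.
Qed.

Local Notation W := (Wfun ip f alpha beta e de x y).

(** Up to a constant [W] is [E + F]; the derivative of [F] cancels the work term in the slope of [E]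
    and leaves only dissipation. *)
Lemma W_formula : exists (F : R -> R) (c : R),
  [/\ forall u v, abs_cont_on u v F,
     {ae cmu, forall t : R, t1 < t -> is_derive t 1 F (work t)} &
     forall t, t1 <= t -> W t = (E t + F t + (finf - c))%:E].
Proof.
have [F [c [acF DF Ec]]] := primitive_half_line (work_integrable (lexx t1)).
exists F, c; split=> // t tt.
have ft := fxt_fin (lt_le_trans t01 tt).
rewrite /Wfun Ec// -[X in (_ + X - _)%E](fineK ft) -EFinN -!EFinD.
by congr (_%:E); rewrite (ipxx hip); ring.
Qed.

Lemma W_nonincreasing s t : t1 <= s -> s <= t -> (W t <= W s)%E.
Proof.
move=> ts st; have [F [c [acF DF EW]]] := W_formula.
rewrite !EW ?(le_trans ts st)// lee_fin lerD2r.
have t0s := lt_le_trans t01 ts.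
have ac1 : abs_cont_on s t (fun r => E r + F r).
  by apply: acD => //; exact: (E_ac hip g_ac phi_ac t0s st).
apply: (ac_nonincreasing st ac1); apply: ae_imp2 ae_reg DF => r Hr DFr /andP[sr rt].
have rr := Hr (lt_trans t0s sr); have t1r := le_lt_trans ts sr.
have rab : alpha * beta <= r.
  have : 0 <= alpha * beta by apply: ltW; rewrite mulr_gt0.
  by move: t1ab (ltW t1r); lra.
have := slope_leD (E_dissipation hip alpha0 beta0 t00 phi_slope_le rr rab)
  (slope_le_derive [set s | t0 < s] (DFr t1r)).
apply: slope_le_weaken; first by move=> q /= /andP[h _]; exact: lt_le_trans t0s h.
by have := dissipation_ge0 (reg_gt rr) => /=; lra.
Qed.

Lemma W_cvg : W t @[t --> +oo] --> inf_fun f.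
Proof.
rewrite -(fineK inf_fun_fin); apply/cvg_EFin.
  exists t1; split; first exact: num_real.
  by move=> t /ltW tt; have [F [c [_ _ ->]]] := W_formula.
apply/cvgrPdist_le => eps eps0.
have e2 : 0 < eps / 2 by rewrite divr_gt0.
have [T1 t1T1 H1] := E_vanishes e2; have [T2 t1T2 H2] := work_tail e2.
exists (Num.max T1 T2); split; first exact: num_real.
move=> t; rewrite gt_max => /andP[/ltW h1 /ltW h2].
have tt := le_trans t1T1 h1.
have ft := fxt_fin (lt_le_trans t01 tt).
have fi := integrable_fin_num (completed_measurable_half_line t) (work_integrable tt).
have [J JE] : exists J : R, (\int[cmu]_(s in [set s | (t <= s)%R]) (work s)%:E = J%:E)%E.
  by exists (fine (\int[cmu]_(s in [set s | (t <= s)%R]) (work s)%:E)%E); rewrite fineK.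
have EW : fine (W t) = 2^-1 * `|g t| ^+ 2 + fine (f (x t)) - J.
  by rewrite /Wfun JE -[X in (_ + X - _)%E](fineK ft) -EFinN -!EFinD.
have HJ : `|J| <= eps / 2 by have := H2 t h2; rewrite JE lee_fin.
have p1 := H1 t h1; have p2 := E_nonneg (lt_le_trans t01 tt).
rewrite /= (ipxx hip) in p1 p2.
move: HJ; rewrite /= EW !ler_norml => /andP[p3 p4].
by apply/andP; split; lra.
Qed.

Lemma fx_cvg : f (x t) @[t --> +oo] --> inf_fun f.
Proof.
rewrite -(fineK inf_fun_fin); apply/cvg_EFin.
  exists t0; split; first exact: num_real.
  by move=> t tt; exact: fxt_fin.
apply/cvgrPdist_le => eps eps0; have [T t1T HT] := E_vanishes eps0.
exists T; split; first exact: num_real.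
move=> t /ltW Tt; have tt := lt_le_trans t01 (le_trans t1T Tt).
rewrite distrC ger0_norm; last exact: phi_nonneg.
apply: le_trans (HT t Tt); rewrite /= lerDr (ipxx hip).
by rewrite mulr_ge0 ?invr_ge0 ?exprn_ge0.
Qed.

Lemma g_small eps : 0 < eps -> exists2 T, t1 <= T & forall t, T <= t -> `|g t| < eps.
Proof.
move=> eps0; have e2 : 0 < eps ^+ 2 / 4 by rewrite divr_gt0 ?exprn_gt0.
have [T t1T HT] := E_vanishes e2; exists T => // t Tt.
have tt := lt_le_trans t01 (le_trans t1T Tt).
have := HT t Tt; have := phi_nonneg tt; rewrite /= (ipxx hip) => h1 h2.
rewrite -(@ltr_pXn2r _ 2) ?nnegrE ?(ltW eps0)//.
by have := exprn_gt0 2 eps0; lra.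
Qed.

Lemma g_cvg : `|g t| @[t --> +oo] --> 0.
Proof.
apply/cvgrPdist_lt => eps eps0; have [T _ HT] := g_small eps0.
exists T; split; first exact: num_real.
by move=> t /ltW Tt; rewrite sub0r normrN normr_id; exact: HT.
Qed.

Lemma ae_gradient_small eps : 0 < eps -> exists T, {ae cmu, forall t : R,
  T <= t -> `|derive1 x t + beta *: xi t| < eps}.
Proof.
move=> eps0; have [T t1T HT] := g_small eps0; exists T.
apply: ae_imp ae_reg => t Ht Tt.
have rt := Ht (lt_le_trans t01 (le_trans t1T Tt)).
by rewrite (reg_dx rt) subrK; exact: HT.
Qed.

Lemma weak_cluster_argmin (tn : nat -> R) (z : H) :
  tn n @[n --> \oo] --> +oo -> weak_cvg ip (fun n => x (tn n)) z -> argmin f z.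
Proof.
move=> tnoo; apply: (weak_limit_argmin hip hlsc hcvx) => a infa.
have e0 : 0 < a - finf by rewrite subr_gt0 -lte_fin (fineK inf_fun_fin).
have [T t1T HT] := E_vanishes e0.
have nearT : \forall t \near +oo, T <= t.
  by exists T; split; [exact: num_real|move=> t /ltW].
have : \forall n \near \oo, T <= tn n := tnoo _ nearT.
apply: filterS => n Tn.
have tt := lt_le_trans t01 (le_trans t1T Tn).
rewrite -(fineK (fxt_fin tt)) lee_fin.
have := HT _ Tn; rewrite /= (ipxx hip).
have : 0 <= 2^-1 * `|g (tn n)| ^+ 2 by rewrite mulr_ge0 ?invr_ge0 ?exprn_ge0.
by lra.
Qed.

Lemma weight_ge t : t1 <= t ->
  2^-1 * t^-1 <= t^-1 - alpha * beta * (t^-1 * t^-1).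
Proof.
move=> tt; have tp := lt_trans t00 (lt_le_trans t01 tt).
have i0 : 0 < t^-1 by rewrite invr_gt0.
have h : alpha * beta * t^-1 <= 4^-1 by rewrite ler_pdivrMr//; move: t1ab tt; lra.
by have := ler_wpM2r (ltW i0) h; lra.
Qed.

(** At a minimizer the offset [cz] is 0, so the slope is nonpositive and [Lam] is bounded above by
    its initial value as well. *)
Lemma lyapunov_argmin z : argmin f z -> exists (Lam : R -> R) (K : R),
  [/\ forall a b, t1 <= a -> a <= b -> abs_cont_on a b Lam,
      forall t, t1 <= t -> `|Lam t| <= K &
      {ae cmu, forall t : R, t1 < t -> slope_le [set s | t1 <= s] Lam t
        (- (2^-1 * t^-1 * E t))}].
Proof.
move=> zmin.
have fzE : f z = inf_fun f.
  apply/eqP; rewrite eq_le inf_fun_le andbT.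
  by apply: le_ereal_inf_tmp => _ [w _ <-]; exact: zmin.
have fz : f z \is a fin_num by rewrite fzE inf_fun_fin.
have [Lam [K [acL geL slL]]] := lyapunov_ex fz.
have slL' : {ae cmu, forall t : R, t1 < t -> slope_le [set s | t1 <= s] Lam t
        (- (2^-1 * t^-1 * E t))}.
  apply: ae_imp slL => t Ht tt; apply: slope_le_weaken (Ht tt) => //.
  rewrite fzE subrr subr0 mulNr lerN2; apply: ler_wpM2r.
    by apply: E_nonneg; exact: lt_trans t01 tt.
  exact: weight_ge (ltW tt).
exists Lam, (Num.max K (Lam t1)); split=> // t tt.
rewrite ler_norml; apply/andP; split.
  by rewrite lerNl (le_trans _ (_ : K <= _)) ?le_max ?lexx// lerNl; exact: geL.
rewrite le_max; apply/orP; right.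
apply: (ac_nonincreasing tt (acL _ _ (lexx t1) tt)).
apply: ae_imp slL' => s Hs /andP[ts st]; apply: slope_le_weaken (Hs ts).
  by move=> r /= /andP[].
have s0 := lt_trans t01 ts.
rewrite oppr_le0; apply: mulr_ge0; last exact: E_nonneg.
by apply: mulr_ge0; rewrite invr_ge0// ltW// (lt_trans t00 s0).
Qed.

Lemma phi_integral_lty : argmin f !=set0 ->
  (\int[cmu]_(t in [set t : R | (t0 <= t)%R])
       ((t^-1)%:E * (f (x t) - inf_fun f)) < +oo)%E.
Proof.
move=> [z zmin]; have [Lam [K [acL bdL slL]]] := lyapunov_argmin zmin.
have h0 t : t0 <= t -> 0 <= t^-1 * phi t.
  move=> tt; have tp := lt_le_trans t00 tt.
  apply: mulr_ge0; first by rewrite invr_ge0 ltW.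
  have [->|tN] := eqVneq t t0; last by apply: phi_nonneg; rewrite lt_neqAle eq_sym tN.
  by rewrite subr_ge0 -lee_fin (fineK inf_fun_fin) (fineK fx0) inf_fun_le.
have [B HB] := phi_bounded.
have [K1 hK1] : exists K1 : R,
    (\int[cmu]_(t in `]t0, t1]) (t^-1 * phi t)%:E <= K1%:E)%E.
  apply: (left_piece (kappa := 0) (lambda := t0^-1 * B) (lexx 0) measurable_phi h0).
  move=> t rt tt1; rewrite mul0r add0r; have tt := reg_gt rt.
  apply: ler_pM; rewrite ?invr_ge0 ?(ltW (lt_trans t00 tt))//.
  - exact: phi_nonneg.
  - by rewrite lef_pV2 ?posrE ?(lt_trans t00 tt)// ltW.
  - exact: HB.
have hK2 : (\int[cmu]_(t in `]t1, +oo[) (t^-1 * phi t)%:E <= (2 * (2 * K))%:E)%E.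
  (* The factor 2 offsets the [1/2] in the slope of [Lam], and [phi <= E]. *)
  apply: (@integral_right_bound R t1 _ (fun s => 2 * Lam s)).
  - by move=> b tb; apply: acM; [exact: ac_cst|exact: acL].
  - by move=> s ts; rewrite normrM ger0_norm// ler_wpM2l// bdL.
  - apply: measurable_funS measurable_phi; first exact: completed_measurable_half_line.
    by move=> t /=; rewrite in_itv/= andbT => /(lt_trans t01)/ltW.
  - by move=> t tt; apply: h0; exact: ltW (lt_trans t01 tt).
  apply: ae_imp slL => t Ht tt.
  have := slope_leZ (ler0n R 2) (Ht tt); apply: slope_le_weaken => //.
  have t0t := lt_trans t01 tt; have tp := lt_trans t00 t0t.
  rewrite mulrN lerN2 !mulrA mulfV// mul1r; apply: ler_wpM2l.
    by rewrite invr_ge0 ltW.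
  by rewrite /= lerDr (ipxx hip) mulr_ge0 ?invr_ge0 ?exprn_ge0.
have := integral_half_line_lty t01 measurable_phi h0 hK1 hK2.
congr (_ < _)%E; apply: eq_integral => t /set_mem /= tt.
have ft : f (x t) \is a fin_num.
  have [->//|tN] := eqVneq t t0.
  by apply: fxt_fin; rewrite lt_neqAle eq_sym tN.
by rewrite -[in RHS](fineK ft) -[in RHS](fineK inf_fun_fin) -EFinB -EFinM.
Qed.

(** [ln t * E t] gains [E / t] from the logarithm, which [2 * Lam] loses, and at most [G ln t m t]
    from the perturbation, which the primitive [L] of [ln t * m t] compensates. Hence [ln t * E t]
    is bounded. *)
Lemma log_rates : argmin f !=set0 ->
  cmu.-integrable [set t | t0 <= t] (fun t => (ln t * `|e t|)%:E) ->
  cmu.-integrable [set t | t0 <= t] (fun t => (ln t * `|de t|)%:E) ->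
  exists C T : R, forall t, T <= t ->
    (f (x t) - inf_fun f <= (C / ln t)%:E)%E /\ `|g t| <= C / Num.sqrt (ln t).
Proof.
move=> [z zmin] ile ilde; have [Lam [K [acL bdL slL]]] := lyapunov_argmin zmin.
have mD0 := completed_measurable_half_line t0.
have mD1 := completed_measurable_half_line t1.
have ln_ge0' t : t1 <= t -> 0 <= ln t by move=> tt; apply: ln_ge0; exact: le_trans t1_ge1 tt.
have il : cmu.-integrable [set t | t1 <= t] (fun t => (ln t * m t)%:E).
  have h1 := integrableD mD0 ile (integrableZl mD0 beta ilde).
  have h2 : cmu.-integrable [set t | t0 <= t] (fun t => (ln t * m t)%:E).
    apply: eq_integrable h1 => // t _.
    by rewrite /= -EFinM -EFinD; congr (_%:E); ring.
  by apply: integrableS h2 => // t /=; exact: le_trans (ltW t01).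
have m0 t : t1 <= t -> 0 <= ln t * m t.
  move=> tt; apply: mulr_ge0; first exact: ln_ge0'.
  by apply: addr_ge0 => //; apply: mulr_ge0 => //; exact: ltW.
have [L [LK [acL_ DL _ bdL_]]] := primitive_ge0 m0 il.
pose C0 := ln t1 * E t1 + 2 * Lam t1 - G * L t1 + 2 * K + G * LK.
have key t : t1 <= t -> ln t * E t <= C0.
  move=> tt; have tp : 0 < t1 := lt_trans t00 t01.
  pose F s := ln s * E s + 2 * Lam s + - G * L s.
  have acF : abs_cont_on t1 t F.
    apply: acD; last by apply: acM; [exact: ac_cst|exact: acL_].
    apply: acD; last by apply: acM; [exact: ac_cst|exact: acL].
    by apply: acM; [exact: ac_ln|exact: (E_ac hip g_ac phi_ac t01 tt)].
  have : F t <= F t1.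
    apply: (ac_nonincreasing tt acF).
    apply: ae_imp2 (ae_and ae_reg DL) slL => s [Hs DLs] sL /andP[ts st].
    have t0s := lt_trans t01 ts; have rs := Hs t0s; have sp := lt_trans t00 t0s.
    have sab : alpha * beta <= s.
      have : 0 <= alpha * beta by apply: ltW; rewrite mulr_gt0.
      by move: t1ab (ltW ts); lra.
    have sE := E_dissipation hip alpha0 beta0 t00 phi_slope_le rs sab.
    have sE' : slope_le [set s | t1 <= s] E s (G * m s).
      apply: slope_le_weaken sE; first by move=> r /=; exact: lt_le_trans t01.
      have := work_le (ltW ts); rewrite ler_norml => /andP[h1 _].
      by have := dissipation_ge0 t0s; move: h1 => /=; lra.
    have lnpos r : [set s | t1 <= s] r -> 0 <= ln r by exact: ln_ge0'.
    have slnE := slope_leM lnpos (ln_ge0' s (ltW ts)) (is_derive1_ln sp) sE'.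
    have D3 : is_derive s 1 (fun s => - G * L s) (- G * (ln s * m s)).
      exact: (is_deriveZ (- G) (DLs ts)).
    have := slope_leD (slope_leD slnE (slope_leZ (ler0n R 2) (sL ts)))
      (slope_le_derive [set s | t1 <= s] D3).
    apply: slope_le_weaken; first by move=> r /= /andP[].
    by rewrite le_eqVlt; apply/orP; left; apply/eqP; field; rewrite gt_eqF.
  have := bdL t tt; rewrite ler_norml => /andP[h1 _].
  have /andP[_ h2] := bdL_ t tt; have := ler_wpM2l G_ge0 h2.
  by rewrite /F /C0; move: h1 => /=; lra.
have C00 : 0 <= C0.
  apply: le_trans (key t1 (lexx t1)); apply: mulr_ge0; first exact: ln_ge0'.
  exact: E_nonneg.
(* One constant for both rates: [C0 <= 2 C0 + 1] for the values, [2 C0 <= (2 C0 + 1)^2] for the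
   squared norm. Beyond [t1 + 1] the logarithm is positive. *)
exists (2 * C0 + 1), (t1 + 1) => t tt.
have t1t : t1 <= t by lra.
have t0t := lt_le_trans t01 t1t.
have lnt : 0 < ln t by apply: ln_gt0; move: t1_ge1 tt; lra.
have hE : E t <= C0 / ln t by rewrite ler_pdivlMr// mulrC; exact: key.
have gn0 : 0 <= 2^-1 * `|g t| ^+ 2 by rewrite mulr_ge0 ?invr_ge0 ?exprn_ge0.
have ph := phi_nonneg t0t.
move: hE; rewrite /= (ipxx hip) => hE; split.
  rewrite -(fineK (fxt_fin t0t)) -(fineK inf_fun_fin) -EFinB lee_fin.
  have h : C0 / ln t <= (2 * C0 + 1) / ln t.
    by rewrite ler_pM2r ?invr_gt0//; lra.
  by move: gn0 hE h; rewrite /=; lra.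
have sq0 : 0 < Num.sqrt (ln t) by rewrite sqrtr_gt0.
rewrite ler_pdivlMr// -(@ler_pXn2r _ 2) ?nnegrE ?mulr_ge0 ?(ltW sq0)//; last first.
  by rewrite addr_ge0// mulr_ge0.
rewrite exprMn sqr_sqrtr ?(ltW lnt)//.
have h2 : `|g t| ^+ 2 * ln t <= 2 * C0.
  by rewrite -ler_pdivlMr//; move: hE ph gn0; rewrite /= -mulrA; lra.
by apply: (le_trans h2); nra.
Qed.

End Main.

Unset Implicit Arguments.

Theorem theorem11 (R : realType) (H : completeNormedModType R)
  (ip : H -> H -> R) (alpha beta t0 : R) (f : H -> \bar R)
  (e de x y xi : R -> H) :
  is_inner_product ip ->
  0 < alpha -> 0 < beta -> 0 < t0 ->
  proper_fun f -> lsc_fun f -> convex_fun f ->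
  (-oo < inf_fun f)%E ->
  (* e in W^{1,1}(t0,T;H) for all T > t0, with derivative de *)
  (forall T, t0 < T -> abs_cont_on t0 T e) ->
  {ae @completed_lebesgue_measure R, forall t, t0 < t -> is_derive t 1 e (de t)} ->
  (@completed_lebesgue_measure R).-integrable [set t | t0 <= t]
      (fun t => (`|e t|)%:E) ->
  (@completed_lebesgue_measure R).-integrable [set t | t0 <= t]
      (fun t => (`|de t|)%:E) ->
  (* (x, y) global strong solution with Cauchy datum x t0 in dom f *)
  f (x t0) \is a fin_num ->
  {within [set t | t0 <= t], continuous x} ->
  {within [set t | t0 <= t], continuous y} ->
  (forall a b, t0 < a -> a <= b -> abs_cont_on a b x /\ abs_cont_on a b y) ->
  {ae @completed_lebesgue_measure R, forall t, t0 < t ->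
     [/\ derivable x t 1, derivable y t 1, subdiff ip f (x t) (xi t),
         derive1 x t + beta *: xi t + beta *: e t - (beta^-1 - alpha / t) *: x t
           + beta^-1 *: y t = 0
       & derive1 y t - (beta^-1 - alpha / t + alpha * beta / t ^+ 2) *: x t
           + beta^-1 *: y t = 0]} ->
  let du := udot alpha beta e x y in
  let W := Wfun ip f alpha beta e de x y in
  (* (i) *)
  (exists t1, t0 <= t1 /\
     (forall t, t1 <= t ->
        (@completed_lebesgue_measure R).-integrable [set s | t <= s]
          (fun s => (ip (du s) (e s + beta *: de s))%:E)
        /\ f (x t) \is a fin_num) /\
     (forall s t, t1 <= s -> s <= t -> (W t <= W s)%E)) /\
  (* (ii) *)
  ((@completed_lebesgue_measure R).-integrable [set t | t0 <= t]
      (fun t => (t^-1 * `|derive1 x t| ^+ 2)%:E) /\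
   (@completed_lebesgue_measure R).-integrable [set t | t0 <= t]
      (fun t => (t^-1 * `|xi t| ^+ 2)%:E)) /\
  (* (iii) *)
  (W t @[t --> +oo] --> inf_fun f /\
   f (x t) @[t --> +oo] --> inf_fun f /\
   `|du t| @[t --> +oo] --> 0 /\
   (forall eps, 0 < eps -> exists T, {ae @completed_lebesgue_measure R,
      forall t, T <= t -> `|derive1 x t + beta *: xi t| < eps})) /\
  (* (iv) *)
  (forall (tn : nat -> R) (xbar : H),
     tn n @[n --> \oo] --> +oo -> weak_cvg ip (fun n => x (tn n)) xbar ->
     argmin f xbar) /\
  (* (v) *)
  (argmin f !=set0 ->
   (@completed_lebesgue_measure R).-integrable [set t | t0 <= t]
      (fun t => (ln t * `|e t|)%:E) ->
   (@completed_lebesgue_measure R).-integrable [set t | t0 <= t]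
      (fun t => (ln t * `|de t|)%:E) ->
   (exists C T : R, forall t, T <= t ->
       (f (x t) - inf_fun f <= (C / ln t)%:E)%E /\
       `|du t| <= C / Num.sqrt (ln t)) /\
   (\int[@completed_lebesgue_measure R]_(t in [set t : R | (t0 <= t)%R])
       ((t^-1)%:E * (f (x t) - inf_fun f)) < +oo)%E).
Proof.
move=> hip a0 b0 t00 fprop hlsc hcvx hinf ace aede ie ide fx0 cx cy acxy aesol du W.
have [M [Mb [M_ac M_d M_mono M_bd M_e]]] := perturbation_primitive hip b0 ace aede ie ide.
have [t1 [t01 t1ab t1_ge1]] : exists t1, [/\ t0 < t1, 4 * alpha * beta <= t1 & 1 <= t1].
  have ab0 : 0 < 4 * alpha * beta by apply: mulr_gt0 => //; apply: mulr_gt0.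
  by exists (t0 + 4 * alpha * beta + 1); split; lra.
have [G G1 EG] := energy_bounded hip a0 b0 t00 fprop hlsc hinf ace aede ie ide fx0 cx cy
  acxy aesol M_ac M_d M_bd t01 t1ab.
split.
  exists t1; split; [exact: ltW|split].
    move=> t tt; split; first by eapply (work_integrable hip a0 b0 t00); eassumption.
    have tt0 := lt_le_trans t01 tt.
    by eapply (fxt_fin hip a0 b0 t00); eassumption.
  by move=> s t ts st; eapply (W_nonincreasing hip a0 b0 t00); eassumption.
split.
  by split; [eapply (integrable_dx hip a0 b0 t00)|eapply (integrable_xi hip a0 b0 t00)]; eassumption.
split.
  split; first by eapply (W_cvg hip a0 b0 t00); eassumption.
  split; first by eapply (fx_cvg hip a0 b0 t00); eassumption.
  split; first by eapply (g_cvg hip a0 b0 t00); eassumption.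
  by move=> eps eps0; eapply (ae_gradient_small hip a0 b0 t00); eassumption.
split.
  by move=> tn z tnoo wz; eapply (weak_cluster_argmin hip a0 b0 t00); eassumption.
move=> amin ile ilde; split.
  by eapply (log_rates hip a0 b0 t00); eassumption.
by eapply (phi_integral_lty hip a0 b0 t00); eassumption.
Qed.
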